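(* Let $\mathfrak{P}$ be the category of Prüfer extensions, $\mathfrak{R}$ the category of Prüfer-Manis cr-qsrings, $\mathfrak{CP}\subseteq\mathfrak{P}$ the full subcategory of complete Prüfer extensions, $\mathfrak{CR}\subseteq\mathfrak{R}$ the full subcategory of those superrigid directed cr-qsrings which are complete and Prüfer-Manis in a strong sense, and let $\mathcal{B}:\mathfrak{R}\to\mathfrak{P}$ and $\mathcal{R}:\mathfrak{P}\to\mathfrak{R}$ be the covariant functors $R\mapsto (A_R\subseteq B_R)$ and $(A\subseteq B)\mapsto R_{B/A}$ (all defined in the context). Then: (1) The functor $\mathcal{R}:\mathfrak{P}\to\mathfrak{R}$ is the left adjoint of the functor $\mathcal{B}:\mathfrak{R}\to\mathfrak{P}$. (2) The endofunctor $\mathcal{B}\circ\mathcal{R}:\mathfrak{P}\to\mathfrak{P}$, factorizing through $\mathfrak{CP}$, sends a Prüfer extension $A\subseteq B$ to its completion $\widehat{A}:=\varprojlim_{\alpha\in (M_{B/A}^\ast)_+}A/\alpha\ \subseteq\ \widehat{B}:=\varprojlim_{\alpha\in (M_{B/A}^\ast)_+}B/\alpha$. (3) By restriction, $\mathcal{R}$ and $\mathcal{B}$ yield inverse equivalences of the categories $\mathfrak{CP}$ and $\mathfrak{CR}$.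
   Context: **Abelian $l$-groups.** An Abelian $l$-group $\Lambda$ is written multiplicatively, neutral element $\varepsilon$, order $\le$, lattice operations $\wedge,\vee$, and $\Lambda_+=\{\alpha\in\Lambda: \alpha\ge\varepsilon\}$. The convex hull of a subset $X$ is $\{\gamma : a\le\gamma\le b \text{ for some } a,b\in X\}$. $\widehat\Lambda$ is the set of maps $\varphi:\Lambda_+\to\Lambda$ with $\varphi(\alpha)=\varphi(\beta)\wedge\alpha$ whenever $\alpha\le\beta$, with pointwise order and lattice operations and product $(\varphi\psi)(\alpha)=(\varphi(\alpha\psi_-)\psi(\alpha\varphi_-))\wedge\alpha$, where $\varphi_-:=\varphi(\varepsilon)^{-1}$; $\Lambda$ is embedded in $\widehat\Lambda$ by $\gamma\mapsto(\alpha\mapsto\gamma\wedge\alpha)$. **cr-qsrings.** A commutative semigroup $S$ is regular if each $x\in S$ has some $y$ with $x^2y=x$; then there is a unique quasi-inverse $x^{-1}$ with $x^2x^{-1}=x$, $(x^{-1})^2x=x^{-1}$. A cr-qsring is an algebra $(R,+,\bullet,-,{}^{-1},\varepsilon)$ of signature $(2,2,1,1,0)$ such that, writing $e^+(x):=x+(-x)$, $e^\bullet(x):=x\bullet x^{-1}$, $E^+:=\{x: x+x=x\}$, $E^\bullet:=\{x: x\bullet x=x\}$ and $x\le y :\Leftrightarrow x=y+e^+(x)$: (1) $(R,+)$ and $(R,\bullet)$ are commutative regular semigroups with quasi-inverses $-x$ and $x^{-1}$; (2) $E^+\cap E^\bullet=\{\varepsilon\}$; (3') $x\bullet y+x\bullet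 z\le x\bullet(y+z)$; (4) $y\le z\Rightarrow x\bullet y\le x\bullet z$; (5) $-(x\bullet y)=x\bullet(-y)$; (6) $e^+(x+y)\le e^+(x\bullet y)$ for $x,y\in E^\bullet$. Put $x-y:=x+(-y)$, $v(x):=\varepsilon\bullet x$. Then $\Lambda:=E^+(R):=(E^+,\bullet,\wedge,\vee)$ with $e\wedge f=e+f$, $e\vee f=(e^{-1}+f^{-1})^{-1}$ is an Abelian $l$-group with neutral element $\varepsilon$, and $v:R\to E^+$. $R$ is directed if $\varepsilon\le x$ for all $x\in E^\bullet$. A directed cr-qsring is superrigid if the (always injective) map $e^+|_{E^\bullet}:E^\bullet\to\Lambda_+$ is surjective; then $1_\alpha$ denotes the unique element of $E^\bullet$ with $e^+(1_\alpha)=\alpha$ ($\alpha\in\Lambda_+$). $R$ is complete if for every $x\in R$ there is a map $\varphi:\Lambda\to R$ with $e^+(\varphi(\alpha))=\alpha$ for all $\alpha$, $\varphi(\alpha)\le\varphi(\beta)$ whenever $\alpha\le\beta$, and $\varphi(e^+(x))=x$. **The ring extension of a superrigid $R$.** $B_R$ is the set of maps $\varphi:\Lambda_+\to R$ with $e^+(\varphi(\alpha))=\alpha$ for all $\alpha$ and $\varphi(\alpha)\le\varphi(\beta)$ for $\alpha\le\beta$; it is a commutative unital ring with pointwise $+,-$, zero $\alpha\mapsto\alpha$, unit $\alpha\mapsto 1_\alpha$ and product $(\varphi\cdot\psi)(\alpha)=\varphi(\alpha\bullet v(\psi(\varepsilon))^{-1})\bullet\psi(\alpha\bullet v(\varphi(\varepsilon))^{-1})+\alpha$.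 Put $w:B_R\to\widehat\Lambda$, $w(\varphi):=v\circ\varphi$, and $A_R:=\{\varphi\in B_R: w(\varphi)\ge\varepsilon\}=\{\varphi:\varphi(\varepsilon)=\varepsilon\}$, a subring. **Prüfer extensions.** A commutative unital ring extension $A\subseteq B$ is Prüfer if every subring of $B$ containing $A$ is integrally closed in $B$. $M_{B/A}$ is the commutative monoid of finitely generated $A$-submodules of $B$ under multiplication (neutral element $A$), ordered by $I\le J\Leftrightarrow J\subseteq I$, with meet $I\wedge J=I+J$; $M_{B/A}^\ast$ is its group of invertible elements, which for a Prüfer extension is an Abelian $l$-group ($I\wedge J=I+J$, $I\vee J=I\cap J$), and $(M^\ast_{B/A})_+=\{\alpha\in M^\ast_{B/A}:\alpha\subseteq A\}$. The Prüfer extension is complete if the canonical maps $A\to\varprojlim_{\alpha\in(M^\ast_{B/A})_+}A/\alpha$ and $B\to\varprojlim_{\alpha\in(M^\ast_{B/A})_+}B/\alpha$ are isomorphisms. **Prüfer-Manis.** A superrigid directed cr-qsring $R$ is Prüfer if $A_R\subseteq B_R$ is a Prüfer extension. With $M:=M_{B_R/A_R}$, let $\widehat w:M\to\widehat\Lambda$, $\widehat w(\sum_i A_R\varphi_i):=\bigwedge_i w(\varphi_i)$, and let $\widehat w(M)^\ast$ be the group of invertible elements of the monoid $\widehat w(M)$ (for $R$ Prüfer, $\widehat w$ restricts to an isomorphism $M^\ast\cong\widehat w(M)^\ast\subseteq\Lambda$). A Prüfer cr-qsring $R$ is Prüfer-Manis if $\Lambda$ is the convex hull of $\widehat w(M)^\ast$,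 and Prüfer-Manis in a strong sense if $\widehat w(M)^\ast=\Lambda$. **Categories and functors.** $\mathfrak{P}$: objects are Prüfer extensions $A\subseteq B$; morphisms $g:(A\subseteq B)\to(A'\subseteq B')$ are unital ring morphisms $g:B\to B'$ with $g(A)\subseteq A'$ such that $M^\ast_{B'/A'}$ is the convex hull of $\{A'g(\mathbf a):\mathbf a\in M^\ast_{B/A}\}$. $\mathfrak{R}$: objects are Prüfer-Manis cr-qsrings; morphisms are homomorphisms of algebras $f:R\to R'$ such that $\Lambda'=E^+(R')$ is the convex hull of $f(\Lambda)$. $\mathcal B(R):=(A_R\subseteq B_R)$; for $f:R\to R'$, $\mathcal B(f)(\varphi)(\alpha'):=f(\varphi(\alpha))+\alpha'$ for $\varphi\in B_R$, $\alpha'\in\Lambda'_+$ and any $\alpha\in\Lambda_+$ with $f(\alpha)\ge\alpha'$. $\mathcal R(A\subseteq B):=R_{B/A}:=\bigsqcup_{\alpha\in\Lambda}B/\alpha$ with $\Lambda:=M^\ast_{B/A}$, and operations, for $\mathbf x=x\bmod\alpha$, $\mathbf y=y\bmod\beta$: $\mathbf x+\mathbf y=(x+y)\bmod(\alpha+\beta)$; $-\mathbf x=(-x)\bmod\alpha$; $\mathbf x\bullet\mathbf y=xy\bmod(\alpha\beta+x\beta+y\alpha)$; $\mathbf x^{-1}=z\bmod\alpha v(\mathbf x)^{-2}$, where $v(\mathbf x):=\alpha+Ax\in\Lambda$ and $z\in v(\mathbf x)^{-1}$ is such that $xz\equiv1\bmod v(\mathbf x)^{-1}\alpha$; $\varepsilon=0\bmod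 A$. Here $\Lambda$ is identified with $E^+(R_{B/A})$ via $\alpha\mapsto 0\bmod\alpha$. On a morphism $g:(A\subseteq B)\to(A'\subseteq B')$, $\mathcal R(g)(x\bmod\alpha)=g(x)\bmod A'g(\alpha)$. *)

(* Defs.v *)
From HB Require Import structures.
From mathcomp Require Import all_boot all_algebra.
From mathcomp Require Import boolp classical_sets functions.

Set Implicit Arguments.
Unset Strict Implicit.
Unset Printing Implicit Defensive.

Import GRing.Theory.

Local Open Scope classical_set_scope.

(** The convex hull of [X] in the set [L] ordered by [le]. *)
Definition convex_hull (T : Type) (L : set T) (le : T -> T -> Prop)
    (X : set T) : set T :=
  [set c | L c /\ exists a b, [/\ X a, X b, le a c & le c b]].

(** * Commutative regular semigroups *)

Record is_cr_semigroup (T : Type) (op : T -> T -> T) (inv : T -> T) : Prop := {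
  crsA : associative op;
  crsC : commutative op;
  crsK : forall x, op (op x x) (inv x) = x;
  crsV : forall x, op (op (inv x) (inv x)) x = inv x
}.

Section CrSemigroup.
Context (T : Type) (op : T -> T -> T) (inv : T -> T).
Context (H : is_cr_semigroup op inv).
Local Infix "*" := op.
Let e x := x * inv x.
Let A := crsA H.
Let C := crsC H.

Lemma crs_CA x y z : x * (y * z) = y * (x * z).
Proof. by rewrite A (C x) -A. Qed.

Lemma crs_ACA x y z t : (x * y) * (z * t) = (x * z) * (y * t).
Proof. by rewrite -!A (crs_CA y). Qed.

Lemma crs_xe x : x * e x = x.
Proof. by rewrite /e A (crsK H). Qed.

Lemma crs_ve x : inv x * e x = inv x.
Proof. by rewrite /e (C x) A (crsV H). Qed.

Lemma crs_ee x : e x * e x = e x.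
Proof. by rewrite {1}/e -A crs_ve. Qed.

Lemma crs_uniq x y z : x * x * y = x -> y * y * x = y ->
  x * x * z = x -> z * z * x = z -> y = z.
Proof.
move=> xy yx xz zx.
have ef : x * y = (x * y) * (x * z) by rewrite crs_ACA (C y) A xz.
have fe : x * z = (x * y) * (x * z) by rewrite (C (x * y)) crs_ACA (C z) A xy.
have E : x * y = x * z by rewrite ef -fe.
by rewrite -yx -A (C y x) E crs_CA (C y z) crs_CA E (C x z) A zx.
Qed.

Lemma crs_invU x y : x * x * y = x -> y * y * x = y -> inv x = y.
Proof. by move=> a b; apply: (@crs_uniq x) => //; [exact: (crsK H)|exact: (crsV H)]. Qed.

Lemma crs_inv_idem x : x * x = x -> inv x = x.
Proof. by move=> xx; apply: crs_invU; rewrite !xx. Qed.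

Lemma crs_e_idem x : x * x = x -> e x = x.
Proof. by move=> xx; rewrite /e crs_inv_idem. Qed.

Lemma crs_invM x y : inv (x * y) = inv x * inv y.
Proof.
apply: crs_invU.
  by rewrite (crs_ACA x y) crs_ACA !(crsK H).
by rewrite (crs_ACA (inv x) (inv y)) crs_ACA !(crsV H).
Qed.

Lemma crs_invK x : inv (inv x) = x.
Proof. by apply: crs_invU; [exact: (crsV H)|exact: (crsK H)]. Qed.

Lemma crs_eM x y : e (x * y) = e x * e y.
Proof. by rewrite /e crs_invM crs_ACA. Qed.

Lemma crs_ev x : e (inv x) = e x.
Proof. by rewrite /e crs_invK C. Qed.

Lemma crs_e_e x : e (e x) = e x.
Proof. exact/crs_e_idem/crs_ee. Qed.

End CrSemigroup.

(** * cr-qsrings *)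

Record qsalg := QSAlg {
  qs_sort :> Type;
  qs_add : qs_sort -> qs_sort -> qs_sort;
  qs_mul : qs_sort -> qs_sort -> qs_sort;
  qs_opp : qs_sort -> qs_sort;
  qs_inv : qs_sort -> qs_sort;
  qs_eps : qs_sort
}.

Declare Scope qs_scope.
Delimit Scope qs_scope with qs.
Notation "x + y" := (qs_add x y) : qs_scope.
Notation "x * y" := (qs_mul x y) : qs_scope.
Notation "- x" := (qs_opp x) : qs_scope.
Notation "x - y" := (qs_add x (qs_opp y)) : qs_scope.
Notation "x ^-1" := (qs_inv x) : qs_scope.
Local Open Scope qs_scope.

Arguments qs_eps {q}.
Notation eps := (@qs_eps _).

Definition ep (R : qsalg) (x : R) : R := x + - x.
Definition em (R : qsalg) (x : R) : R := x * x^-1.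
Definition Ep (R : qsalg) : set R := [set x | x + x = x].
Definition Em (R : qsalg) : set R := [set x | x * x = x].
Definition qle (R : qsalg) (x y : R) : Prop := x = y + ep x.
Definition qv (R : qsalg) (x : R) : R := eps * x.
Arguments Ep : clear implicits.
Arguments Em : clear implicits.

Notation "x <= y" := (qle x y) : qs_scope.

Record is_crqsring (R : qsalg) : Prop := {
  cq_add : is_cr_semigroup (@qs_add R) (@qs_opp R);
  cq_mul : is_cr_semigroup (@qs_mul R) (@qs_inv R);
  cq_eps : Ep R `&` Em R = [set eps];
  cq_subD : forall x y z : R, x * y + x * z <= x * (y + z);
  cq_mono : forall x y z : R, y <= z -> x * y <= x * z;
  cq_oppM : forall x y : R, - (x * y) = x * - y;
  cq_em : forall x y : R, Em R x -> Em R y -> ep (x + y) <= ep (x * y)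
}.

(** The carrier of the Abelian l-group Lambda is [Ep R]; its product is [*],
    its meet is [+], its order is [qle] and its neutral element is [eps]. *)
Definition LamP (R : qsalg) : set R := [set a | Ep R a /\ eps <= a].
Arguments LamP : clear implicits.

Definition directed (R : qsalg) : Prop := forall x : R, Em R x -> eps <= x.

Definition superrigid (R : qsalg) : Prop :=
  forall a : R, LamP R a -> exists2 x, Em R x & ep x = a.

Definition qs_complete (R : qsalg) : Prop :=
  forall x : R, exists phi : Ep R -> R,
    [/\ forall a : Ep R, ep (phi a) = val a,
        forall a b : Ep R, val a <= val b -> phi a <= phi b
      & forall a : Ep R, val a = ep x -> phi a = x].

Record crqsring := CrQsring {
  cq_alg :> qsalg;
  cq_ax : is_crqsring cq_alg
}.

Record srqsring := SrQsring {
  sr_cq :> crqsring;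
  sr_dir : directed sr_cq;
  sr_sur : superrigid sr_cq
}.

Section CrQsringTheory.
Context (R : crqsring).
Implicit Types x y z a b c : R.
Let P := cq_ax R.
Let HA := cq_add P.
Let HM := cq_mul P.

Lemma qaddA x y z : x + (y + z) = x + y + z. Proof. exact: (crsA HA). Qed.
Lemma qaddC x y : x + y = y + x. Proof. exact: (crsC HA). Qed.
Lemma qaddCA x y z : x + (y + z) = y + (x + z). Proof. exact: (crs_CA HA). Qed.
Lemma qaddAC x y z : x + y + z = x + z + y.
Proof. by rewrite -!qaddA (qaddC y). Qed.
Lemma qaddACA x y z t : (x + y) + (z + t) = (x + z) + (y + t).
Proof. exact: (crs_ACA HA). Qed.
Lemma qmulA x y z : x * (y * z) = x * y * z. Proof. exact: (crsA HM). Qed.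
Lemma qmulC x y : x * y = y * x. Proof. exact: (crsC HM). Qed.
Lemma qmulCA x y z : x * (y * z) = y * (x * z). Proof. exact: (crs_CA HM). Qed.
Lemma qmulACA x y z t : (x * y) * (z * t) = (x * z) * (y * t).
Proof. exact: (crs_ACA HM). Qed.

Lemma qadd_ep x : x + ep x = x. Proof. exact: (crs_xe HA). Qed.
Lemma Ep_ep x : Ep R (ep x). Proof. exact: (crs_ee HA). Qed.
Lemma ep_id a : Ep R a -> ep a = a. Proof. exact: (crs_e_idem HA). Qed.
Lemma epD x y : ep (x + y) = ep x + ep y. Proof. exact: (crs_eM HA). Qed.
Lemma epN x : ep (- x) = ep x. Proof. exact: (crs_ev HA). Qed.
Lemma ep_ep x : ep (ep x) = ep x. Proof. exact: (crs_e_e HA). Qed.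
Lemma qoppD x y : - (x + y) = - x + - y. Proof. exact: (crs_invM HA). Qed.
Lemma qopp_id a : Ep R a -> - a = a. Proof. exact: (crs_inv_idem HA). Qed.
Lemma qmul_em x : x * em x = x. Proof. exact: (crs_xe HM). Qed.
Lemma Em_em x : Em R (em x). Proof. exact: (crs_ee HM). Qed.
Lemma em_id x : Em R x -> em x = x. Proof. exact: (crs_e_idem HM). Qed.
Lemma emM x y : em (x * y) = em x * em y. Proof. exact: (crs_eM HM). Qed.

Lemma Ep_eps : Ep R eps.
Proof. by have [] : (Ep R `&` Em R) eps by rewrite (cq_eps P). Qed.
Lemma Em_eps : Em R eps.
Proof. by have [] : (Ep R `&` Em R) eps by rewrite (cq_eps P). Qed.
Lemma EpEm_eps x : Ep R x -> Em R x -> x = eps.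
Proof. by move=> p m; have : (Ep R `&` Em R) x by []; rewrite (cq_eps P). Qed.

Lemma EpD a b : Ep R a -> Ep R b -> Ep R (a + b).
Proof. by move=> pa pb; rewrite /Ep /= qaddACA pa pb. Qed.

Lemma qle_refl x : x <= x. Proof. by rewrite /qle qadd_ep. Qed.

Lemma qle_ep x y : x <= y -> ep x = ep y + ep x.
Proof. by move=> /(congr1 (@ep R)); rewrite epD ep_ep. Qed.

Lemma qle_trans y x z : x <= y -> y <= z -> x <= z.
Proof.
by move=> xy yz; rewrite /qle {1}xy {1}yz -qaddA -(qle_ep xy).
Qed.

Lemma qle_eq x y : x <= y -> ep x = ep y -> x = y.
Proof. by move=> xy E; rewrite xy E qadd_ep. Qed.

Lemma qle_anti x y : x <= y -> y <= x -> x = y.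
Proof.
move=> xy yx; apply: qle_eq => //.
by rewrite (qle_ep xy) qaddC -(qle_ep yx).
Qed.

Lemma qleE a b : Ep R a -> (a <= b) = (a = b + a).
Proof. by move=> pa; rewrite /qle (ep_id pa). Qed.

Lemma qleDl x y : Ep R y -> x + y <= x.
Proof. by move=> py; rewrite /qle epD (ep_id py) qaddA qadd_ep. Qed.

Lemma qleDr x y : Ep R y -> Ep R x -> x + y <= y.
Proof. by move=> py px; rewrite qaddC; apply: qleDl. Qed.

Lemma qle_glb a b c : Ep R a -> a <= b -> a <= c -> a <= b + c.
Proof.
move=> pa; rewrite !qleE // => ab ac; by rewrite -qaddA -ac.
Qed.

Lemma qle_restr x y a : Ep R a -> x <= y -> a <= ep x -> x + a = y + a.
Proof.
move=> pa xy; rewrite qleE // => ax.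
by rewrite {1}xy -qaddA -ax.
Qed.

Lemma qleM x y z : y <= z -> x * y <= x * z. Proof. exact: cq_mono. Qed.
Lemma qleMM x y z t : x <= y -> z <= t -> x * z <= y * t.
Proof.
move=> xy zt; apply: (@qle_trans (x * t)); first exact: qleM.
by rewrite !(qmulC _ t); apply: qleM.
Qed.

Lemma qmulN x y : x * - y = - (x * y). Proof. by rewrite (cq_oppM P). Qed.

Lemma EpM x a : Ep R a -> Ep R (x * a).
Proof.
move=> pa; have := cq_subD P x a a; rewrite pa => /qle_eq; apply.
by rewrite epD Ep_ep.
Qed.

Lemma EpMr x a : Ep R a -> Ep R (a * x).
Proof. by rewrite qmulC; apply: EpM. Qed.

Lemma Ep_v x : Ep R (qv x). Proof. exact/EpMr/Ep_eps. Qed.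

Lemma EpV_eps a : Ep R a -> a * a^-1 = eps.
Proof. by move=> pa; apply: EpEm_eps; [exact: EpMr|exact: Em_em]. Qed.

Lemma EpV a : Ep R a -> Ep R a^-1.
Proof.
move=> pa; rewrite -(crs_ve HM a) -/(em a) /em EpV_eps //.
exact/EpM/Ep_eps.
Qed.

Lemma eps_mul a : Ep R a -> eps * a = a.
Proof. by move=> pa; rewrite -(EpV_eps pa) qmulC; apply: qmul_em. Qed.

Lemma v_id a : Ep R a -> qv a = a. Proof. exact: eps_mul. Qed.

Lemma vM x y : qv (x * y) = qv x * qv y.
Proof. by rewrite /qv qmulACA Em_eps. Qed.

Lemma mul_Ep x a : Ep R a -> x * a = qv x * a.
Proof. by move=> pa; rewrite -{1}(eps_mul pa) qmulA (qmulC x). Qed.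

Lemma v_Em x : Em R x -> qv x = eps.
Proof.
move=> mx; apply: EpEm_eps; first exact: Ep_v.
by rewrite /Em /= -vM mx.
Qed.

Lemma v_mono x y : x <= y -> qv x <= qv y. Proof. exact: qleM. Qed.

Lemma ep_mul_le x y : ep (x * y) <= qv x * ep y.
Proof.
rewrite -mul_Ep; last exact: Ep_ep.
by rewrite {1}/ep -qmulN; apply: cq_subD.
Qed.

Lemma v_le_ep x : qv x <= ep x.
Proof.
have := ep_mul_le eps x; rewrite (v_id Ep_eps) (eps_mul (Ep_ep x)).
by rewrite -/(qv x) (ep_id (Ep_v x)).
Qed.

Lemma vV x : qv x * qv x^-1 = eps.
Proof. by rewrite -vM; apply/v_Em/Em_em. Qed.

Lemma ep_em x : ep x = qv x * ep (em x).
Proof.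
apply: qle_anti; first by rewrite -{1}(qmul_em x); apply: ep_mul_le.
have : ep (em x) <= qv x^-1 * ep x by rewrite /em qmulC; apply: ep_mul_le.
move=> /(qleM (qv x)); rewrite qmulA vV eps_mul //; exact: Ep_ep.
Qed.

Lemma EpDM a b c : Ep R a -> Ep R b -> Ep R c -> a * (b + c) = a * b + a * c.
Proof.
move=> pa pb pc; apply: qle_anti; last exact: cq_subD.
apply: qle_glb; first exact/EpM/EpD.
  exact/qleM/qleDl.
exact/qleM/qleDr.
Qed.

Lemma ep_mul x y : ep (x * y) = qv y * ep x + qv x * ep y.
Proof.
apply: qle_anti.
  apply: qle_glb; [exact: Ep_ep| |exact: ep_mul_le].
  by rewrite qmulC; apply: ep_mul_le.
have := cq_em P (Em_em x) (Em_em y); rewrite -emM epD.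
move=> /(qleM (qv x * qv y)); rewrite -vM -ep_em vM.
rewrite EpDM; [|exact/EpMr/Ep_v|exact: Ep_ep|exact: Ep_ep].
rewrite -(qmulA (qv x) (qv y) (ep (em y))) -ep_em.
by rewrite (qmulC (qv x) (qv y)) -(qmulA (qv y) (qv x)) -ep_em.
Qed.

Lemma ep_em_le x : ep x * (qv x)^-1 = ep (em x).
Proof.
rewrite ep_em qmulC qmulA (qmulC _ (qv x)) EpV_eps ?eps_mul //.
  exact: Ep_ep.
exact: Ep_v.
Qed.

Lemma LamP_eps : LamP R eps.
Proof. by split; [exact: Ep_eps | exact: qle_refl]. Qed.

Lemma LamPD a b : LamP R a -> LamP R b -> LamP R (a + b).
Proof.
move=> [pa ea] [pb eb]; split; first exact: EpD.
by apply: qle_glb => //; exact: Ep_eps.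
Qed.

Lemma EpV_ge a : Ep R a -> a <= eps -> eps <= a^-1.
Proof.
move=> pa /(qleM a^-1); rewrite qmulC EpV_eps // qmulC eps_mul //.
exact: EpV.
Qed.

Lemma EpM_ge a b : Ep R a -> eps <= b -> a <= a * b.
Proof. by move=> pa /(qleM a); rewrite qmulC eps_mul. Qed.

Lemma LamPM a b : LamP R a -> LamP R b -> LamP R (a * b).
Proof.
move=> [pa ea] [pb eb]; split; first exact: EpM.
by apply: qle_trans ea _; apply: EpM_ge.
Qed.

Lemma LamPV a : Ep R a -> a <= eps -> LamP R a^-1.
Proof. by move=> pa ea; split; [exact: EpV | exact: EpV_ge]. Qed.

Lemma LamP_trans a b : LamP R a -> Ep R b -> a <= b -> LamP R b.
Proof. by move=> [pa ea] pb ab; split=> //; apply: qle_trans ab. Qed.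

End CrQsringTheory.

Section Directed.
Context (R : srqsring).
Implicit Types x y z a b c u w : R.
Let P := cq_ax R.

Lemma Em_LamP u : Em R u -> LamP R (ep u).
Proof.
move=> mu; split; first exact: Ep_ep.
by rewrite (qleE _ (@Ep_eps R)) -{1}(ep_id (@Ep_eps R)) (qle_ep (sr_dir mu))
  (ep_id (@Ep_eps R)).
Qed.

Lemma Em_eps_ep u : Em R u -> ep u = eps -> u = eps.
Proof.
move=> mu eu; have := sr_dir mu.
by move=> /qle_eq <- //; rewrite eu ep_id //; exact: Ep_eps.
Qed.

Lemma Em_inj_aux u w : Em R u -> Em R w -> u * w = w -> ep u = ep w -> u = w.
Proof.
move=> mu mw uw E; pose d : R := u + - w.
have ed : ep d = ep w by rewrite /d epD epN E Ep_ep.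
have H1 : ep w <= w * d.
  have := cq_subD P w u (- w); rewrite qmulN mw qmulC uw; exact.
have H2 : ep w * d^-1 <= w * em d.
  by rewrite /em qmulA !(qmulC _ d^-1); apply: qleM.
have := v_mono H2; rewrite (vM w) (v_Em mw) (v_Em (Em_em d)) Em_eps.
rewrite (v_id (EpMr _ (Ep_ep w))) qmulC (mul_Ep _ (Ep_ep w)).
move=> /(qleM (qv d)); rewrite qmulA vV (eps_mul (Ep_ep w)).
rewrite (qmulC (qv d)) (eps_mul (Ep_v d)).
move=> H3; have H4 := v_le_ep d; rewrite ed in H4.
have vd := qle_anti H4 H3.
have emd : em d = eps.
  apply: Em_eps_ep; first exact: Em_em.
  by rewrite -ep_em_le ed vd EpV_eps //; apply: Ep_ep.
have dE : d = ep w by rewrite -(qmul_em d) emd qmulC -vd.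
by rewrite -(qadd_ep u) E /ep qaddCA qaddC -/d dE qaddC qadd_ep.
Qed.

Lemma ep_mulEm u w : Em R u -> Em R w -> ep (u * w) = ep u + ep w.
Proof.
by move=> mu mw; rewrite ep_mul !v_Em // !eps_mul //; exact: Ep_ep.
Qed.

Lemma EmM u w : Em R u -> Em R w -> Em R (u * w).
Proof. by move=> mu mw; rewrite /Em /= qmulACA mu mw. Qed.

Lemma Em_inj u w : Em R u -> Em R w -> ep u = ep w -> u = w.
Proof.
move=> mu mw E; have muw := EmM mu mw.
have e1 : ep (u * w) = ep u by rewrite ep_mulEm // E Ep_ep.
rewrite (@Em_inj_aux u (u * w)) //; last by rewrite qmulA mu.
symmetry; apply: Em_inj_aux => //; first by rewrite qmulCA mw.
by rewrite e1.
Qed.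

Lemma Em_le_mul u w : Em R u -> Em R w -> ep u <= ep w -> u * w = u.
Proof.
move=> mu mw; rewrite qleE; last exact: Ep_ep.
move=> E; apply: Em_inj => //; first exact: EmM.
by rewrite ep_mulEm // qaddC -E.
Qed.

Lemma Em_le u w : Em R u -> Em R w -> ep u <= ep w -> u <= w.
Proof.
move=> mu mw le.
have pu := Ep_ep u.
have le' := le; rewrite qleE // in le'.
have epE : ep (w + ep u) = ep u by rewrite epD ep_ep -le'.
have vE : qv (w + ep u) = eps.
  apply: qle_anti.
    by rewrite -(v_Em mw); apply/v_mono/qleDl.
  have := cq_subD P eps w (ep u).
  rewrite -[eps * w]/(qv w) v_Em // eps_mul //.
  by have [_] := Em_LamP mu; rewrite (qleE _ (@Ep_eps R)) qaddC => <-.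
suff : w + ep u = u by rewrite /qle => ->.
apply: Em_inj => //; rewrite /Em /=.
have lew : (w + ep u) * (w + ep u) <= w.
  by rewrite -{3}mw; apply: qleMM; apply: qleDl.
have ep2 : ep ((w + ep u) * (w + ep u)) = ep u.
  by rewrite ep_mul vE epE eps_mul // pu.
by rewrite lew ep2.
Qed.

Lemma v_eps_eq x : ep x = eps -> eps <= qv x -> x = eps.
Proof.
move=> ex vx; have vE : qv x = eps.
  by apply: qle_anti => //; rewrite -ex; apply: v_le_ep.
have : em x = eps.
  apply: Em_eps_ep; first exact: Em_em.
  by rewrite -ep_em_le ex vE EpV_eps //; apply: Ep_eps.
by move=> E; rewrite -(qmul_em x) E qmulC.
Qed.

End Directed.

(** * The ring extension of a superrigid directed cr-qsring *)

Definition epsP (R : crqsring) : LamP R := exist _ eps (mem_set (LamP_eps R)).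

(** Only used at [a] in [LamP R]; elsewhere its value [eps] is junk. *)
Definition toP (R : crqsring) (a : R) : LamP R := insubd (epsP R) a.

Definition BR_set (R : crqsring) : set (LamP R -> R) :=
  [set phi | (forall a : LamP R, ep (phi a) = val a) /\
             (forall a b : LamP R, val a <= val b -> phi a <= phi b)].

Definition br_zero (R : crqsring) : LamP R -> R := fun a => val a.
Definition br_add (R : crqsring) (phi psi : LamP R -> R) : LamP R -> R :=
  fun a => phi a + psi a.
Definition br_opp (R : crqsring) (phi : LamP R -> R) : LamP R -> R :=
  fun a => - phi a.
Definition br_mul (R : crqsring) (phi psi : LamP R -> R) : LamP R -> R :=
  fun a => phi (toP (val a * (qv (psi (epsP R)))^-1)) *
           psi (toP (val a * (qv (phi (epsP R)))^-1)) + val a.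

Lemma one_subproof (R : srqsring) (a : LamP R) :
  exists x : R, Em R x /\ ep x = val a.
Proof. by have [x mx ex] := sr_sur (set_valP a); exists x. Qed.

(** The element [1_a] of [Em R]; it is unique by [Em_inj]. *)
Definition br_one (R : srqsring) : LamP R -> R :=
  fun a => sval (cid (one_subproof a)).

Section BRing.
Context (R : srqsring).
Implicit Types (phi psi chi : LamP R -> R) (a b c d : LamP R).

Lemma toPK (x : R) : LamP R x -> val (toP x) = x.
Proof. by move=> Px; rewrite /toP insubdK //; apply: mem_set. Qed.

Lemma valP_Ep a : Ep R (val a). Proof. by have [] := set_valP a. Qed.
Lemma valP_ge a : eps <= val a. Proof. by have [] := set_valP a. Qed.
Hint Resolve valP_Ep valP_ge : core.

Lemma BR_ep phi a : BR_set phi -> ep (phi a) = val a. Proof. by case. Qed.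
Lemma BR_le phi a b : BR_set phi -> val a <= val b -> phi a <= phi b.
Proof. by case=> _; apply. Qed.
Lemma BR_restr phi a b : BR_set phi -> val a <= val b -> phi a = phi b + val a.
Proof. by move=> Bp ab; rewrite -(BR_ep a Bp); apply: BR_le. Qed.

Lemma BR_setP phi : (forall a, ep (phi a) = val a) ->
  (forall a b, val a <= val b -> phi a = phi b + val a) -> BR_set phi.
Proof. by move=> h1 h2; split=> // a b ab; rewrite /qle h1; apply: h2. Qed.

Lemma BR_v_le phi : BR_set phi -> qv (phi (epsP R)) <= eps.
Proof. by move=> Bp; have := v_le_ep (phi (epsP R)); rewrite (BR_ep _ Bp). Qed.

Lemma BR_v_ge phi a : BR_set phi -> qv (phi (epsP R)) <= qv (phi a).
Proof. by move=> Bp; apply/v_mono/BR_le => //; apply: valP_ge. Qed.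

Definition br_sh (a : LamP R) phi : R := val a * (qv (phi (epsP R)))^-1.

Lemma br_shP a phi : BR_set phi -> LamP R (br_sh a phi).
Proof.
move=> Bp; apply: LamPM; first exact: set_valP.
by apply: LamPV; [exact: Ep_v | exact: BR_v_le].
Qed.

Lemma br_sh_ge a phi : BR_set phi -> val a <= br_sh a phi.
Proof.
move=> Bp; apply: EpM_ge => //.
by apply: EpV_ge; [exact: Ep_v | exact: BR_v_le].
Qed.

Lemma br_sh_mono a b phi : val a <= val b -> br_sh a phi <= br_sh b phi.
Proof. by move=> ab; rewrite /br_sh !(qmulC _ _^-1); apply: qleM. Qed.

Lemma br_ep_ge phi psi a b c : BR_set phi -> BR_set psi ->
  br_sh a psi <= val b -> br_sh a phi <= val c -> val a <= ep (phi b * psi c).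
Proof.
have aux f x z : BR_set f -> br_sh a f <= val x -> val a <= qv (f z) * val x.
  move=> Bf h; apply: (@qle_trans _ (qv (f z) * br_sh a f)); last exact: qleM.
  apply: (@qle_trans _ (qv (f (epsP R)) * br_sh a f)).
    rewrite /br_sh qmulCA EpV_eps; last exact: Ep_v.
    by rewrite qmulC eps_mul //; apply: qle_refl.
  by rewrite !(qmulC _ (br_sh a f)); apply/qleM/BR_v_ge.
move=> Bp Bq hb hc; rewrite ep_mul (BR_ep _ Bp) (BR_ep _ Bq).
by apply: qle_glb => //; apply: aux.
Qed.

Lemma br_mulE phi psi a b c : BR_set phi -> BR_set psi ->
  br_sh a psi <= val b -> br_sh a phi <= val c ->
  br_mul phi psi a = phi b * psi c + val a.
Proof.
move=> Bp Bq hb hc; rewrite /br_mul -/(br_sh a psi) -/(br_sh a phi).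
apply: qle_restr => //.
  by apply: qleMM; apply: BR_le => //; rewrite toPK //; apply: br_shP.
by apply: br_ep_ge => //; rewrite toPK; (try exact: br_shP); apply: qle_refl.
Qed.

Lemma br_mulP phi psi a : BR_set phi -> BR_set psi -> exists n : LamP R,
  forall b, val n <= val b -> [/\ br_mul phi psi a = phi b * psi b + val a,
    val a <= ep (phi b * psi b) & val a <= val b].
Proof.
move=> Bp Bq; have P1 := br_shP a Bp; have P2 := br_shP a Bq.
exists (toP (br_sh a phi * br_sh a psi)) => b; rewrite toPK; last exact: LamPM.
move=> nb.
have h1 : br_sh a phi <= val b.
  by apply: qle_trans nb; apply: EpM_ge; [case: P1|case: P2].
have h2 : br_sh a psi <= val b.
  by apply: qle_trans nb; rewrite qmulC; apply: EpM_ge; [case: P2|case: P1].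
split; [exact: br_mulE|exact: br_ep_ge|].
by apply: qle_trans h1; apply: br_sh_ge.
Qed.

Lemma LamP_ub a b : exists c, val a <= val c /\ val b <= val c.
Proof.
exists (toP (val a * val b)); rewrite toPK; last by apply: LamPM; apply: set_valP.
by split; last rewrite qmulC; apply: EpM_ge.
Qed.

Lemma BR_zero : BR_set (@br_zero R).
Proof.
apply: BR_setP => [a|a b]; rewrite /br_zero; first exact: ep_id.
by rewrite qleE.
Qed.

Lemma BR_add phi psi : BR_set phi -> BR_set psi -> BR_set (br_add phi psi).
Proof.
move=> Bp Bq; apply: BR_setP => [a|a b ab]; rewrite /br_add.
  by rewrite epD (BR_ep _ Bp) (BR_ep _ Bq) valP_Ep.
by rewrite (BR_restr Bp ab) (BR_restr Bq ab) qaddACA valP_Ep.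
Qed.

Lemma BR_opp phi : BR_set phi -> BR_set (br_opp phi).
Proof.
move=> Bp; apply: BR_setP => [a|a b ab]; rewrite /br_opp.
  by rewrite epN (BR_ep _ Bp).
by rewrite (BR_restr Bp ab) qoppD (qopp_id (valP_Ep a)).
Qed.

Lemma BR_mul phi psi : BR_set phi -> BR_set psi -> BR_set (br_mul phi psi).
Proof.
move=> Bp Bq; apply: BR_setP => [a|a b ab].
  have [n /(_ n (qle_refl _)) [-> h _]] := br_mulP a Bp Bq.
  by rewrite epD (ep_id (valP_Ep a)); move: h; rewrite qleE // => <-.
have [n h] := br_mulP a Bp Bq; have [m k] := br_mulP b Bp Bq.
have [c [nc mc]] := LamP_ub n m.
have [-> _ _] := h _ nc; have [-> _ _] := k _ mc.
by rewrite -qaddA; congr (_ + _); move: ab; rewrite qleE.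
Qed.

Lemma br_one_Em a : Em R (br_one a).
Proof. by rewrite /br_one; case: cid => x []. Qed.

Lemma br_one_ep a : ep (br_one a) = val a.
Proof. by rewrite /br_one; case: cid => x []. Qed.

Lemma BR_one : BR_set (@br_one R).
Proof.
split=> [|a b ab]; first exact: br_one_ep.
by apply: Em_le; rewrite ?br_one_ep //; apply: br_one_Em.
Qed.

Lemma br_one_eps : br_one (epsP R) = eps.
Proof.
by apply: Em_eps_ep; [exact: br_one_Em | rewrite br_one_ep].
Qed.

Lemma br_mulC phi psi : br_mul phi psi = br_mul psi phi.
Proof. by apply/funext => a; rewrite /br_mul qmulC. Qed.

Lemma br_mul1 phi : BR_set phi -> br_mul phi (@br_one R) = phi.
Proof.
move=> Bp; apply/funext => a.
rewrite (@br_mulE _ _ a a (toP (br_sh a phi))) //; first last.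
- by rewrite toPK; [exact: qle_refl | exact: br_shP].
- rewrite /br_sh br_one_eps (v_id (@Ep_eps R)).
  rewrite (crs_inv_idem (cq_mul (cq_ax R)) (@Em_eps R)) qmulC eps_mul //.
  exact: qle_refl.
- exact: BR_one.
suff E : em (phi a) * br_one (toP (br_sh a phi)) = em (phi a).
  rewrite -{1}(qmul_em (phi a)) -qmulA E qmul_em.
  by rewrite -(BR_ep a Bp) qadd_ep.
apply: Em_le_mul; [exact: Em_em|exact: br_one_Em|].
rewrite br_one_ep toPK; last exact: br_shP.
rewrite -ep_em_le (BR_ep _ Bp) /br_sh; apply: qleM.
have vp := @Ep_v R (phi (epsP R)); have va := @Ep_v R (phi a).
have := @BR_v_ge phi a Bp.
move=> /(qleM ((qv (phi (epsP R)))^-1 * (qv (phi a))^-1)).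
rewrite -qmulA (qmulC (_^-1) (qv (phi (epsP R)))) qmulCA.
rewrite qmulA EpV_eps // -qmulA (qmulC _ (qv (phi a))) EpV_eps //.
by rewrite eps_mul ?(qmulC _ eps) ?eps_mul //; apply: EpV.
Qed.

Lemma br_mulA_le phi psi chi a : BR_set phi -> BR_set psi -> BR_set chi ->
  exists n : LamP R, forall b, val n <= val b ->
  br_mul (br_mul phi psi) chi a = phi b * psi b * chi b + val a.
Proof.
move=> Bp Bq Br; have Bpq := BR_mul Bp Bq.
have [n h] := br_mulP a Bpq Br; have [-> hep _] := h n (qle_refl _).
have [m k] := br_mulP n Bp Bq.
exists m => b mb; have [E _ nb] := k b mb.
apply: qle_restr => //; apply: qleMM; last exact: BR_le.
by rewrite E; apply: qleDl.
Qed.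

Lemma br_mulA phi psi chi : BR_set phi -> BR_set psi -> BR_set chi ->
  br_mul phi (br_mul psi chi) = br_mul (br_mul phi psi) chi.
Proof.
move=> Bp Bq Br; apply/funext => a; rewrite br_mulC.
have [n h] := br_mulA_le a Bq Br Bp; have [m k] := br_mulA_le a Bp Bq Br.
have [c [nc mc]] := LamP_ub n m.
by rewrite (h _ nc) (k _ mc) qmulC qmulA.
Qed.

Lemma br_mulDr phi psi chi : BR_set phi -> BR_set psi -> BR_set chi ->
  br_mul phi (br_add psi chi) = br_add (br_mul phi psi) (br_mul phi chi).
Proof.
move=> Bp Bq Br; apply/funext => a.
have [n1 h1] := br_mulP a Bp (BR_add Bq Br).
have [n2 h2] := br_mulP a Bp Bq; have [n3 h3] := br_mulP a Bp Br.
have [c [c1 c2]] := LamP_ub n1 n2; have [d [d1 d2]] := LamP_ub c n3.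
have [-> _ _] := h1 _ (qle_trans c1 d1).
rewrite /br_add; have [-> e2 _] := h2 _ (qle_trans c2 d1).
have [-> e3 _] := h3 _ d2.
rewrite qaddACA valP_Ep; symmetry; apply: qle_restr => //.
  exact: (cq_subD (cq_ax R)).
by rewrite epD; apply: qle_glb.
Qed.

Lemma br_addN phi : BR_set phi -> br_add (br_opp phi) phi = @br_zero R.
Proof.
by move=> Bp; apply/funext => a; rewrite /br_add qaddC -[LHS]/(ep (phi a)) BR_ep.
Qed.

Lemma br_add0 phi : BR_set phi -> br_add (@br_zero R) phi = phi.
Proof.
by move=> Bp; apply/funext => a;
  rewrite /br_add /br_zero qaddC -(BR_ep a Bp) qadd_ep.
Qed.

Definition BR : Type := set_type (@BR_set R).

HB.instance Definition _ := gen_eqMixin BR.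
HB.instance Definition _ := gen_choiceMixin BR.

Definition mkBR phi (H : BR_set phi) : BR := exist _ phi (mem_set H).

Lemma BR_inj (x y : BR) : val x = val y -> x = y.
Proof. exact: val_inj. Qed.

Let B (x : BR) : BR_set (val x) := set_valP x.

Definition BR0 : BR := mkBR BR_zero.
Definition BR1 : BR := mkBR BR_one.
Definition BRadd (x y : BR) : BR := mkBR (BR_add (B x) (B y)).
Definition BRopp (x : BR) : BR := mkBR (BR_opp (B x)).
Definition BRmul (x y : BR) : BR := mkBR (BR_mul (B x) (B y)).

Lemma BRaddA : associative BRadd.
Proof. by move=> x y z; apply/BR_inj/funext => a; apply: qaddA. Qed.
Lemma BRaddC : commutative BRadd.
Proof. by move=> x y; apply/BR_inj/funext => a; apply: qaddC. Qed.
Lemma BRadd0 : left_id BR0 BRadd.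
Proof. by move=> x; apply/BR_inj/br_add0/B. Qed.
Lemma BRaddN : left_inverse BR0 BRopp BRadd.
Proof. by move=> x; apply/BR_inj/br_addN/B. Qed.
Lemma BRmulA : associative BRmul.
Proof. by move=> x y z; apply/BR_inj/br_mulA; apply: B. Qed.
Lemma BRmulC : commutative BRmul.
Proof. by move=> x y; apply/BR_inj/br_mulC. Qed.
Lemma BRmul1 : left_id BR1 BRmul.
Proof. by move=> x; rewrite BRmulC; apply/BR_inj/br_mul1/B. Qed.
Lemma BRmulD : left_distributive BRmul BRadd.
Proof.
by move=> x y z; rewrite !(BRmulC _ z); apply/BR_inj/br_mulDr; apply: B.
Qed.

HB.instance Definition _ :=
  GRing.isZmodule.Build BR BRaddA BRaddC BRadd0 BRaddN.
HB.instance Definition _ :=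
  GRing.Zmodule_isComPzRing.Build BR BRmulA BRmulC BRmul1 BRmulD.

End BRing.

(** * Ring extensions and Prüfer extensions *)

(** The zero ring is not excluded: the completion of [A] in [A] is zero. *)
Record ringext := RingExt {
  re_ring :> comPzRingType;
  re_sub : set re_ring;
  re_subP : GRing.subring_closed [in re_sub]
}.
Arguments re_sub : clear implicits.

(** [{poly C}] requires a nonzero ring, hence the explicit equation. *)
Definition integral_over (B : comPzRingType) (C : set B) (x : B) : Prop :=
  exists n (c : 'I_n -> B), (forall i, C (c i)) /\
    (x ^+ n + \sum_(i < n) c i * x ^+ i = 0)%R.

Definition integrally_closed (B : comPzRingType) (C : set B) : Prop :=
  forall x, integral_over C x -> C x.

Definition is_prufer (E : ringext) : Prop :=
  forall C : set E, GRing.subring_closed [in C] -> re_sub E `<=` C ->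
    integrally_closed C.

Record prufer_ext := PruferExt {
  pe_ext :> ringext;
  pe_prufer : is_prufer pe_ext
}.
Arguments pe_prufer : clear implicits.

Section Modules.
Local Open Scope ring_scope.

Definition lspan (B : comPzRingType) (A : set B) n (s : 'I_n -> B) : set B :=
  [set x | exists a : 'I_n -> B,
     (forall i, A (a i)) /\ x = \sum_(i < n) a i * s i].

Definition mulm (B : comPzRingType) (I J : set B) : set B :=
  [set x | exists s : seq (B * B),
     {in s, forall p, I p.1 /\ J p.2} /\ x = \sum_(p <- s) p.1 * p.2].

Definition addm (B : comPzRingType) (I J : set B) : set B :=
  [set x + y | x in I & y in J].

Definition scalem (B : comPzRingType) (x : B) (I : set B) : set B :=
  [set x * y | y in I].

Definition modclass (B : comPzRingType) (x : B) (a : set B) : set B :=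
  [set x + y | y in a].

End Modules.

(** The monoid [M_{B/A}], its group [M_{B/A}^*] of invertible elements, and the
    positive cone of the latter. *)
Definition Mon (E : ringext) : set (set E) :=
  [set I | exists n (s : 'I_n -> E), I = lspan (re_sub E) s].
Arguments Mon : clear implicits.

Definition Mstar (E : ringext) : set (set E) :=
  [set I | Mon E I /\ exists2 J, Mon E J & mulm I J = re_sub E].
Arguments Mstar : clear implicits.

Definition MstarP (E : ringext) : set (set E) :=
  [set I | Mstar E I /\ I `<=` re_sub E].
Arguments MstarP : clear implicits.

Definition mle (E : ringext) (I J : set E) : Prop := J `<=` I.

Definition extm (E E' : ringext) (g : E -> E') (I : set E) : set E' :=
  mulm (re_sub E') (g @` I).

(** ** Completion *)

Definition to_lim (E : ringext) (b : E) : MstarP E -> set E :=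
  fun a => modclass b (val a).
Arguments to_lim {E} b.

(** The projective limits of [B / a] and [A / a] for [a] in [MstarP E];
    the transition map sends a class modulo [a] to the class modulo [b] which
    contains it. *)
Definition limB (E : ringext) : set (MstarP E -> set E) :=
  [set X | (forall a, exists b, X a = modclass b (val a)) /\
           (forall a b : MstarP E, val a `<=` val b -> X a `<=` X b)].
Arguments limB : clear implicits.

Definition limA (E : ringext) : set (MstarP E -> set E) :=
  [set X | limB E X /\
           (forall a, exists2 b, re_sub E b & X a = modclass b (val a))].
Arguments limA : clear implicits.

Definition ext_complete (E : ringext) : Prop :=
  set_bij (re_sub E) (limA E) to_lim /\ set_bij setT (limB E) to_lim.

(** [psi] identifies [E'] with the completion of [E]: the sum on the limit is
    componentwise; the classes modulo [a] form no ring, and the product is the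
    continuous extension of the product of [E]. *)
Record is_completion (E E' : ringext) (psi : E' -> MstarP E -> set E) : Prop := {
  cpl_B : set_bij setT (limB E) psi;
  cpl_A : set_bij (re_sub E') (limA E) psi;
  cpl_add : forall x y a, psi (x + y)%R a = addm (psi x a) (psi y a);
  cpl_mul : forall x y a, exists c, forall b b',
    psi x c b -> psi y c b' -> psi (x * y)%R a (b * b')%R
}.

(** * Prüfer and Prüfer-Manis cr-qsrings *)

(** [hatLam R] is the carrier of [hat Lambda], whose
    elements are maps [LamP R -> R] with values in [Ep R]; [hat_in] embeds
    [Lambda]. *)
Definition hatLam (R : crqsring) : set (LamP R -> R) :=
  [set phi | (forall a, Ep R (phi a)) /\
             (forall a b : LamP R, val a <= val b -> phi a = phi b + val a)].
Arguments hatLam : clear implicits.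

Definition hat_le (R : crqsring) (phi psi : LamP R -> R) : Prop :=
  forall a, phi a <= psi a.

Definition hat_mul (R : crqsring) (phi psi : LamP R -> R) : LamP R -> R :=
  fun a => phi (toP (val a * (psi (epsP R))^-1)) *
           psi (toP (val a * (phi (epsP R))^-1)) + val a.

Definition hat_in (R : crqsring) (c : R) : LamP R -> R := fun a => c + val a.

Definition qw (R : srqsring) (x : BR R) : LamP R -> R := fun a => qv (val x a).

Definition AR (R : srqsring) : set (BR R) :=
  [set x | hat_le (hat_in eps) (qw x)].
Arguments AR : clear implicits.

Lemma AR_E (R : srqsring) (x : BR R) : AR R x <-> val x (epsP R) = eps.
Proof.
have Bx := set_valP x; split=> [h|h a].
  apply: v_eps_eq; first by rewrite (BR_ep _ Bx).
  by have := h (epsP R); rewrite /hat_in /= (@Ep_eps R).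
rewrite /hat_in; apply: (@qle_trans _ eps).
  exact/qleDl/valP_Ep.
by have := BR_v_ge a Bx; rewrite h (v_id (@Ep_eps R)).
Qed.

Lemma AR_subring (R : srqsring) : GRing.subring_closed [in AR R].
Proof.
split; rewrite ?inE.
- by apply/AR_E; apply: br_one_eps.
- move=> x y; rewrite !inE => /AR_E hx /AR_E hy; apply/AR_E.
  by rewrite /= /br_add /br_opp hx hy (qopp_id (@Ep_eps R)) (@Ep_eps R).
move=> x y; rewrite !inE => /AR_E hx /AR_E hy; apply/AR_E => /=.
have Bx := set_valP x; have By := set_valP y.
have E : eps * eps^-1 = eps :> R by apply: EpV_eps; apply: Ep_eps.
rewrite (@br_mulE _ _ _ _ (epsP R) (epsP R)) //;
  rewrite /br_sh ?hx ?hy ?(v_id (@Ep_eps R)) /= ?E; try exact: qle_refl.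
by rewrite (@Em_eps R) (@Ep_eps R).
Qed.

Definition BR_ext (R : srqsring) : ringext := RingExt (@AR_subring R).

(** [hat_w I phi]: the map [hat w] takes the value [phi] at [I]. The value
    [val a] of the empty meet is the greatest value at [a] of an element of
    [hat Lambda]. *)
Definition hat_w (R : srqsring) (I : set (BR R)) (phi : LamP R -> R) : Prop :=
  exists n (s : 'I_n -> BR R), I = lspan (AR R) s /\
    phi = fun a => \big[@qs_add R/val a]_(i < n) qw (s i) a.

Definition hat_wM (R : srqsring) : set (LamP R -> R) :=
  [set phi | exists2 I, Mon (BR_ext R) I & hat_w I phi].
Arguments hat_wM : clear implicits.

Definition hat_wMstar (R : srqsring) : set (LamP R -> R) :=
  [set phi | hat_wM R phi /\
     exists2 psi, hat_wM R psi & hat_mul phi psi = hat_in eps].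
Arguments hat_wMstar : clear implicits.

Definition hat_Lam_in (R : crqsring) : set (LamP R -> R) :=
  [set hat_in c | c in Ep R].
Arguments hat_Lam_in : clear implicits.

Definition prufer_manis (R : srqsring) : Prop :=
  convex_hull (hatLam R) (@hat_le R) (hat_wMstar R) = hat_Lam_in R.

Definition strong_prufer_manis (R : srqsring) : Prop :=
  hat_wMstar R = hat_Lam_in R.

Record pm_qsring := PMQsring {
  pm_sr :> srqsring;
  pm_prufer : is_prufer (BR_ext pm_sr);
  pm_manis : prufer_manis pm_sr
}.
Arguments pm_prufer : clear implicits.

(** * Categories *)

Record category := Category {
  ob :> Type;
  hom : ob -> ob -> Type;
  idm : forall a, hom a a;
  catcomp : forall a b c, hom b c -> hom a b -> hom a c;
  comp1m : forall a b (f : hom a b), catcomp (idm b) f = f;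
  compm1 : forall a b (f : hom a b), catcomp f (idm a) = f;
  compA : forall a b c d (f : hom c d) (g : hom b c) (h : hom a b),
    catcomp f (catcomp g h) = catcomp (catcomp f g) h
}.
Arguments hom {c} a b : rename.
Arguments idm {c} a : rename.
Arguments catcomp {c a b} {c0} f g : rename.

(** Functors with a prescribed object map. *)
Record functor_on (C D : category) (F : C -> D) := FunctorOn {
  fmap :> forall a b, hom a b -> hom (F a) (F b);
  fmap1 : forall a, fmap (idm a) = idm (F a);
  fmapM : forall a b c (f : hom b c) (g : hom a b),
    fmap (catcomp f g) = catcomp (fmap f) (fmap g)
}.

Definition functor_id (C : category) : functor_on (fun a : C => a).
Proof. by exists (fun a b f => f). Defined.

Definition functor_comp (C D E : category) (F : C -> D) (G : D -> E)
  (Gm : functor_on G) (Fm : functor_on F) : functor_on (fun a => G (F a)).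
Proof.
exists (fun a b f => Gm _ _ (Fm _ _ f)) => [a|a b c f g].
  by rewrite !fmap1.
by rewrite !fmapM.
Defined.

Definition is_iso (C : category) (a b : C) (f : hom a b) : Prop :=
  exists g : hom b a, catcomp f g = idm b /\ catcomp g f = idm a.

Definition naturally_isomorphic (C D : category) (F G : C -> D)
    (Fm : functor_on F) (Gm : functor_on G) : Prop :=
  exists t : forall a, hom (F a) (G a),
    (forall a b (f : hom a b), catcomp (t b) (Fm _ _ f) = catcomp (Gm _ _ f) (t a)) /\
    (forall a, is_iso (t a)).

Definition inverse_equivalences (C D : category) (F : C -> D) (G : D -> C)
    (Fm : functor_on F) (Gm : functor_on G) : Prop :=
  naturally_isomorphic (functor_comp Gm Fm) (functor_id C) /\
  naturally_isomorphic (functor_comp Fm Gm) (functor_id D).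

Record adjunction (C D : category) (F : C -> D) (G : D -> C)
    (Fm : functor_on F) (Gm : functor_on G) := Adjunction {
  adj : forall c d, hom (F c) d -> hom c (G d);
  adj_bij : forall c d, bijective (@adj c d);
  adj_natl : forall c c' d (h : hom c' c) (f : hom (F c) d),
    adj (catcomp f (Fm _ _ h)) = catcomp (adj f) h;
  adj_natr : forall c d d' (k : hom d d') (f : hom (F c) d),
    adj (catcomp k f) = catcomp (Gm _ _ k) (adj f)
}.

Definition adj_unit (C D : category) (F : C -> D) (G : D -> C)
    (Fm : functor_on F) (Gm : functor_on G) (t : adjunction Fm Gm) (c : C) :
  hom c (G (F c)) := adj t (idm (F c)).

Definition full_subcategory (C : category) (P : C -> Prop) : category.
Proof.
exists {a : C | P a} (fun a b => hom (sval a) (sval b)) (fun a => idm (sval a))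
  (fun a b c f g => catcomp f g).
- by move=> a b f; apply: comp1m.
- by move=> a b f; apply: compm1.
by move=> a b c d f g h; apply: compA.
Defined.

Definition functor_restrict_ob (C D : category) (P : C -> Prop) (Q : D -> Prop)
    (F : C -> D) (h : forall a, P a -> Q (F a))
    (a : full_subcategory P) : full_subcategory Q :=
  exist Q (F (sval a)) (h _ (svalP a)).

Definition functor_restrict (C D : category) (P : C -> Prop) (Q : D -> Prop)
    (F : C -> D) (h : forall a, P a -> Q (F a)) (Fm : functor_on F) :
  functor_on (functor_restrict_ob h).
Proof.
exists (fun a b f => Fm (sval a) (sval b) f) => [a|a b c f g].
  exact: (fmap1 Fm).
exact: (fmapM Fm).
Defined.

(** ** The category of Prüfer extensions *)

Definition is_Pmor (E E' : prufer_ext) (g : E -> E') : Prop :=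
  (forall x, re_sub E x -> re_sub E' (g x)) /\
  convex_hull (Mstar E') (@mle E') [set extm g a | a in Mstar E] = Mstar E'.

Definition Phom (E E' : prufer_ext) : Type :=
  {g : {rmorphism E -> E'} | is_Pmor g}.

Lemma Phom_eq (E E' : prufer_ext) (f g : Phom E E') :
  sval f =1 sval g -> f = g.
Proof.
case: f g => [f Pf] [g Pg] /= fg; apply: eq_exist.
case: f g {Pf Pg} fg => [f [[f1] [f2]]] [g [[g1] [g2]]] /= /funext fg.
by subst g; rewrite (Prop_irrelevance f1 g1) (Prop_irrelevance f2 g2).
Qed.

Section Pcategory.
Local Open Scope ring_scope.

Lemma mulm_mono (B : comPzRingType) (I J K : set B) :
  J `<=` K -> mulm I J `<=` mulm I K.
Proof.
move=> JK x [s [h ->]]; exists s; split=> // p ps.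
by have [hI hJ] := h p ps; split=> //; apply: JK.
Qed.

Lemma lspan_sum (B : comPzRingType) (A : set B) n (s : 'I_n -> B)
    (l : seq (B * B)) : GRing.subring_closed [in A] ->
  {in l, forall p, A p.1 /\ lspan A s p.2} ->
  lspan A s (\sum_(p <- l) p.1 * p.2).
Proof.
move=> [A1 AB AM]; have A0 : 0 \in [in A] by rewrite -(subrr 1) AB.
have AN x : x \in [in A] -> - x \in [in A].
  by move=> Ax; rewrite -sub0r AB.
elim: l => [|p l IH] h.
  rewrite big_nil; exists (fun=> 0); split; first by move=> i; apply: set_mem.
  by rewrite big1 // => i _; rewrite mul0r.
have [|b [bA bE]] := IH; first by move=> q ql; apply: h; rewrite inE ql orbT.
have [pA [a [aA aE]]] := h p (mem_head _ _).
rewrite big_cons bE aE mulr_sumr -big_split /=.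
exists (fun i => p.1 * a i + b i); split.
  move=> i; apply: set_mem; rewrite -[b i]opprK; apply: (AB).
    by apply: AM; apply: mem_set.
  by apply: AN; apply: mem_set.
by apply: eq_bigr => i _; rewrite mulrDl mulrA.
Qed.

Lemma extm_id (E : ringext) (I : set E) : Mon E I -> extm idfun I = I.
Proof.
move=> [n [s ->]]; have [A1 _ _] := re_subP E; apply/seteqP; split=> x.
  move=> [l [h ->]]; apply: lspan_sum; first exact: re_subP.
  by move=> p pl; have [h1 [y h2 <-]] := h p pl.
move=> hx; exists [:: (1, x)]; split.
  move=> p; rewrite inE => /eqP -> /=; split; first exact: set_mem.
  by exists x.
by rewrite big_seq1 mul1r.
Qed.

Lemma extm_mono (E E' : ringext) (g : E -> E') (I J : set E) :
  I `<=` J -> extm g I `<=` extm g J.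
Proof.
by move=> IJ; apply: mulm_mono => _ [y Iy <-]; exists y => //; apply: IJ.
Qed.

Lemma extm_comp (E E' E'' : ringext) (g : {rmorphism E' -> E''})
    (f : {rmorphism E -> E'}) (I : set E) :
  (forall x, re_sub E' x -> re_sub E'' (g x)) ->
  extm g (extm f I) = extm (g \o f) I.
Proof.
move=> gA; have [A1 _ _] := re_subP E'; have [_ _ AM] := re_subP E''.
apply/seteqP; split=> x.
  move=> [l [h ->]]; elim: l h => [|p l IH] h.
    by exists [::]; split=> //; rewrite !big_nil.
  have [|m [hm mE]] := IH; first by move=> q ql; apply: h; rewrite inE ql orbT.
  have [pA [y [k [hk yE]] pE]] := h p (mem_head _ _).
  exists ([seq (p.1 * g q.1, g q.2) | q <- k] ++ m); split.
    move=> q; rewrite mem_cat => /orP[/mapP[r rk ->] /=|]; last exact: hm.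
    have [r1 [z Iz zE]] := hk r rk; split.
      by apply: set_mem; apply: AM; apply: mem_set => //; apply: gA.
    by exists z => //=; rewrite zE.
  rewrite big_cat big_cons mE /= -pE yE big_map rmorph_sum mulr_sumr.
  by congr (_ + _); apply: eq_bigr => r _; rewrite /= rmorphM mulrA.
move=> [l [h ->]]; exists l; split=> // p pl.
have [hp [y Iy yE]] := h p pl; split=> //; exists (f y) => //.
exists [:: (1, f y)]; split.
  by move=> q; rewrite inE => /eqP -> /=; split; [exact: set_mem|exists y].
by rewrite big_seq1 mul1r.
Qed.

Lemma Pid_mor (E : prufer_ext) : is_Pmor (idfun : {rmorphism E -> E}).
Proof.
split=> //; apply/seteqP; split=> [c []|c Mc] //; split=> //.
by exists c, c; split=> //; exists c => //; rewrite extm_id //; case: Mc.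
Qed.

Lemma Pcomp_mor (E E' E'' : prufer_ext) (g : {rmorphism E' -> E''})
    (f : {rmorphism E -> E'}) :
  is_Pmor g -> is_Pmor f -> is_Pmor (g \o f : {rmorphism E -> E''}).
Proof.
move=> [gA gH] [fA fH]; split=> [x /fA /gA //|].
apply/seteqP; split=> [c []|c Mc] //; split=> //.
move: (Mc); rewrite -{1}gH => -[_ [_ [_ [[a Ma <-] [b Mb <-] ac cb]]]].
move: Ma Mb; rewrite -{1}fH => -[_ [_ [_ [[a0 Ma0 <-] _ a0a _]]]].
rewrite -{1}fH => -[_ [_ [_ [_ [b0 Mb0 <-] _ bb0]]]].
exists (extm (g \o f) a0), (extm (g \o f) b0); split.
- by exists a0.
- by exists b0.
- by rewrite -extm_comp //; apply: subset_trans ac _; apply: extm_mono.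
- by rewrite -extm_comp //; apply: subset_trans cb; apply: extm_mono.
Qed.

End Pcategory.

Definition catP : category.
Proof.
exists prufer_ext Phom
  (fun E : prufer_ext => exist _ (idfun : {rmorphism E -> E}) (Pid_mor E))
  (fun (E E' E'' : prufer_ext) (g : Phom E' E'') (f : Phom E E') =>
     exist _ (sval g \o sval f : {rmorphism E -> E''})
     (Pcomp_mor (svalP g) (svalP f))).
- by move=> E E' f; apply: Phom_eq.
- by move=> E E' f; apply: Phom_eq.
by move=> E1 E2 E3 E4 f g h; apply: Phom_eq.
Defined.

(** ** The category of Prüfer-Manis cr-qsrings *)

Record is_qs_hom (R R' : qsalg) (f : R -> R') : Prop := {
  qs_homD : forall x y, f (x + y) = f x + f y;
  qs_homM : forall x y, f (x * y) = f x * f y;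
  qs_homN : forall x, f (- x) = - f x;
  qs_homV : forall x, f x^-1 = (f x)^-1;
  qs_hom_eps : f eps = eps
}.

Definition is_Rmor (R R' : qsalg) (f : R -> R') : Prop :=
  is_qs_hom f /\
  convex_hull (Ep R') (@qle R') [set f a | a in Ep R] = Ep R'.

Definition Rhom (R R' : pm_qsring) : Type := {f : R -> R' | is_Rmor f}.

Lemma Rhom_eq (R R' : pm_qsring) (f g : Rhom R R') : sval f = sval g -> f = g.
Proof. by case: f g => [f Pf] [g Pg] /= fg; apply: eq_exist. Qed.

Lemma qs_hom_le (R R' : qsalg) (f : R -> R') (x y : R) :
  is_qs_hom f -> x <= y -> f x <= f y.
Proof.
by move=> hf xy; rewrite /qle /ep -(qs_homN hf) -!(qs_homD hf); congr f.
Qed.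

Lemma Rid_mor (R : crqsring) : is_Rmor (@id R).
Proof.
split=> //; apply/seteqP; split=> [c []|c Ec] //; split=> //.
by exists c, c; split; try (by exists c); apply: qle_refl.
Qed.

Lemma Rcomp_mor (R R' R'' : crqsring) (g : R' -> R'') (f : R -> R') :
  is_Rmor g -> is_Rmor f -> is_Rmor (g \o f).
Proof.
move=> [gh gH] [fh fH]; split.
  split=> * /=.
  - by rewrite (qs_homD fh) (qs_homD gh).
  - by rewrite (qs_homM fh) (qs_homM gh).
  - by rewrite (qs_homN fh) (qs_homN gh).
  - by rewrite (qs_homV fh) (qs_homV gh).
  - by rewrite (qs_hom_eps fh) (qs_hom_eps gh).
apply/seteqP; split=> [c []|c Mc] //; split=> //.
move: (Mc); rewrite -{1}gH => -[_ [_ [_ [[a Ma <-] [b Mb <-] ac cb]]]].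
move: Ma Mb; rewrite -{1}fH => -[_ [_ [_ [[a0 Ma0 <-] _ a0a _]]]].
rewrite -{1}fH => -[_ [_ [_ [_ [b0 Mb0 <-] _ bb0]]]].
exists (g (f a0)), (g (f b0)); split.
- by exists a0.
- by exists b0.
- by apply: qle_trans ac; apply: qs_hom_le.
- by apply: qle_trans cb _; apply: qs_hom_le.
Qed.

Definition catR : category.
Proof.
exists pm_qsring Rhom (fun R : pm_qsring => exist _ id (Rid_mor R))
  (fun (R R' R'' : pm_qsring) (g : Rhom R' R'') (f : Rhom R R') =>
     exist _ (sval g \o sval f)
     (Rcomp_mor (svalP g) (svalP f))).
- by move=> R R' f; apply: Rhom_eq.
- by move=> R R' f; apply: Rhom_eq.
by move=> R1 R2 R3 R4 f g h; apply: Rhom_eq.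
Defined.

(** * The functors *)

Definition B_ob (R : pm_qsring) : prufer_ext := PruferExt (pm_prufer R).

(** [(B f phi) a' = f (phi a) + a'] for every [a] with [f a >= a']; such an [a]
    exists since [Ep R'] is the convex hull of the image of [Ep R]. *)
Definition B_on_morphisms (Bm : @functor_on catR catP B_ob) : Prop :=
  forall (R R' : pm_qsring) (f : Rhom R R') (phi : B_ob R)
         (a' : LamP R') (a : LamP R),
    val a' <= sval f (val a) ->
    val (sval (Bm R R' f : Phom (B_ob R) (B_ob R')) phi) a' =
    sval f (val phi a) + val a'.

(** The disjoint union of the [B / a], for [a] in [Mstar E]: [x mod a] is the pair
    of [a] and the class of [x] modulo [a]. *)
Definition rba_cls (E : ringext) (x : E) (a : set E) : set E * set E :=
  (a, modclass x a).

Definition RBA_set (E : ringext) : set (set E * set E) :=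
  [set p | Mstar E p.1 /\ exists x, p = rba_cls x p.1].
Arguments RBA_set : clear implicits.

(** [R_{B/A}], with its structure of a Prüfer-Manis cr-qsring. The equations
    below, which hold for all representatives, determine the operations; in
    [RBA_invE], [V] is the inverse of [v(X) = a + A x]. *)
Record RBA (E : ringext) := MkRBA {
  RBA_add : RBA_set E -> RBA_set E -> RBA_set E;
  RBA_mul : RBA_set E -> RBA_set E -> RBA_set E;
  RBA_opp : RBA_set E -> RBA_set E;
  RBA_inv : RBA_set E -> RBA_set E;
  RBA_eps : RBA_set E;
  RBA_addE : forall (X Y : RBA_set E) x y a b,
    val X = rba_cls x a -> val Y = rba_cls y b ->
    val (RBA_add X Y) = rba_cls (x + y)%R (addm a b);
  RBA_oppE : forall (X : RBA_set E) x a, val X = rba_cls x a ->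
    val (RBA_opp X) = rba_cls (- x)%R a;
  RBA_mulE : forall (X Y : RBA_set E) x y a b,
    val X = rba_cls x a -> val Y = rba_cls y b ->
    val (RBA_mul X Y) =
      rba_cls (x * y)%R (addm (addm (mulm a b) (scalem x b)) (scalem y a));
  RBA_invE : forall (X : RBA_set E) x a, val X = rba_cls x a ->
    exists V z, [/\ Mstar E V,
      mulm V (addm a (scalem x (re_sub E))) = re_sub E,
      V z,
      mulm V a (x * z - 1)%R
      & val (RBA_inv X) = rba_cls z (mulm a (mulm V V))];
  RBA_epsE : val RBA_eps = rba_cls 0%R (re_sub E);
  RBA_alg := QSAlg RBA_add RBA_mul RBA_opp RBA_inv RBA_eps;
  RBA_cr : is_crqsring RBA_alg;
  RBA_cq := CrQsring RBA_cr;
  RBA_dir : directed RBA_cq;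
  RBA_sur : superrigid RBA_cq;
  RBA_sr := SrQsring RBA_dir RBA_sur;
  RBA_prufer : is_prufer (BR_ext RBA_sr);
  RBA_manis : prufer_manis RBA_sr
}.
Arguments RBA_prufer {E} r.
Arguments RBA_manis {E} r.

Definition R_ob (S : forall E : prufer_ext, RBA E) (E : prufer_ext) : pm_qsring :=
  PMQsring (RBA_prufer (S E)) (RBA_manis (S E)).

Definition R_on_morphisms (S : forall E : prufer_ext, RBA E)
    (Rm : @functor_on catP catR (R_ob S)) : Prop :=
  forall (E E' : prufer_ext) (g : Phom E E') (X : R_ob S E) x a,
    val X = rba_cls x a ->
    val (sval (Rm E E' g : Rhom (R_ob S E) (R_ob S E')) X) =
    rba_cls (sval g x) (extm (sval g) a).

Definition in_CP (E : prufer_ext) : Prop := ext_complete E.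

Definition in_CR (R : pm_qsring) : Prop :=
  qs_complete R /\ strong_prufer_manis R.

(* Main.v *)
Require Import Defs.
From HB Require Import structures.
From mathcomp Require Import all_boot all_algebra.
From mathcomp Require Import boolp classical_sets functions.
From mathcomp Require Import ring.

(** A ring extension is Prüfer if and only if every [x] in [B] admits [v] with [v],
    [v x] and [x - v x^2] in [A]; this amounts to the invertibility of [A + A x],
    and it passes from [A] in [B] to [A'] in [B'] along any ring morphism [g] with
    [B' = g B + A'], in particular to the completion. Over a Prüfer extension, the
    invertible modules are closed under sums, and they are the units of the
    semiring of [A]-submodules of [B], so that all the identities between ideals
    which the axioms of [R_{B/A}] require are identities of semirings.

    For a Prüfer cr-qsring [R], an element [phi] of [B_R] extends to a map [ev phi]
    on the whole of [Lambda], and every invertible module is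
    [J_c = {phi | ev phi c = c}] for a unique [c], which is its value under [hat w].
    The unit of the adjunction sends [b] to [alpha |-> b mod alpha], and the counit
    sends [phi mod J_c] to [ev phi c]. Both [B_R] and [R_{B/A}] are always complete,
    and [R_{B/A}] is always Prüfer-Manis in the strong sense. *)

Set Implicit Arguments.
Unset Strict Implicit.
Unset Printing Implicit Defensive.

Import GRing.Theory.

Local Open Scope classical_set_scope.
Local Open Scope ring_scope.

(** * A criterion for Prüfer extensions *)

(** For a general Prüfer-Manis [R], an element [c] of Lambda need not be the value of an invertible
    module, so the inverse of [Jm c] is never available a priori. Values are therefore obtained by
    pinching: a pair of inverse modules contained in [Jm c] and [Jm c^-1] must fill both of them.
    This needs a candidate [c], which comes from the finitely many generators of one module, read at
    [eps]. The map [hat w] takes values in hat Lambda rather than in Lambda. The two are reconciled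
    by a boundedness argument: an invertible element of hat Lambda is bounded, and a bounded one is
    constant from some point on, hence lies in Lambda. The Prüfer-Manis property enters through
    cofinality alone: every element of Lambda lies between two values of invertible modules. This
    suffices for morphisms, since an element of [B_R] is determined by its values on a cofinal set.
    Products in [B_R] are pointwise only after a shift of the arguments; identities are checked at
    one sufficiently large common argument and then restricted. *)

Section Subring.
Context (E : ringext).
Implicit Types x y : E.
Local Notation A := (re_sub E).

Lemma sub1 : A 1.
Proof. by have [h _ _] := re_subP E; apply: set_mem. Qed.
Lemma subB x y : A x -> A y -> A (x - y).
Proof.
have [_ h _] := re_subP E.
by move=> Ax Ay; apply: set_mem; apply: h; apply: mem_set.
Qed.
Lemma subM x y : A x -> A y -> A (x * y).
Proof.
have [_ _ h] := re_subP E.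
by move=> Ax Ay; apply: set_mem; apply: h; apply: mem_set.
Qed.
Lemma sub0 : A 0. Proof. by rewrite -(subrr 1); apply: subB; apply: sub1. Qed.
Lemma subN x : A x -> A (- x).
Proof. by rewrite -sub0r => Ax; apply: subB => //; apply: sub0. Qed.
Lemma subD x y : A x -> A y -> A (x + y).
Proof. by move=> Ax Ay; rewrite -[y]opprK; apply: subB => //; apply: subN. Qed.
Lemma subX x n : A x -> A (x ^+ n).
Proof.
move=> Ax; elim: n => [|n IH]; first by rewrite expr0; apply: sub1.
by rewrite exprS; apply: subM.
Qed.
Lemma sub_sum n (F : 'I_n -> E) : (forall i, A (F i)) -> A (\sum_(i < n) F i).
Proof. by move=> h; apply: big_ind => //; [exact: sub0|exact: subD]. Qed.
End Subring.
#[local] Hint Resolve sub1 sub0 : core.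

Section PruferCriterion.
Context (E : ringext).
Implicit Types x y : E.

(** In a ring with [1 = u + v x], [u x] and [v x] in [A], the [A]-module generated
    by [1] and [x] is invertible; its inverse is generated by [u] and [v]. *)
Definition prufer_at x := exists v,
  [/\ re_sub E v, re_sub E (v * x) & re_sub E (x - v * x ^+ 2)].

(** Multiplying the equation by [v ^ n] puts [x * (v * x) ^ n] in the subring. As
    [x = x * (v * x) + (x - v * x ^ 2)], the exponent of [v * x] can then be lowered step by step to
    0. *)
Lemma prufer_at_stable x : (exists n (c : 'I_n.+1 -> E),
    (forall i, re_sub E (c i)) /\ x ^+ n.+1 + \sum_(i < n.+1) c i * x ^+ i = 0) ->
  prufer_at x -> re_sub E x.
Proof.
move=> [n [c [cA cE]]] [v [vA vxA ux]].
have h : re_sub E (x * (v * x) ^+ n).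
  have -> : x * (v * x) ^+ n = - \sum_(i < n.+1) v ^+ n * (c i * x ^+ i).
    rewrite -mulr_sumr -mulrN -(addr0_eq cE) opprK exprMn mulrCA exprS //.
  apply/subN/sub_sum => i.
  have -> : v ^+ n * (c i * x ^+ i) = v ^+ (n - i) * (c i * (v * x) ^+ i).
    by rewrite exprMn -{1}(subnK (ltn_ord i : i <= n)%N) exprD; ring.
  by do !apply: subM => //; apply: subX.
elim: n {c cA cE} h => [|n IH]; first by rewrite mulr1.
move=> h; apply: IH.
have -> : x * (v * x) ^+ n = x * (v * x) ^+ n.+1 +
    (x - v * x ^+ 2) * (v * x) ^+ n by rewrite exprS; ring.
by apply: subD => //; apply: subM => //; apply: subX.
Qed.

End PruferCriterion.

(** * Polynomial relations and the subrings [A[t]] *)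

Section Horner.
Context (E : ringext) (x : E).
Implicit Types (s q : seq E) (y t : E).
Local Notation A := (re_sub E).

(** Polynomials are coefficient lists, lowest degree first, so that the zero ring is covered. *)
Fixpoint horn t s : E := if s is a :: s' then a + t * horn t s' else 0.
Fixpoint over_sub s : Prop := if s is a :: s' then A a /\ over_sub s' else True.

(** The tails [c_k = b_k + b_(k+1) x + ...] of a polynomial relation on [x] lie in
    [A], since [c_k x] is integral over [A]. *)
Lemma horn_tail s k (f : nat -> E) :
  integrally_closed A -> over_sub s -> (forall i, A (f i)) ->
  \sum_(i < k.+1) f i * x ^+ i + x ^+ k.+1 * horn x s = 0 ->
  A (horn x s) /\ A (x * horn x s).
Proof.
move=> icA; elim: s k f => [|b s IH] k f /=.
  by rewrite !mulr0 => _ _ _; split; apply: sub0.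
move=> [Ab As] Af E0; have [] :=
  IH k.+1 (fun i => if (i < k.+1)%N then f i else b) As.
- by move=> i; case: ifP.
- rewrite big_ord_recr /= ltnn -[RHS]E0; under eq_bigr do rewrite ltn_ord.
  by rewrite (exprSr x k.+1); ring.
move=> _ Axh; have Ac : A (b + x * horn x s) by apply: subD.
split=> //; apply: icA.
set c := b + _ in Ac E0 *.
(* Multiplied by [c ^ k], the relation becomes monic in [x * c]. *)
exists k.+1, (fun i => f i * c ^+ (k - i)); split.
  by move=> i; apply: subM => //; apply: subX.
rewrite -[RHS](mulr0 (c ^+ k)) -[X in _ = _ * X]E0 [RHS]mulrDr addrC mulr_sumr;
  congr (_ + _).
  apply: eq_bigr => i _; rewrite exprMn.
  have -> : c ^+ k = c ^+ (k - i) * c ^+ i by rewrite -exprD subnK // -ltnS.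
  by ring.
by rewrite exprMn (exprSr c) mulrCA mulrA.
Qed.

Lemma over_cat s q : over_sub s -> over_sub q ->
  exists2 r, over_sub r & forall t, horn t s + horn t q = horn t r.
Proof.
elim: s q => [|a s IH] [|b q] /=.
- by exists [::] => // t; rewrite addr0.
- by exists (b :: q) => // t; rewrite add0r.
- by exists (a :: s) => // t; rewrite addr0.
move=> [Aa As] [Ab Aq]; have [r Ar h] := IH q As Aq.
exists (a + b :: r) => /=; first by split=> //; apply: subD.
by move=> t; rewrite -h; ring.
Qed.

Lemma over_scale a s : A a -> over_sub s ->
  exists2 r, over_sub r & forall t, a * horn t s = horn t r.
Proof.
move=> Aa; elim: s => [|b s IH] /=; first by exists [::] => // t; rewrite mulr0.
move=> [Ab /IH[r Ar h]]; exists (a * b :: r) => /=; first by split=> //;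
  apply: subM.
by move=> t; rewrite -h; ring.
Qed.

Lemma over_mul s q : over_sub s -> over_sub q ->
  exists2 r, over_sub r & forall t, horn t s * horn t q = horn t r.
Proof.
move=> + Aq; elim: s => [|a s IH] /=; first by exists [::] => // t;
  rewrite mul0r.
move=> [Aa /IH[r Ar h]]; have [u Au k] := over_scale Aa Aq.
have [w Aw l] := @over_cat u (0 :: r) Au (conj (sub0 E) Ar).
by exists w => // t; rewrite -l -k /= -h; ring.
Qed.

Definition adjoin t : set E := [set y | exists2 s, over_sub s & y = horn t s].

Lemma adjoin_subring t : GRing.subring_closed [in adjoin t].
Proof.
split=> [|y z|y z]; rewrite ?inE.
- by exists [:: 1] => /=; [split=> //; apply: sub1|rewrite mulr0 addr0].
- move=> [s As ->] [q Aq ->]; have [r Ar h] := over_scale (subN (sub1 E)) Aq.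
  by have [w Aw k] := over_cat As Ar; exists w => //; rewrite -k -h mulN1r.
by move=> [s As ->] [q Aq ->]; have [r Ar h] := over_mul As Aq; exists r.
Qed.

Lemma interleave s : over_sub s ->
  exists2 r, over_sub r & horn x r = horn (x ^+ 2) s.
Proof.
elim: s => [|a s IH] /=; first by exists [::].
move=> [Aa /IH[r Ar h]]; exists [:: a, 0 & r] => /=.
  by split=> //; split=> //; apply: sub0.
by rewrite h; ring.
Qed.

(** As a root of [T ^ 2 - x ^ 2], the element [x] is integral over [A[x ^ 2]] and so belongs to it:
    [x = a + x ^ 2 * h] with [a] in [A] and [h] a polynomial in [x]. By [horn_tail], [h] and [x * h]
    lie in [A]; thus [v := h] works, and [x - v * x ^ 2] is [a]. *)
Lemma prufer_at_prufer : is_prufer E -> prufer_at x.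
Proof.
move=> pE.
have icA : integrally_closed A by apply: pE => //; apply: re_subP.
have subC : A `<=` adjoin (x ^+ 2).
  by move=> a Aa; exists [:: a] => //=; rewrite mulr0 addr0.
have : adjoin (x ^+ 2) x.
  apply: (pE _ (adjoin_subring (x ^+ 2)) subC).
  exists 2, (fun i => if i == 0 :> nat then - x ^+ 2 else 0); split.
    have h0 : adjoin (x ^+ 2) 0 by exists [::].
    move=> i; case: ifP => // _; exists [:: 0; -1] => /=.
      by split; [apply: sub0|split=> //; apply/subN/sub1].
    by rewrite mulr0 addr0 mulrN1 add0r.
  by rewrite big_ord_recl big_ord1 /= expr0; ring.
move=> [[|a s]]; first by move=> _ /= x0; exists 0; rewrite x0 !mul0r subr0;
  split; apply: sub0.
move=> /= [Aa /interleave[r Ar h]] xE.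
have [] := @horn_tail r 1 (fun i => if i is 0 then a else -1) icA Ar.
- by case=> [|i] //; apply/subN/sub1.
- by rewrite h big_ord_recl big_ord1 /= {2}xE expr1 expr0 mulr1 -h; ring.
move=> Ah Axh; exists (horn x r); split=> //; first by rewrite mulrC.
rewrite {1}xE -h.
have -> : a + x ^+ 2 * horn x r - horn x r * x ^+ 2 = a by ring.
by [].
Qed.
End Horner.

Lemma is_pruferP (E : ringext) : is_prufer E <-> forall x : E, prufer_at x.
Proof.
split=> [pE x|h C Csub AC x [n [c [cC cE]]]]; first exact: prufer_at_prufer.
pose E' := RingExt Csub.
case: n c cC cE => [|n] c cC cE.
  (* A monic relation of degree 0 says [1 = 0], whence [x = 0]. *)
  move: cE; rewrite expr0 big_ord0 addr0 => /(congr1 ( *%R x)).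
  by rewrite mulr1 mulr0 => ->; apply: (@sub0 E').
apply: (@prufer_at_stable E' x); first by exists n, c.
by have [v [h1 h2 h3]] := h x; exists v; split; apply: AC.
Qed.

(** Write [y = g x + a] with [a] in [A']. The image of the [v] of [x] serves for [y]: the terms by
    which the conditions for [y] differ from the images of those for [x] are products of [a], [g v]
    and [g (v * x)], which all lie in [A']. *)
Lemma prufer_extend (E E' : ringext) (g : {rmorphism E -> E'}) :
  is_prufer E -> (forall x, re_sub E x -> re_sub E' (g x)) ->
  (forall y : E', exists x, re_sub E' (y - g x)) -> is_prufer E'.
Proof.
move=> /is_pruferP pE gA gS; apply/is_pruferP => y.
have [x Aa] := gS y; have [v [Av Avx Au]] := pE x.
have Ev : y = g x + (y - g x) by rewrite addrC subrK.
move: Aa Ev; set a := y - g x => Aa Ev.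
have := gA _ Avx; rewrite rmorphM => Avx'.
exists (g v); split; [exact: gA| |].
  by rewrite Ev mulrDr; apply: subD => //; apply/subM/Aa/gA.
have -> : y - g v * y ^+ 2 =
    g (x - v * x ^+ 2) + (a - (1 + 1) * (g v * g x * a) - g v * a * a).
  by rewrite Ev rmorphB rmorphM rmorphXn; ring.
apply: subD; first exact: gA.
apply: subB; last by do !apply: subM => //; apply: gA.
apply: subB => //; apply: subM; first by apply: subD; apply: sub1.
by apply: subM.
Qed.

(** * The semiring of submodules *)

Record smod (E : ringext) := Smod {
  sm_set : E -> Prop;
  sm0 : sm_set 0;
  smD : forall x y, sm_set x -> sm_set y -> sm_set (x + y);
  smZ : forall a x, re_sub E a -> sm_set x -> sm_set (a * x)
}.
Coercion sm_set : smod >-> Funclass.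

Section SmodTheory.
Context (E : ringext).
Implicit Types (x y z a : E) (I J K : smod E).
Local Notation A := (re_sub E).

Lemma smod_set_inj I J : sm_set I = sm_set J -> I = J.
Proof.
case: I J => [I i0 iD iZ] [J j0 jD jZ] /= IJ; subst J.
by rewrite (Prop_irrelevance i0 j0) (Prop_irrelevance iD jD)
  (Prop_irrelevance iZ jZ).
Qed.

Lemma smod_eq I J : sm_set I `<=` sm_set J -> sm_set J `<=` sm_set I -> I = J.
Proof. by move=> IJ JI; apply: smod_set_inj; apply/seteqP. Qed.

Lemma smN I x : I x -> I (- x).
Proof. by rewrite -mulN1r; apply/smZ/subN/sub1. Qed.
Lemma smB I x y : I x -> I y -> I (x - y).
Proof. by move=> Ix Iy; apply: smD => //; apply: smN. Qed.
Lemma smZr I x y : I x -> A y -> I (x * y).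
Proof. by move=> Ix Ay; rewrite mulrC; apply: smZ. Qed.
Lemma sm_sum I n (F : 'I_n -> E) : (forall i, I (F i)) -> I (\sum_(i < n) F i).
Proof. by move=> h; apply: big_ind => //; [exact: sm0|exact: smD]. Qed.

HB.instance Definition _ := gen_eqMixin (smod E).
HB.instance Definition _ := gen_choiceMixin (smod E).

Definition sm_zero : smod E.
Proof.
exists [set 0] => // [x y -> ->|a x _ ->]; first exact: addr0.
exact: mulr0.
Defined.

Definition sm_one : smod E.
Proof. by exists A; [exact: sub0|exact: subD|exact: subM]. Defined.

Definition sm_add I J : smod E.
Proof.
exists (addm I J).
- by exists 0; [exact: sm0|exists 0; [exact: sm0|exact: addr0]].
- move=> _ _ [x Ix [y Jy <-]] [x' Ix' [y' Jy' <-]].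
  by exists (x + x'); [exact: smD|exists (y + y');
    [exact: smD|rewrite addrACA]].
move=> a _ Aa [x Ix [y Jy <-]].
by exists (a * x); [exact: smZ|exists (a * y); [exact: smZ|rewrite mulrDr]].
Defined.

Lemma mulm_gen (I J : set E) x y : I x -> J y -> mulm I J (x * y).
Proof.
move=> Ix Jy; exists [:: (x, y)]; rewrite big_seq1; split=> // p.
by rewrite inE => /eqP ->.
Qed.

Lemma mulm_ind (I J P : set E) : P 0 -> (forall x y, P x -> P y -> P (x + y)) ->
  (forall x y, I x -> J y -> P (x * y)) -> mulm I J `<=` P.
Proof.
move=> P0 PD PM _ [s [h ->]]; rewrite big_seq.
by apply: big_ind => // p /h[]; apply: PM.
Qed.

Lemma mulmD (I J : set E) x y : mulm I J x -> mulm I J y -> mulm I J (x + y).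
Proof.
move=> [s [hs ->]] [q [hq ->]]; exists (s ++ q); rewrite big_cat; split=> // p.
by rewrite mem_cat => /orP[/hs|/hq].
Qed.

Lemma mulm0 (I J : set E) : mulm I J 0.
Proof. by exists [::]; rewrite big_nil. Qed.

Lemma mulmZ I (J : set E) a x : A a -> mulm I J x -> mulm I J (a * x).
Proof.
move=> Aa; move: x.
apply: (@mulm_ind I J [set x | mulm I J (a * x)]) => [|x y|x y Ix Jy];
  rewrite /= ?mulr0 ?mulrDr ?mulrA; [exact: mulm0|exact: mulmD|].
by apply: mulm_gen => //; apply: smZ.
Qed.

Definition sm_mul I J : smod E :=
  Smod (mulm0 I J) (@mulmD I J) (@mulmZ I J).

Lemma sm_addA : associative sm_add.
Proof.
move=> I J K; apply: smod_eq => t /=.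
  move=> [x Ix [_ [y Jy [z Kz <-]] <-]]; exists (x + y);
    first by exists x => //; exists y.
  by exists z => //; rewrite addrA.
move=> [_ [x Ix [y Jy <-]] [z Kz <-]]; exists x => //; exists (y + z);
  last by rewrite addrA.
by exists y => //; exists z.
Qed.

Lemma sm_addC : commutative sm_add.
Proof.
by move=> I J; apply: smod_eq => _ /= [x Ix [y Jy <-]]; exists y => //;
  exists x => //; rewrite addrC.
Qed.

Lemma sm_add0 : left_id sm_zero sm_add.
Proof.
move=> I; apply: smod_eq => [_ [x -> [y Iy <-]]|x Ix] /=;
  first by rewrite add0r.
by exists 0 => //; exists x => //; rewrite add0r.
Qed.

Lemma sm_mul_sub I J K :
  (forall x y, I x -> J y -> K (x * y)) -> sm_set (sm_mul I J) `<=` sm_set K.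
Proof. by move=> h; apply: (mulm_ind (sm0 K) (@smD _ K) h). Qed.

Lemma sm_mulC : commutative sm_mul.
Proof.
by move=> I J; apply: smod_eq; apply: sm_mul_sub => x y Ix Jy; rewrite mulrC;
  apply: mulm_gen.
Qed.

Lemma sm_mulA_sub I J K :
  sm_set (sm_mul (sm_mul I J) K) `<=` sm_set (sm_mul I (sm_mul J K)).
Proof.
apply: sm_mul_sub => x z + Kz; move: x.
apply: (@mulm_ind I J [set x | sm_mul I (sm_mul J K) (x * z)])
  => [|x y Ix Iy|x y Ix Jy] /=.
- by rewrite mul0r; apply: (sm0 (sm_mul I (sm_mul J K))).
- by rewrite mulrDl; apply: (@smD _ (sm_mul I (sm_mul J K))).
by rewrite -mulrA; do 2?apply: mulm_gen.
Qed.

Lemma sm_mulA : associative sm_mul.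
Proof.
move=> I J K; apply: smod_eq; last exact: sm_mulA_sub.
rewrite sm_mulC (sm_mulC J) (sm_mulC _ K) (sm_mulC I).
exact: sm_mulA_sub.
Qed.

Lemma sm_mul1 : left_id sm_one sm_mul.
Proof.
move=> I; apply: smod_eq; first by apply: sm_mul_sub => x y; apply: smZ.
by move=> x Ix; rewrite -[x]mul1r; apply: mulm_gen => //; apply: sub1.
Qed.

Lemma sm_mulD : left_distributive sm_mul sm_add.
Proof.
move=> I J K; apply: smod_eq.
  apply: (@sm_mul_sub _ _ (sm_add (sm_mul I K) (sm_mul J K))).
  move=> _ z [x Ix [y Jy <-]] Kz; rewrite mulrDl.
  by exists (x * z); [exact: mulm_gen|exists (y * z); [exact: mulm_gen|]].
move=> _ [x + [y + <-]] => Hx Hy; apply: smD; [move: Hx|move: Hy];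
  apply: sm_mul_sub => u v hu hv.
  by apply: mulm_gen => //; exists u => //; exists 0;
    [exact: sm0|rewrite addr0].
by apply: mulm_gen => //; exists 0; [exact: sm0|exists u => //; rewrite add0r].
Qed.

Lemma sm_mul0 : left_zero sm_zero sm_mul.
Proof.
move=> I; apply: smod_eq; last by move=> _ ->; apply: sm0.
by apply: sm_mul_sub => x y -> _ /=; rewrite mul0r.
Qed.

HB.instance Definition _ :=
  GRing.isNmodule.Build (smod E) sm_addA sm_addC sm_add0.
HB.instance Definition _ := GRing.Nmodule_isComPzSemiRing.Build (smod E)
  sm_mulA sm_mulC sm_mul1 sm_mulD sm_mul0.
End SmodTheory.

(** Inclusion; the order on Lambda is the reverse one, as [rba_le] shows. *)
Definition sm_le (E : ringext) (I J : smod E) := forall x, I x -> J x.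
Local Notation "I <=s J" := (sm_le I J) (at level 70, no associativity).

(** Finite generation is not part of the definition: [mul_eq1_gen] extracts generators from an
    expression of [1] in the product. *)
Definition munit (E : ringext) (I : smod E) := exists J, I * J = 1.

Section SmodOrder.
Context (E : ringext).
Implicit Types (x y z a : E) (I J K L : smod E).
Local Notation A := (re_sub E).

Lemma sle_refl I : I <=s I. Proof. by []. Qed.
Lemma sle_trans J I K : I <=s J -> J <=s K -> I <=s K.
Proof. by move=> IJ JK x /IJ/JK. Qed.
Lemma sle_anti I J : I <=s J -> J <=s I -> I = J.
Proof. exact: smod_eq. Qed.
Lemma sle_addl I J : I <=s I + J.
Proof.
by move=> x Ix; exists x => //; exists 0; [exact: sm0|rewrite addr0].
Qed.
Lemma sle_addr I J : J <=s I + J.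
Proof. by rewrite addrC; apply: sle_addl. Qed.
Lemma sle_lub I J K : I <=s K -> J <=s K -> I + J <=s K.
Proof. by move=> IK JK _ [x /IK Ix [y /JK Jy <-]]; apply: smD. Qed.
Lemma sle_add I J K L : I <=s K -> J <=s L -> I + J <=s K + L.
Proof.
move=> IK JL; apply: sle_lub; first by apply: sle_trans IK (@sle_addl _ _).
exact: sle_trans JL (@sle_addr _ _).
Qed.
Lemma in_smul I J x y : I x -> J y -> (I * J)%R (x * y).
Proof. exact: mulm_gen. Qed.
Lemma smul_sub I J K : (forall x y, I x -> J y -> K (x * y)) -> I * J <=s K.
Proof. exact: sm_mul_sub. Qed.
Lemma sle_mul I J K L : I <=s K -> J <=s L -> I * J <=s K * L.
Proof.
by move=> IK JL; apply: smul_sub => x y /IK Kx /JL Ly; apply: in_smul.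
Qed.
Lemma sle_mull I J K : J <=s K -> I * J <=s I * K.
Proof. exact: sle_mul. Qed.
Lemma addss I : I + I = I.
Proof. by apply: sle_anti; [exact: sle_lub|exact: sle_addl]. Qed.
Lemma sadd_idPr I J : I <=s J -> I + J = J.
Proof. by move=> IJ; apply: sle_anti; [exact: sle_lub|exact: sle_addr]. Qed.

Definition sm_pr x : smod E.
Proof.
exists (scalem x A).
- by exists 0 => //; rewrite mulr0.
- by move=> _ _ [a Aa <-] [b Ab <-]; exists (a + b);
  [exact: subD|rewrite mulrDr].
by move=> a _ Aa [b Ab <-]; exists (a * b); [exact: subM|rewrite mulrCA].
Defined.

Lemma sm_pr_id x : sm_pr x x. Proof. by exists 1; rewrite ?mulr1. Qed.
Lemma sm_pr_le x I : sm_pr x <=s I <-> I x.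
Proof.
split=> [|Ix _ [a Aa <-]]; last exact: smZr.
by apply; apply: sm_pr_id.
Qed.
Lemma sone_le I : 1 <=s I <-> I 1.
Proof.
split=> [|I1 x Ax]; first by apply; apply: sub1.
by rewrite -[x]mulr1; apply: smZ.
Qed.
Lemma sm_prM x y : sm_pr x * sm_pr y = sm_pr (x * y).
Proof.
apply: sle_anti; last by apply/sm_pr_le/in_smul; apply: sm_pr_id.
apply: smul_sub => _ _ [a Aa <-] [b Ab <-].
by exists (a * b); [exact: subM|rewrite mulrACA].
Qed.

Lemma sm_pr_mul x I : sm_set (sm_pr x * I) = scalem x I.
Proof.
apply/seteqP; split=> [|_ [y Iy <-]]; last by apply: in_smul => //;
  apply: sm_pr_id.
have D : forall y, I y -> scalem x I (x * y) by move=> y Iy; exists y.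
apply: (@mulm_ind _ (sm_pr x) I (scalem x I)).
- by exists 0; [exact: sm0|rewrite mulr0].
- by move=> _ _ [y Iy <-] [z Iz <-]; rewrite -mulrDr; apply/D/smD.
by move=> _ y [a Aa <-] Iy; rewrite -mulrA; apply/D/smZ.
Qed.

Lemma lspan_smod n (s : 'I_n -> E) :
  sm_set (\sum_(i < n) sm_pr (s i)) = lspan A s.
Proof.
elim: n s => [|n IH] s.
  rewrite big_ord0; apply/seteqP; split=> [_ ->|_ [a [_ ->]]].
    by exists (fun=> 0); rewrite big_ord0; split=> //; case.
  by rewrite big_ord0.
rewrite big_ord_recl; apply/seteqP; split.
  move=> _ [_ [a Aa <-] [y + <-]]; rewrite IH => -[b [Ab ->]].
  exists (fun i => if unlift ord0 i is Some j then b j else a); split.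
    by move=> i; case: unliftP.
  rewrite big_ord_recl unlift_none mulrC; congr (_ + _).
  by apply: eq_bigr => i _; rewrite liftK.
move=> _ [a [Aa ->]]; rewrite big_ord_recl.
exists (a ord0 * s ord0); first by exists (a ord0) => //; rewrite mulrC.
exists (\sum_(i < n) a (lift ord0 i) * s (lift ord0 i)) => //.
by rewrite IH; exists (fun i => a (lift ord0 i)).
Qed.

Lemma sm_sum_le n (s : 'I_n -> E) I :
  \sum_(i < n) sm_pr (s i) <=s I <-> forall i, I (s i).
Proof.
split=> [h i|h].
  by apply: h; rewrite (bigD1 i) //; apply: sle_addl; apply: sm_pr_id.
rewrite /sm_le lspan_smod => _ [a [Aa ->]].
by apply: sm_sum => i; apply: smZ.
Qed.

Lemma smul_seq I J z : (I * J)%R z -> exists n (s t : 'I_n -> E),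
  [/\ forall i, I (s i), forall i, J (t i) & z = \sum_(i < n) s i * t i].
Proof.
move=> [l [h ->]]; exists (size l), (fun i => (l`_i).1), (fun i => (l`_i).2).
rewrite (big_nth 0) big_mkord; split=> // i.
  by have [] := h _ (mem_nth 0 (ltn_ord i)).
by have [] := h _ (mem_nth 0 (ltn_ord i)).
Qed.

(** The dual basis argument: an [x] in [I] is the sum of the [(x * t i) * s i], and [x * t i] lies
    in [I * J = 1]. *)
Lemma mul_eq1_span I J n (s t : 'I_n -> E) : I * J = 1 -> (forall i, I (s i)) ->
  (forall i, J (t i)) -> 1 = \sum_(i < n) s i * t i ->
  I = \sum_(i < n) sm_pr (s i).
Proof.
move=> IJ Is Jt E1; apply: sle_anti; last exact/sm_sum_le.
rewrite /sm_le lspan_smod => x Ix; exists (fun i => x * t i); split.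
  by move=> i; rewrite -[A _]/((1 : smod E) _) -IJ; apply: in_smul.
by rewrite -[LHS]mulr1 E1 mulr_sumr; apply: eq_bigr => i _;
  rewrite mulrA mulrAC.
Qed.

Lemma mul_eq1_gen I J : I * J = 1 -> exists n (s t : 'I_n -> E),
  [/\ forall i, I (s i), forall i, J (t i), 1 = \sum_(i < n) s i * t i
    & I = \sum_(i < n) sm_pr (s i)].
Proof.
move=> IJ; have : (I * J)%R 1 by rewrite IJ; apply: sub1.
move=> /smul_seq[n [s [t [Is Jt E1]]]]; exists n, s, t; split=> //.
exact: mul_eq1_span Jt E1.
Qed.

Lemma munit_fg I : munit I ->
  exists n (s : 'I_n -> E), I = \sum_(i < n) sm_pr (s i).
Proof. by move=> [J /mul_eq1_gen[n [s [_ [_ _ _ ->]]]]]; exists n, s. Qed.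

Lemma munit1 : munit (1 : smod E). Proof. by exists 1; rewrite mulr1. Qed.
Lemma munitM I J : munit I -> munit J -> munit (I * J).
Proof.
by move=> [I' II'] [J' JJ']; exists (I' * J'); rewrite mulrACA II' JJ' mulr1.
Qed.

Definition sm_inv I : smod E :=
  if pselect (munit I) is left h then sval (cid h) else I.

Lemma smulV I : munit I -> I * sm_inv I = 1.
Proof. by move=> uI; rewrite /sm_inv; case: pselect => // h; case: cid. Qed.
Lemma smulVl I : munit I -> sm_inv I * I = 1.
Proof. by rewrite mulrC; apply: smulV. Qed.
Lemma sm_invU I J : I * J = 1 -> sm_inv I = J.
Proof.
move=> IJ; have uI : munit I by exists J.
by rewrite -[LHS]mulr1 -IJ mulrA smulVl // mul1r.
Qed.
Lemma munitV I : munit I -> munit (sm_inv I).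
Proof. by move=> uI; exists I; apply: smulVl. Qed.

Lemma smul_cancel I J K : munit I -> I * J = I * K -> J = K.
Proof.
by move=> [I' II'] /(congr1 ( *%R I')); rewrite !mulrA (mulrC I') II' !mul1r.
Qed.

(** * Sums of invertible modules over a Prüfer extension *)

Section Prufer.
Context (pE : is_prufer E).

(** Induction on the number of generators, by gluing along [1 = u + v * x] as for an open cover.
    Since [u], [u * x], [v] and [v * x] are in [A], the module [u K] lies in [1 + u L] and [v K] in
    [1 + v L]; both are invertible by induction, [u L] and [v L] having one generator less than [K]
    has besides [1]. With [J] and [J'] their inverses, the inverse of [K] is [u J + v J']. *)
Lemma munit_span n (s : 'I_n -> E) : munit (1 + \sum_(i < n) sm_pr (s i)).
Proof.
elim: n s => [|n IH] s; first by rewrite big_ord0 addr0; apply: munit1.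
rewrite big_ord_recl; set x := s ord0.
pose L := \sum_(i < n) sm_pr (s (lift ord0 i)).
rewrite -/L; set K := 1 + _.
have hL a : munit (1 + sm_pr a * L).
  by rewrite mulr_sumr; under eq_bigr do rewrite sm_prM; apply: IH.
have [v [Av Avx Aux]] := proj1 (is_pruferP E) pE x.
pose u := 1 - v * x.
have Au : A u by apply: subB.
have {}Aux : A (u * x) by rewrite mulrBl mul1r -mulrA -expr2.
have [J EJ] := hL u; have [J' EJ'] := hL v.
have KE w : sm_pr w * K = sm_pr w + (sm_pr (w * x) + sm_pr w * L).
  by rewrite !mulrDr mulr1 sm_prM.
have one w : A w -> sm_pr w <=s 1 by move=> Aw; apply/sm_pr_le.
have small w : A w -> A (w * x) -> sm_pr w * K <=s 1 + sm_pr w * L.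
  move=> Aw Awx; rewrite KE; apply: sle_lub.
    exact: sle_trans (one _ Aw) (@sle_addl _ _).
  by apply: sle_add => //; apply: one.
have big w z : A z -> sm_pr z <=s sm_pr w * K ->
  sm_pr z * (1 + sm_pr w * L) <=s sm_pr w * K.
  move=> Az zw; rewrite mulrDr mulr1; apply: sle_lub => //.
  rewrite KE; apply: sle_trans (@sle_addr _ _);
    apply: sle_trans (@sle_addr _ _).
  by rewrite -{2}[sm_pr w * L]mul1r; apply: sle_mul => //; apply: one.
exists (sm_pr u * J + sm_pr v * J').
have -> : K * (sm_pr u * J + sm_pr v * J') =
    J * (sm_pr u * K) + J' * (sm_pr v * K) by ring.
apply: sle_anti.
  apply: sle_lub; [rewrite -EJ|rewrite -EJ'];
    by rewrite mulrC; apply: sle_mul => //; apply: small.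
(* The two summands of [1] are found in the two summands of the product: [u] in [J * (u K)] and
   [v * x] in [J' * (v K)]. *)
apply/sone_le; have -> : 1 = u + v * x by rewrite subrK.
have down w z J0 : (1 + sm_pr w * L) * J0 = 1 -> A z ->
    sm_pr z <=s sm_pr w * K -> (J0 * (sm_pr w * K))%R z.
  move=> E1 Az zw; apply/sm_pr_le.
  rewrite -[sm_pr z]mulr1 -E1 [_ * J0]mulrC mulrCA; apply: sle_mull; exact: big.
apply: smD; [apply: sle_addl|apply: sle_addr]; apply: down => //; rewrite KE.
  exact: sle_addl.
exact/(sle_trans _ (@sle_addr _ _))/sle_addl.
Qed.

(** Factor out [I]: if [S] is the span, then [I + S = I * (1 + I^-1 * S)], and [I^-1 * S] is
    generated by the products of generators of [I^-1] and [S], so that [munit_span] applies. *)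
Lemma munit_add_span I n (s : 'I_n -> E) :
  munit I -> munit (I + \sum_(i < n) sm_pr (s i)).
Proof.
move=> uI; have [m [t tE]] := munit_fg (munitV uI).
have -> : I + \sum_(i < n) sm_pr (s i) =
    I * (1 + \sum_(p < #|{: 'I_m * 'I_n}|)
      sm_pr (t (enum_val p).1 * s (enum_val p).2)).
  rewrite mulrDr mulr1 -{1}[\sum_(i < n) _]mul1r -(smulV uI) -mulrA tE;
    congr (_ + _ * _).
  rewrite mulr_suml; under eq_bigr do rewrite mulr_sumr.
  rewrite pair_big /= (reindex _ (onW_bij _ (enum_val_bij _))) /=.
  by apply: eq_bigr => p _; rewrite sm_prM.
exact/munitM/munit_span.
Qed.

Lemma munitD I J : munit I -> munit J -> munit (I + J).
Proof. by move=> uI /munit_fg[n [s ->]]; apply: munit_add_span. Qed.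

Lemma munit_pr I x : munit I -> munit (I + sm_pr x).
Proof.
move=> uI; have := @munit_add_span I 1 (fun=> x) uI.
by rewrite big_ord1.
Qed.
End Prufer.

Lemma Mon_smod (S : set E) : Mon E S -> exists I : smod E, sm_set I = S.
Proof.
by move=> [n [s ->]]; exists (\sum_(i < n) sm_pr (s i)); apply: lspan_smod.
Qed.

Lemma munit_Mon I : munit I -> Mon E (sm_set I).
Proof. by move=> /munit_fg[n [s ->]]; exists n, s; apply: lspan_smod. Qed.

Lemma MstarP_munit I : Mstar E (sm_set I) <-> munit I.
Proof.
split=> [[_ [_ /Mon_smod[J <-] IJ]]|uI]; first by exists J; apply: smod_set_inj.
split; first exact: munit_Mon.
exists (sm_set (sm_inv I)); first exact/munit_Mon/munitV.
by rewrite -[LHS]/(sm_set (I * sm_inv I)) smulV.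
Qed.

Lemma Mstar_smod (S : set E) : Mstar E S ->
  exists2 I : smod E, sm_set I = S & munit I.
Proof.
move=> MS; have [I IS] := Mon_smod (proj1 MS).
by exists I => //; apply/MstarP_munit; rewrite IS.
Qed.
End SmodOrder.

(** * The cr-qsring of a Prüfer extension *)

Lemma modclass_eq (E : ringext) (I : smod E) x y :
  modclass x (sm_set I) = modclass y (sm_set I) <-> I (x - y).
Proof.
have h u w : I (u - w) -> modclass u (sm_set I) `<=` modclass w (sm_set I).
  move=> d _ [a Ia <-]; exists (u - w + a); first exact: smD.
  by rewrite addrA addrCA subrr addr0.
split=> [E0|xy]; last first.
  by apply/seteqP; split; apply: h => //; rewrite -opprB; apply: smN.
have : modclass x (sm_set I) x by exists 0; [exact: sm0|rewrite addr0].
by rewrite E0 => -[a Ia <-]; rewrite addrC addKr.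
Qed.

Lemma sm_eq0 (E : ringext) (I : smod E) x : x = 0 -> I x.
Proof. by move=> ->; apply: sm0. Qed.

Section RBAConstruction.
Context (E : prufer_ext).
Implicit Types (x y z : E) (I J K V : smod E) (X Y Z : RBA_set E).
Let pE := pe_prufer E.

Lemma cls_subproof x I : munit I -> RBA_set E (rba_cls x (sm_set I)).
Proof. by move=> uI; split=> /=; [apply/MstarP_munit|exists x]. Qed.

Definition cls x I (uI : munit I) : RBA_set E :=
  exist _ (rba_cls x (sm_set I)) (mem_set (cls_subproof x uI)).

Lemma cls_eq x y I J (uI : munit I) (uJ : munit J) :
  I = J -> I (x - y) -> cls x uI = cls y uJ.
Proof.
by move=> IJ; subst J => /modclass_eq h; apply/val_inj; rewrite /= /rba_cls h.
Qed.

Lemma cls_inj x y I J (uI : munit I) (uJ : munit J) :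
  cls x uI = cls y uJ -> I = J /\ I (x - y).
Proof.
move=> [/smod_set_inj IJ]; subst J => h; split=> //.
exact/modclass_eq.
Qed.

Lemma rba_clsP X x (a : set E) : val X = rba_cls x a ->
  exists I (uI : munit I), a = sm_set I /\ X = cls x uI.
Proof.
move=> XE; have [] := set_valP X; rewrite XE /= => /Mstar_smod[I IE uI] _.
by exists I, uI; split=> //; apply: val_inj; rewrite /= IE -XE.
Qed.

Lemma cls_ex X : exists p : E * {I : smod E | munit I}, X = cls p.1 (svalP p.2).
Proof.
have [_ [x xE]] := set_valP X.
have [I [uI [_ ->]]] := rba_clsP xE.
by exists (x, exist _ I uI); apply: cls_eq => //; apply: sm_eq0; apply: subrr.
Qed.

Lemma clsP X : exists x I (uI : munit I), X = cls x uI.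
Proof. by have [p ->] := cls_ex X; exists p.1, (sval p.2), (svalP p.2). Qed.

Let rep X := sval (cid (cls_ex X)).
Let repE X : X = cls (rep X).1 (svalP (rep X).2).
Proof. exact: (svalP (cid (cls_ex X))). Qed.

Definition mulI x I y J : smod E := I * J + sm_pr x * J + sm_pr y * I.
Definition vI x I : smod E := I + sm_pr x.

Lemma munit_vI x I : munit I -> munit (vI x I).
Proof. exact: munit_pr. Qed.

(** In this form the modulus of a product is a sum of products of units, hence a unit. With [vI] the
    value of a class, it is also the formula of [ep_mul]. *)
Lemma mulI_v x I y J : mulI x I y J = vI x I * J + vI y J * I.
Proof.
rewrite /mulI /vI !mulrDl addrACA [J * I]mulrC -[I * J in LHS]addss.
by rewrite -!addrA; congr (_ + _); rewrite addrCA.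
Qed.

Lemma munit_mulI x I y J : munit I -> munit J -> munit (mulI x I y J).
Proof.
move=> uI uJ; rewrite mulI_v.
by apply: munitD => //; apply: munitM => //; apply: munit_vI.
Qed.

Definition rba_add X Y : RBA_set E :=
  cls ((rep X).1 + (rep Y).1) (munitD pE (svalP (rep X).2) (svalP (rep Y).2)).
Definition rba_opp X : RBA_set E := cls (- (rep X).1) (svalP (rep X).2).
Definition rba_mul X Y : RBA_set E :=
  cls ((rep X).1 * (rep Y).1)
    (munit_mulI (rep X).1 (rep Y).1 (svalP (rep X).2) (svalP (rep Y).2)).

Lemma rba_addE x y I J (uI : munit I) (uJ : munit J) :
  rba_add (cls x uI) (cls y uJ) = cls (x + y) (munitD pE uI uJ).
Proof.
rewrite /rba_add.
have /cls_inj[EI hx] := repE (cls x uI);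
  have /cls_inj[EJ hy] := repE (cls y uJ).
apply: cls_eq; first by rewrite -EI -EJ.
rewrite -EI -EJ opprD addrACA; apply: smD; [apply: sle_addl|apply: sle_addr].
  by rewrite -opprB; apply: smN.
by rewrite -opprB; apply: smN.
Qed.

Lemma rba_oppE x I (uI : munit I) : rba_opp (cls x uI) = cls (- x) uI.
Proof.
rewrite /rba_opp; have /cls_inj[EI hx] := repE (cls x uI).
by apply: cls_eq; rewrite -EI // opprK addrC.
Qed.

Lemma rba_mulE x y I J (uI : munit I) (uJ : munit J) :
  rba_mul (cls x uI) (cls y uJ) = cls (x * y) (munit_mulI x y uI uJ).
Proof.
rewrite /rba_mul; move: (repE (cls x uI)) (repE (cls y uJ)).
case: (rep (cls x uI)) (rep (cls y uJ)) => [x' [I' uI']] [y' [J' uJ']] /=.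
move=> /cls_inj[EI hx] /cls_inj[EJ hy]; subst I' J'.
have le u u' w w' (K L : smod E) : K (u - u') -> L (w - w') ->
  mulI u K w L <=s mulI u' K w' L.
  have aux a b (M : smod E) : M (a - b) -> sm_pr a <=s M + sm_pr b.
    move=> h; apply/sm_pr_le; rewrite -[a](subrK b).
    by apply: smD; [apply: sle_addl|apply: sle_addr; apply: sm_pr_id].
  move=> hu hw; rewrite /mulI.
  apply: sle_trans (_ : _ <=s K * L + (K + sm_pr u') * L + (L + sm_pr w') * K) _.
    by apply: sle_add; first apply: sle_add => //; apply: sle_mul => //;
      apply: aux.
  have -> : K * L + (K + sm_pr u') * L + (L + sm_pr w') * K =
      (K * L + sm_pr u' * L + sm_pr w' * K) + (K * L + K * L) by ring.
  apply: sle_lub => //; rewrite addss -addrA; exact: sle_addl.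
have sym (M : smod E) a b : M (a - b) -> M (b - a) by move=> h; rewrite -opprB;
  apply: smN.
apply: cls_eq; first by apply: sle_anti; apply: le => //; apply: sym.
have -> : x' * y' - x * y = (y' - y) * x' + (x' - x) * y by ring.
apply: smD; last first.
  apply: (le x x' y y' I J) => //; apply: sle_addr.
  by rewrite mulrC; apply: in_smul; [exact: sym|exact: sm_pr_id].
apply: sle_addl; apply: sle_addr; rewrite mulrC.
by apply: in_smul; [exact: sym|exact: sm_pr_id].
Qed.

(** Let [V] be the inverse of [vI x I]. Splitting [1] along [V * I + V * sm_pr x], the second
    summand is [x * z] with [z] in [V]. *)
Lemma inv_ex x I : munit I -> exists z,
  sm_inv (vI x I) z /\ (sm_inv (vI x I) * I)%R (x * z - 1).
Proof.
move=> uI; have uv := @munit_vI x I uI.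
have : (sm_inv (vI x I) * vI x I)%R 1 by rewrite smulVl //; apply: sub1.
rewrite /vI mulrDr => -[a h1 [b h2 ab]]; move: h2.
rewrite mulrC sm_pr_mul -/(vI x I) => -[z Vz zE]; exists z; split=> //.
by rewrite -ab -zE opprD addrCA subrr addr0; apply: smN.
Qed.

Lemma munit_invI x I : munit I ->
  munit (I * (sm_inv (vI x I) * sm_inv (vI x I))).
Proof. by move=> uI; do !apply: munitM => //; apply/munitV/munit_vI. Qed.

Definition rba_inv X : RBA_set E :=
  let: uI := svalP (rep X).2 in
  cls (sval (cid (inv_ex (rep X).1 uI))) (munit_invI (rep X).1 uI).

Lemma vI_rep x x' I : I (x - x') -> vI x I = vI x' I.
Proof.
move=> h; have aux a b : I (a - b) -> vI a I <=s vI b I.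
  move=> hab; apply: sle_lub; first exact: sle_addl.
  apply/sm_pr_le; rewrite -[a](subrK b).
  by apply: smD; [apply: sle_addl|apply: sle_addr; apply: sm_pr_id].
by apply: sle_anti; apply: aux => //; rewrite -opprB; apply: smN.
Qed.

(** [z] is determined modulo [I V V], with [V] the inverse of [I + A x]: a
    difference [d] of two solutions satisfies [d (I + A x) <= V I]. *)
Lemma rba_invE x I (uI : munit I) V z : vI x I * V = 1 -> V z ->
  (V * I)%R (x * z - 1) -> forall u : munit (I * (V * V)),
  rba_inv (cls x uI) = cls z u.
Proof.
move=> vV Vz xz u; rewrite /rba_inv.
move: (repE (cls x uI)); case: (rep (cls x uI)) => [x' [I' uI']] /=.
move=> /cls_inj[EI hx]; subst I'.
case: cid => z' [Vz' xz'] /=.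
have EV : sm_inv (vI x' I) = V by rewrite -(vI_rep hx); apply: sm_invU.
rewrite EV in Vz' xz'; apply: cls_eq; rewrite EV //.
have Vd : V (z' - z) by apply: smB.
have xd : (V * I)%R ((z' - z) * x).
  have -> : (z' - z) * x = x' * z' - 1 + z' * (x - x') - (x * z - 1) by ring.
  by apply: smB => //; apply: smD => //; apply: in_smul.
apply/sm_pr_le; rewrite -[sm_pr _]mulr1 -vV mulrA.
have -> : I * (V * V) = V * I * V by ring.
apply: sle_mul => //; rewrite mulrDr sm_prM; apply: sle_lub;
  last exact/sm_pr_le.
by apply: sle_mul => //; apply/sm_pr_le.
Qed.

Lemma clsVP x I (uI : munit I) : exists V z (uz : munit (I * (V * V))),
  [/\ vI x I * V = 1, V z,
    (V * I)%R (x * z - 1) & rba_inv (cls x uI) = cls z uz].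
Proof.
have [z [Vz xz]] := inv_ex x uI; have uv := @munit_vI x I uI.
exists (sm_inv (vI x I)), z, (munit_invI x uI); split=> //; first exact: smulV.
by apply: rba_invE => //; apply: smulV.
Qed.

(** Reduces the second regularity law to the first, applied to the inverse of [X]. The point is that
    the value of the inverse is [V], which is [vE]: then [x] satisfies the conditions that
    characterize the inverse of the class of [z]. *)
Lemma rba_invK X : rba_inv (rba_inv X) = X.
Proof.
have [x [I [uI ->]]] := clsP X; have [V [z [uz [vV Vz xz ->]]]] := clsVP x uI.
have Vx : vI x I x by apply: sle_addr; apply: sm_pr_id.
have VI1 : V * I <=s 1 by rewrite -vV mulrC; apply: sle_mul => //;
  apply: sle_addl.
have vE : vI z (I * (V * V)) = V.
  apply: sle_anti.
    apply: sle_lub; last exact/sm_pr_le.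
    by rewrite mulrA -[X in _ <=s X]mul1r; apply: sle_mul => //; rewrite mulrC.
  rewrite -{1}[V]mulr1; apply: sle_trans (_ : _ <=s V * (V * I + sm_pr (z * x))) _.
    apply: sle_mul => //; apply/sone_le.
    have -> : 1 = (1 - x * z) + z * x by rewrite [z * x]mulrC subrK.
    apply: smD; [apply: sle_addl|apply: sle_addr; exact: sm_pr_id].
    by rewrite -opprB; apply: smN.
  rewrite mulrDr; apply: sle_add;
    first by have -> : V * (V * I) = I * (V * V) by ring.
  rewrite -sm_prM [V * _]mulrC -mulrA -[X in _ <=s X]mulr1 -vV.
  by apply: sle_mul => //; rewrite [sm_pr x * V]mulrC [X in _ <=s X]mulrC;
    apply: sle_mul => //; apply: sle_addr.
have E0 : I * (V * V) * (vI x I * vI x I) = I.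
  have -> : I * (V * V) * (vI x I * vI x I) =
      I * (vI x I * V) * (vI x I * V) by ring.
  by rewrite vV !mulr1.
have u' : munit (I * (V * V) * (vI x I * vI x I)) by rewrite E0.
have zx : (vI x I * (I * (V * V)))%R (z * x - 1).
  have -> : vI x I * (I * (V * V)) = V * I * (vI x I * V) by ring.
  by rewrite vV mulr1 [z * x]mulrC.
rewrite (rba_invE _ _ Vx zx u'); last by rewrite vE mulrC.
by apply: cls_eq => //; rewrite E0; apply: sm_eq0; rewrite subrr.
Qed.

Lemma rba_mulK X : rba_mul (rba_mul X X) (rba_inv X) = X.
Proof.
have [x [I [uI ->]]] := clsP X; have [V [z [uz [vV Vz xz ->]]]] := clsVP x uI.
rewrite !rba_mulE.
have Ev : mulI x I x I = I * vI x I.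
  by rewrite /mulI -addrA addss mulrDr [I * sm_pr x]mulrC.
have le1 J K : J <=s vI x I -> K <=s V -> J * K <=s 1.
  by move=> hJ hK; rewrite -vV; apply: sle_mul.
have Iv : I <=s vI x I by apply: sle_addl.
have xv : sm_pr x <=s vI x I by apply: sle_addr.
have xVI : I (x * (x * z - 1)).
  rewrite -[I]mul1r -vV -mulrA; apply: in_smul => //; exact/sm_pr_le.
have EI : mulI (x * x) (mulI x I x I) z (I * (V * V)) = I.
  rewrite Ev /mulI.
  have -> : I * vI x I * (I * (V * V)) + sm_pr (x * x) * (I * (V * V)) +
      sm_pr z * (I * vI x I) =
      I * (I * V * (vI x I * V) + (sm_pr x * V) * (sm_pr x * V) + vI x I * sm_pr z).
    by rewrite -sm_prM; ring.
  rewrite vV mulr1 -[X in _ = X]mulr1; congr (_ * _); apply: sle_anti.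
    apply: sle_lub; last by apply: le1 => //; apply/sm_pr_le.
    apply: sle_lub; first exact: le1.
    by rewrite -[1]mulr1; apply: sle_mul; apply: le1.
  (* Here [x * z] lies in [vI x I * sm_pr z] and [x * z - 1] in [I * V], two of the summands. *)
  apply/sone_le; have -> : 1 = x * z - (x * z - 1) by rewrite subKr.
  apply: smB; last by apply: sle_addl; apply: sle_addl; rewrite mulrC.
  by apply: sle_addr; apply: in_smul; [exact/sm_pr_le|exact: sm_pr_id].
apply: cls_eq => //; rewrite EI.
by have -> : x * x * z - x = x * (x * z - 1) by ring.
Qed.

Definition rba_alg : qsalg :=
  QSAlg rba_add rba_mul rba_opp rba_inv (cls 0 (munit1 E)).

Lemma rba_qadd x y I J (uI : munit I) (uJ : munit J) :
  @qs_add rba_alg (cls x uI) (cls y uJ) = cls (x + y) (munitD pE uI uJ).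
Proof. exact: rba_addE. Qed.
Lemma rba_qmul x y I J (uI : munit I) (uJ : munit J) :
  @qs_mul rba_alg (cls x uI) (cls y uJ) = cls (x * y) (munit_mulI x y uI uJ).
Proof. exact: rba_mulE. Qed.

Lemma rba_ep x I (uI : munit I) : ep (cls x uI : rba_alg) = cls 0 uI.
Proof.
rewrite /ep /= rba_oppE rba_addE; apply: cls_eq; first exact: addss.
by apply: sm_eq0; rewrite subr0 subrr.
Qed.

Lemma rba_le x y I J (uI : munit I) (uJ : munit J) :
  @qle rba_alg (cls x uI) (cls y uJ) <-> J <=s I /\ I (x - y).
Proof.
rewrite /qle rba_ep /= rba_addE; split=> [/cls_inj[IE]|[JI xy]].
  by rewrite addr0 => h; split=> //; rewrite IE; apply: sle_addl.
by apply: cls_eq; rewrite ?addr0 // sadd_idPr.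
Qed.

(** Comparing moduli, [I * (I + A x) = I], so [I + A x = A]. Writing [1 = a + x * b] with [a] in [I]
    and [b] in [A] gives [x - 1 = a * (x - 1) + b * (x * x - x)], which is in [I]. *)
Lemma rba_Em x I (uI : munit I) : Em rba_alg (cls x uI) -> I <=s 1 /\ I (x - 1).
Proof.
rewrite /Em /= rba_mulE => /cls_inj[EI].
have v1 : I + sm_pr x = 1.
  apply: (smul_cancel uI); rewrite mulr1 -[RHS]EI mulrDr /mulI -addrA addss.
  by rewrite [I * sm_pr x]mulrC.
rewrite EI => xx.
split; first by rewrite -v1; apply: sle_addl.
have : (I + sm_pr x)%R 1 by rewrite v1; apply: sub1.
move=> [a Ia [_ [b Ab <-] E1]].
have -> : x - 1 = a * (x - 1) + b * (x * x - x) by rewrite -[LHS]mul1r -{1}E1;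
  ring.
apply: smD; last exact: smZ.
apply: smZr => //; apply: subB => //.
by have : (1 : smod E)%R x by rewrite -v1; apply: sle_addr; apply: sm_pr_id.
Qed.

Lemma rba_one_Em I (uI : munit I) : I <=s 1 -> Em rba_alg (cls 1 uI).
Proof.
move=> I1; rewrite /Em /= rba_mulE; apply: cls_eq.
  rewrite /mulI -addrA addss.
  have -> : sm_pr 1 = 1 :> smod E by apply: sle_anti;
    [exact/sm_pr_le/sub1|exact/sone_le/sm_pr_id].
  by rewrite mul1r; apply: sadd_idPr; rewrite -[X in _ <=s X]mul1r;
    apply: sle_mul.
by apply: sm_eq0; rewrite mulr1 subrr.
Qed.

Lemma rba_Ep X : Ep rba_alg X -> exists I (uI : munit I), X = cls 0 uI.
Proof.
have [x [I [uI ->]]] := clsP X; rewrite /Ep /= rba_addE => /cls_inj[_].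
rewrite addss addrK => Ix; exists I, uI.
by apply: cls_eq; rewrite ?subr0.
Qed.

Lemma rba_Ep0 I (uI : munit I) : Ep rba_alg (cls 0 uI).
Proof.
rewrite /Ep /= rba_addE; apply: cls_eq; first exact: addss.
by apply: sm_eq0; rewrite addr0 subrr.
Qed.

Lemma sm_pr0 : sm_pr (0 : E) = 0 :> smod E.
Proof. by apply: sle_anti; [exact/sm_pr_le/sm0|move=> _ ->; apply: sm0]. Qed.

Lemma rba_ax : is_crqsring rba_alg.
Proof.
split.
- split.
  + move=> X Y Z; have [x [I [uI ->]]] := clsP X;
    have [y [J [uJ ->]]] := clsP Y.
    have [z [K [uK ->]]] := clsP Z; rewrite /= !rba_addE.
    by apply: cls_eq; rewrite ?addrA //; apply: sm_eq0; rewrite subrr.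
  + move=> X Y; have [x [I [uI ->]]] := clsP X; have [y [J [uJ ->]]] := clsP Y.
    rewrite /= !rba_addE.
    by apply: cls_eq; [exact: addrC|apply: sm_eq0; rewrite [x + y]addrC subrr].
  + move=> X; have [x [I [uI ->]]] := clsP X; rewrite /= rba_oppE !rba_addE.
    by apply: cls_eq; rewrite !addss // addrK; apply: sm_eq0; rewrite subrr.
  move=> X; have [x [I [uI ->]]] := clsP X; rewrite /= rba_oppE !rba_addE.
  by apply: cls_eq; rewrite !addss // subrK; apply: sm_eq0; rewrite subrr.
- have mulKE := rba_mulK; split=> //=.
  + move=> X Y Z; have [x [I [uI ->]]] := clsP X;
    have [y [J [uJ ->]]] := clsP Y.
    have [z [K [uK ->]]] := clsP Z; rewrite /= !rba_mulE.
    apply: cls_eq; last by apply: sm_eq0; rewrite mulrA subrr.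
    by rewrite /mulI -!sm_prM; ring.
  + move=> X Y; have [x [I [uI ->]]] := clsP X; have [y [J [uJ ->]]] := clsP Y.
    rewrite /= !rba_mulE; apply: cls_eq; last by apply: sm_eq0;
      rewrite mulrC subrr.
    by rewrite /mulI; ring.
  by move=> X; rewrite -{3}[X]rba_invK mulKE.
- apply/seteqP; split=> [X [/rba_Ep[I [uI ->]] /rba_Em[I1 h]]|_ ->].
    apply: cls_eq; last by apply: sm_eq0; rewrite subrr.
    apply: sle_anti => //; apply/sone_le; rewrite -[1]opprK.
    by apply: smN; rewrite -sub0r.
  split; first exact: rba_Ep0.
  rewrite /Em /= rba_mulE; apply: cls_eq; last by apply: sm_eq0;
    rewrite mulr0 subrr.
  by rewrite /mulI sm_pr0 !mul0r !addr0 mulr1.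
- move=> X Y Z; have [x [I [uI ->]]] := clsP X; have [y [J [uJ ->]]] := clsP Y.
  have [z [K [uK ->]]] := clsP Z; rewrite /= !(rba_mulE, rba_addE).
  apply/rba_le; split; last by apply: sm_eq0; rewrite mulrDr subrr.
  rewrite /mulI; have -> : I * J + sm_pr x * J + sm_pr y * I +
      (I * K + sm_pr x * K + sm_pr z * I) =
      I * (J + K) + sm_pr x * (J + K) + (sm_pr y + sm_pr z) * I by ring.
  apply: sle_add => //; apply: sle_mul => //; apply/sm_pr_le.
  by apply: smD; [apply: sle_addl|apply: sle_addr]; apply: sm_pr_id.
- move=> X Y Z; have [x [I [uI ->]]] := clsP X; have [y [J [uJ ->]]] := clsP Y.
  have [z [K [uK ->]]] := clsP Z; rewrite /= !rba_mulE => /rba_le[KJ yz].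
  have h : sm_pr x * J <=s mulI x I y J
    by apply: sle_trans (@sle_addr _ _ _) (@sle_addl _ _ _).
  have h' : I * J <=s mulI x I y J by rewrite /mulI -addrA; apply: sle_addl.
  apply/rba_le; split; last first.
    by rewrite -mulrBr; apply: h; apply: in_smul => //; apply: sm_pr_id.
  apply: sle_lub; first apply: sle_lub.
  + exact/(sle_trans _ h')/sle_mull.
  + exact/(sle_trans _ h)/sle_mull.
  (* Replacing [z] by [y] costs a multiple of [y - z], an element of [J], and [I * J] is already
     part of the modulus. *)
  rewrite mulrC; apply: smul_sub => a _ Ia [c Ac <-].
  have -> : a * (z * c) = y * c * a - a * ((y - z) * c) by ring.
  apply: smB; first by apply: sle_addr; apply: in_smul => //; exists c.
  by apply: h'; apply: in_smul => //; apply: smZr.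
- move=> X Y; have [x [I [uI ->]]] := clsP X; have [y [J [uJ ->]]] := clsP Y.
  rewrite /= [rba_opp (cls y uJ)]rba_oppE !rba_mulE rba_oppE.
  have h w : sm_pr (- w) = sm_pr w :> smod E.
    apply: sle_anti; apply/sm_pr_le; first exact/smN/sm_pr_id.
    by have := smN (sm_pr_id (- w)); rewrite opprK.
  apply: cls_eq; first by rewrite /mulI h.
  by apply: sm_eq0; rewrite mulrN subrr.
move=> X Y; have [x [I [uI ->]]] := clsP X; have [y [J [uJ ->]]] := clsP Y.
move=> /rba_Em[I1 x1] /rba_Em[J1 y1]; rewrite rba_qadd rba_qmul !rba_ep.
apply/rba_le; split; last by apply: sm_eq0; rewrite subrr.
have h w K : K <=s 1 -> K (w - 1) -> sm_pr w <=s 1.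
  by move=> K1 kw; apply/sm_pr_le; rewrite -[w](subrK 1); apply: smD => //;
    [exact: K1|exact: sub1].
apply: sle_lub; first apply: sle_lub.
+ by apply: sle_trans (@sle_addr _ _ _); rewrite -{2}[J]mul1r; apply: sle_mul.
+ by apply: sle_trans (@sle_addr _ _ _); rewrite -{2}[J]mul1r;
  apply: sle_mul => //; apply: h x1.
by apply: sle_trans (@sle_addl _ _ _); rewrite -{2}[I]mul1r;
  apply: sle_mul => //; apply: h y1.
Qed.
End RBAConstruction.

(** * The invertible modules of [B_R] *)

Local Open Scope qs_scope.

(** * Arithmetic of the l-group Lambda *)

Section LatticeGroup.
Context (R : srqsring).
Implicit Types x y a b c d : R.

Lemma EpVK x : x^-1^-1 = x.
Proof. exact: (crs_invK (cq_mul (cq_ax R))). Qed.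
Lemma EpMV x y : (x * y)^-1 = x^-1 * y^-1.
Proof. exact: (crs_invM (cq_mul (cq_ax R))). Qed.
Lemma epsV : eps^-1 = eps :> R.
Proof. exact: (crs_inv_idem (cq_mul (cq_ax R)) (@Em_eps R)). Qed.
Lemma EpVl a : Ep R a -> a^-1 * a = eps.
Proof. by move=> pa; rewrite qmulC EpV_eps. Qed.
Lemma EpKV a b : Ep R a -> Ep R b -> a * (a^-1 * b) = b.
Proof. by move=> pa pb; rewrite qmulA EpV_eps // eps_mul. Qed.
Lemma EpVKl a b : Ep R a -> Ep R b -> a^-1 * (a * b) = b.
Proof. by move=> pa pb; rewrite qmulA EpVl // eps_mul. Qed.
Lemma mul_eps a : Ep R a -> a * eps = a.
Proof. by move=> pa; rewrite qmulC eps_mul. Qed.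

Lemma Ep_le_mul a b c : Ep R a -> Ep R b -> Ep R c ->
  a * b <= c <-> b <= a^-1 * c.
Proof.
move=> pa pb pc; split=> [/(qleM a^-1)|/(qleM a)]; first by rewrite EpVKl.
by rewrite EpKV.
Qed.

Lemma EpV_anti a b : Ep R a -> Ep R b -> a <= b -> b^-1 <= a^-1.
Proof.
move=> pa pb ab; have pa' := EpV pa; have pb' := EpV pb.
have := qleM (a^-1 * b^-1) ab.
by rewrite qmulC EpKV // -qmulA EpVl // mul_eps.
Qed.

Lemma qv_restr x a : Ep R a -> qv (x + a) = qv x + a.
Proof.
move=> pa; apply: qle_anti.
  apply: qle_glb; [exact: Ep_v|exact/v_mono/qleDl|].
  apply: qle_trans (v_le_ep _) _.
  by rewrite epD (ep_id pa); apply: qleDr => //; apply: Ep_ep.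
by have := cq_subD (cq_ax R) eps x a; rewrite (eps_mul pa).
Qed.

Lemma qle_addl a b c : Ep R a -> Ep R b -> Ep R c -> a <= b + c -> a <= b.
Proof. by move=> pa pb pc h; apply: qle_trans h _; apply: qleDl. Qed.

(** [c (c /\ eps)^-1 = c \/ eps] *)
Definition join_eps c : R := c * (c + eps)^-1.

Lemma join_epsP c : Ep R c -> LamP R (join_eps c) /\ c <= join_eps c.
Proof.
move=> pc; have pe := @Ep_eps R; have pce := EpD pc pe.
split; last by apply: EpM_ge => //; apply: EpV_ge => //; apply: qleDr.
split; first exact: EpMr.
by rewrite /join_eps qmulC; apply/Ep_le_mul => //; rewrite mul_eps //;
  apply: qleDl.
Qed.

Lemma LamP_above c : Ep R c -> exists a : LamP R, c <= val a.
Proof.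
by move=> /join_epsP[h1 h2]; exists (toP (join_eps c)); rewrite toPK.
Qed.

Lemma LamP_val a : LamP R a -> exists b : LamP R, val b = a.
Proof. by move=> h; exists (toP a); rewrite toPK. Qed.

Lemma big_meetP n (F : 'I_n -> R) d : Ep R d -> (forall i, Ep R (F i)) ->
  let m := \big[@qs_add R/d]_(i < n) F i in
  [/\ Ep R m, m <= d & forall i, m <= F i].
Proof.
move=> pd; elim: n F => [|n IH] F pF /=.
  by rewrite big_ord0; split=> //; [exact: qle_refl|case].
rewrite big_ord_recl.
have [p1 h1 k1] := IH (fun i => F (lift ord0 i)) (fun i => pF _).
split; first exact: EpD.
  by apply: qle_trans h1; apply: qleDr.
move=> i; case: (unliftP ord0 i) => [j ->|->]; last exact: qleDl.
by apply: qle_trans (k1 j); apply: qleDr.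
Qed.

Lemma big_meet_lb n (F : 'I_n -> R) c d : Ep R c -> c <= d ->
  (forall i, c <= F i) -> c <= \big[@qs_add R/d]_(i < n) F i.
Proof.
move=> pc cd cF; apply: (big_ind (fun x => c <= x)) => // x y.
exact: qle_glb.
Qed.
End LatticeGroup.

(** * Evaluation on the whole of Lambda, and the modules [Jm c] *)

Section Evaluation.
Context (R : srqsring).
Implicit Types (x y z c d e : R) (a b : LamP R) (phi psi : BR R).
Local Hint Resolve valP_Ep valP_ge Ep_eps EpV : core.

Lemma BRP phi : BR_set (val phi). Proof. exact: set_valP. Qed.
Local Hint Resolve BRP : core.

(** The extension of [phi] from the positive cone to the whole group. *)
Definition ev phi c : R := val phi (toP (join_eps c)) + c.

(** Any upper bound in the positive cone may replace [join_eps c]; several evaluations can thus be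
    read at one common argument. *)
Lemma evE phi c a : Ep R c -> c <= val a -> ev phi c = val phi a + c.
Proof.
move=> pc ca; rewrite /ev; have [h1 h2] := join_epsP pc.
have aux a1 a2 : c <= val a1 -> val a1 <= val a2 ->
  val phi a1 + c = val phi a2 + c.
  move=> h h'; rewrite (BR_restr (BRP phi) h') -qaddA; congr (_ + _).
  by move: h; rewrite qleE.
have [b [b1 b2]] := LamP_ub a (toP (join_eps c)).
by rewrite (aux _ b) // ?toPK // -(aux a b).
Qed.

Lemma ev_ep phi c : Ep R c -> ep (ev phi c) = c.
Proof.
move=> pc; have [a ca] := LamP_above pc;
  rewrite (evE _ pc ca) epD (BR_ep _ (BRP phi)).
by rewrite (ep_id pc); move: ca; rewrite qleE.
Qed.

Lemma ev_val phi a : ev phi (val a) = val phi a.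
Proof.
rewrite (@evE _ _ a) //; last exact: qle_refl.
by rewrite -(BR_ep a (BRP phi)) qadd_ep.
Qed.

Lemma ev_le phi c d : Ep R c -> Ep R d -> c <= d -> ev phi c = ev phi d + c.
Proof.
move=> pc pd cd; have [a da] := LamP_above pd.
rewrite (evE _ pd da) (evE _ pc (qle_trans cd da)) -qaddA; congr (_ + _).
by move: cd; rewrite qleE.
Qed.

Lemma LamP_above2 c d : Ep R c -> Ep R d ->
  exists a : LamP R, c <= val a /\ d <= val a.
Proof.
move=> /LamP_above[a ca] /LamP_above[b db]; have [e [ae be]] := LamP_ub a b.
by exists e; split; [apply: qle_trans ae|apply: qle_trans be].
Qed.

Lemma evD phi psi c d : Ep R c -> Ep R d ->
  ev phi c + ev psi d = ev (phi + psi)%R (c + d).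
Proof.
move=> pc pd; have [a [ca da]] := LamP_above2 pc pd.
rewrite (evE _ pc ca) (evE _ pd da) (@evE _ _ a); first by rewrite qaddACA.
  exact: EpD.
by apply: qle_trans ca; apply: qleDl.
Qed.

Lemma evN phi c : Ep R c -> ev (- phi)%R c = - ev phi c.
Proof.
move=> pc; have [a ca] := LamP_above pc; rewrite !(evE _ pc ca).
by rewrite qoppD (qopp_id pc).
Qed.

Lemma ev0 c : Ep R c -> ev 0%R c = c.
Proof.
move=> pc; have [a ca] := LamP_above pc; rewrite !(evE _ pc ca).
by rewrite qaddC /= /br_zero; apply/esym; move: ca; rewrite qleE // qaddC.
Qed.

(** For [m] large enough, the factors on the left lie below the values of [phi] and [psi] at [m], so
    their product lies below the product of these values. The index on the right is the [ep] of the
    left side, by [ep_mul], and restricting to it yields equality. *)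
Lemma ev_mul phi psi c d : Ep R c -> Ep R d ->
  ev phi c * ev psi d = ev (phi * psi)%R (qv (ev psi d) * c + qv (ev phi c) * d).
Proof.
move=> pc pd; set e := _ + _.
have pe : Ep R e by apply: EpD; apply: EpM.
have epE : ep (ev phi c * ev psi d) = e by rewrite ep_mul !ev_ep.
have [a ea] := LamP_above pe; rewrite (evE _ pe ea).
have [n h] := br_mulP a (BRP phi) (BRP psi).
have [b [cb db]] := LamP_above2 pc pd; have [m [nm bm]] := LamP_ub n b.
have /= [-> _ _] := h m nm; rewrite -qaddA.
have -> : val a + e = e by apply/esym; move: ea; rewrite qleE.
rewrite -epE; apply: qleMM.
  by rewrite (@evE _ _ m) //; [apply: qleDl|apply: qle_trans bm].
by rewrite (@evE _ _ m) //; [apply: qleDl|apply: qle_trans bm].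
Qed.

Lemma AR_ev phi : AR R phi <-> ev phi eps = eps.
Proof.
have -> : ev phi eps = val phi (epsP R) by exact: (ev_val phi (epsP R)).
exact: AR_E.
Qed.

Lemma qv_ep_eq x : qv x = ep x -> x = qv x.
Proof.
move=> h; have : em x = eps.
  apply: Em_eps_ep; first exact: Em_em.
  by rewrite -ep_em_le h EpV_eps //; apply: Ep_ep.
by move=> E; rewrite -{1}(qmul_em x) E qmulC.
Qed.

(** This is why [ev phi c = c] may be read as [w phi >= c]. *)
Lemma ev_idP phi c : Ep R c -> ev phi c = c <-> c <= qv (ev phi c).
Proof.
move=> pc; split=> [->|h]; first by rewrite v_id //; apply: qle_refl.
have E : qv (ev phi c) = c.
  by apply: qle_anti => //; rewrite -{2}(ev_ep phi pc); apply: v_le_ep.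
by rewrite -[RHS]E; apply: qv_ep_eq; rewrite E ev_ep.
Qed.

Lemma qv_ev_le phi c : Ep R c -> qv (ev phi c) <= c.
Proof. by move=> pc; rewrite -{2}(ev_ep phi pc); apply: v_le_ep. Qed.

Lemma qv_evE phi c a : Ep R c -> c <= val a ->
  qv (ev phi c) = qv (val phi a) + c.
Proof. by move=> pc ca; rewrite (evE _ pc ca) qv_restr. Qed.

Lemma ev_id_iff phi c a : Ep R c -> c <= val a ->
  ev phi c = c <-> c <= qv (val phi a).
Proof.
move=> pc ca; rewrite ev_idP // (qv_evE _ pc ca); split=> [h|h].
  by apply: qle_addl h => //; apply: Ep_v.
by apply: qle_glb => //; apply: qle_refl.
Qed.

Lemma ev_id_all phi c a : Ep R c -> ev phi c = c -> c + val a <= qv (val phi a).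
Proof.
move=> pc h; have [b [cb ab]] := LamP_above2 pc (valP_Ep a).
have pca : Ep R (c + val a) by apply: EpD.
rewrite (BR_restr (BRP phi) ab) qv_restr //.
apply: qle_glb => //; last by apply: qleDr.
apply: (@qle_trans _ c); first exact: qleDl.
exact: (proj1 (ev_id_iff phi pc cb)).
Qed.

Lemma ev_id_mono phi c d : Ep R c -> Ep R d -> c <= d -> ev phi d = d ->
  ev phi c = c.
Proof.
by move=> pc pd cd h; rewrite (ev_le _ pc pd cd) h; apply/esym; move: cd;
  rewrite qleE.
Qed.

Lemma ev_idM phi psi c d : Ep R c -> Ep R d -> ev phi c = c -> ev psi d = d ->
  ev (phi * psi)%R (c * d) = c * d.
Proof.
move=> pc pd hc hd; have := ev_mul phi psi pc pd.
by rewrite hc hd !v_id // (qmulC d) (EpM c pd) => <-.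
Qed.

Lemma BRmul_val phi psi a : val (phi * psi)%R a = br_mul (val phi) (val psi) a.
Proof. by []. Qed.

(** The fractional ideal [{phi | w phi >= c}]; outside of [Ep R], where it is junk,
    it is the whole of [B_R]. *)
Definition Jm c : smod (BR_ext R).
Proof.
exists (fun phi : BR R => Ep R c -> ev phi c = c).
- by move=> pc; apply: ev0.
- move=> phi psi h k pc; rewrite -{1}pc -evD //.
  by rewrite (h pc) (k pc).
move=> phi psi /AR_ev h k pc.
by have := ev_idM (Ep_eps R) pc h (k pc); rewrite eps_mul.
Defined.

Lemma JmE phi c : Ep R c -> Jm c phi <-> ev phi c = c.
Proof. by move=> pc; split=> [|? ?] //; apply. Qed.

Lemma Jm_eps : Jm eps = 1%R.
Proof.
by apply: sle_anti => phi;
  [move=> /JmE h; apply/AR_ev/h|move=> /AR_ev h; apply/JmE].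
Qed.

Lemma Jm_mono c d : Ep R c -> Ep R d -> c <= d -> Jm d <=s Jm c.
Proof.
by move=> pc pd cd phi /(JmE _ pd) h; apply/JmE/(ev_id_mono _ pd cd h).
Qed.

Lemma JmM c d : Ep R c -> Ep R d -> (Jm c * Jm d)%R <=s Jm (c * d).
Proof.
move=> pc pd; apply: smul_sub => phi psi /(JmE _ pc) h /(JmE _ pd) k.
by apply/JmE; [exact: EpM|exact: ev_idM].
Qed.

Lemma Jm_one_le e : Ep R e -> 1%R <=s Jm e -> e <= eps.
Proof.
move=> pe /sone_le /(JmE _ pe) h; have [a ea] := LamP_above pe.
have := proj1 (ev_id_iff _ pe ea) h.
by rewrite /= v_Em //; apply: br_one_Em.
Qed.

(** The index [(c^-1 + d^-1)^-1] is the join of [c] and [d]. *)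
Lemma Jm_join phi c d : Ep R c -> Ep R d -> Jm c phi -> Jm d phi ->
  Jm (c^-1 + d^-1)^-1 phi.
Proof.
move=> pc pd /(JmE _ pc) h /(JmE _ pd) k.
have pcd : Ep R (c^-1 + d^-1)^-1 by apply/EpV/EpD; apply: EpV.
have ubound e : Ep R e -> c <= e -> d <= e -> (c^-1 + d^-1)^-1 <= e.
  move=> pe ce de; rewrite -[e]EpVK; apply: EpV_anti;
    [exact: EpV|by apply: EpD; apply: EpV|].
  by apply: qle_glb; [exact: EpV|exact: EpV_anti|exact: EpV_anti].
have [a [ca da]] := LamP_above2 pc pd.
apply/JmE => //; apply/(ev_id_iff phi pcd (ubound _ (valP_Ep a) ca da)).
apply: ubound; [exact: Ep_v|exact/(ev_id_iff phi pc ca)|].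
exact/(ev_id_iff phi pd da).
Qed.

(** [c] is the meet of [eps] and of the values [v] of the [s i] at [eps]. Evaluate [psi] at [v^-1],
    with value [w], and [s i] at [eps]: by [ev_mul] the product is [psi * s i] evaluated at
    [eps + w], which is [eps] because [psi] is in [A_R]. As [psi * s i] is in [A_R] too,
    [w * v = eps], so that [psi] lies in [Jm v^-1]. The join of these bounds is [c^-1]. *)
Lemma finite_meet n (s : 'I_n -> BR R) : exists c,
  [/\ Ep R c, c <= eps, forall i, Jm c (s i) &
    forall psi, AR R psi -> (forall i, AR R (psi * s i)%R) -> Jm c^-1 psi].
Proof.
elim: n s => [|n IH] s.
  exists eps; split=> //; [exact: qle_refl|by case|].
  by move=> psi Apsi _; rewrite epsV Jm_eps.
have [c [pc c1 hc kc]] := IH (fun i => s (lift ord0 i)).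
set v := qv (ev (s ord0) eps); have pv : Ep R v by apply: Ep_v.
have ve : v <= eps by apply: qv_ev_le.
exists (c + v); split.
- exact: EpD.
- by apply: qle_trans c1; apply: qleDl.
- move=> i; case: (unliftP ord0 i) => [j ->|->].
    by apply: (Jm_mono _ pc) => //; [exact: EpD|exact: qleDl].
  apply: (Jm_mono _ pv); [exact: EpD|exact: qleDr|].
  apply/JmE => //; apply/ev_idP => //.
  by rewrite (ev_le _ pv _ ve) // qv_restr // -/v pv; apply: qle_refl.
move=> psi Apsi As.
rewrite -[c]EpVK -[v in _ + v]EpVK; apply: Jm_join; [exact: EpV|exact: EpV| |].
  by apply: kc => // i; apply: As.
apply/JmE; first exact: EpV.
have pV := EpV pv; set w := qv (ev psi v^-1).
have pw : Ep R w by apply: Ep_v.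
have ew : eps <= w.
  have h : eps <= v^-1 by apply: EpV_ge.
  rewrite /w; have := v_mono (qleDl (ev psi v^-1) (Ep_eps R)).
  rewrite -(ev_le psi (Ep_eps R) pV h); have /AR_ev -> := Apsi.
  by rewrite v_id.
have := ev_mul psi (s ord0) pV (Ep_eps R).
rewrite -/v -/w mul_eps // EpV_eps //.
have -> : eps + w = eps by apply/esym; move: ew; rewrite qleE // qaddC.
have /AR_ev -> := As ord0.
move=> /(congr1 (@qv R)); rewrite vM -/w -/v v_id // => wv.
have wE : w = v^-1 by rewrite -(mul_eps pV) -wv qmulC -qmulA EpV_eps // mul_eps.
by apply/ev_idP => //; rewrite -/w wE; apply: qle_refl.
Qed.
End Evaluation.

(** * Values of invertible modules, and their comparison with hat w *)

Section HatW.
Context (R : srqsring) (pR : is_prufer (BR_ext R)).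
Implicit Types (x y z c d e : R) (a b : LamP R) (phi psi : BR R).
Implicit Types (I J K : smod (BR_ext R)).
Local Hint Resolve valP_Ep valP_ge Ep_eps EpV : core.

(** [Jm c] equals [I * (J * Jm c)], and [J * Jm c] is contained in [Jm c^-1 * Jm c], hence in
    [Jm eps = 1]. So [Jm c] is contained in [I]; the case of [J] is symmetric. *)
Lemma Jm_pinch I J c : Ep R c -> (I * J = 1)%R -> I <=s Jm c -> J <=s Jm c^-1 ->
  I = Jm c /\ J = Jm c^-1.
Proof.
have aux d (I1 I2 : smod (BR_ext R)) : Ep R d -> (I1 * I2 = 1)%R ->
  I1 <=s Jm d -> I2 <=s Jm d^-1 -> I1 = Jm d.
  move=> pd E1 h1 h2; apply: sle_anti => //.
  rewrite -[X in X <=s _]mulr1 -E1 mulrC -mulrA -[X in _ <=s X]mulr1.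
  apply: sle_mull; rewrite -Jm_eps -(EpVl pd).
  by apply: sle_trans (JmM _ pd); [apply: sle_mul|apply: EpV].
move=> pc IJ Ic Jc; split; first exact: aux IJ Ic Jc.
by apply: (aux _ _ I) => //; [exact: EpV|rewrite mulrC|rewrite EpVK].
Qed.

(** As [I] contains [1], its inverse is contained in [A_R], so [finite_meet], applied to generators
    of [I], bounds the elements of the inverse. *)
Lemma hw_big I : munit I -> 1%R <=s I ->
  exists c, [/\ Ep R c, I = Jm c & sm_inv I = Jm c^-1].
Proof.
move=> uI I1; have [n [s [t [Is It E1 IE]]]] := mul_eq1_gen (smulV uI).
have [c [pc c1 hc kc]] := finite_meet s; exists c.
have V1 : sm_inv I <=s 1%R.
  by rewrite -[X in X <=s _]mul1r -[X in _ <=s X](smulV uI); apply: sle_mul.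
have hI : I <=s Jm c by rewrite IE; apply/sm_sum_le.
have hV : sm_inv I <=s Jm c^-1.
  move=> psi Vpsi; apply: kc => [|i]; first exact: V1.
  by rewrite -[AR R _]/((1 : smod (BR_ext R))%R _) -(smulVl uI); apply: in_smul.
by have [h1 h2] := Jm_pinch pc (smulV uI) hI hV.
Qed.

(** As [R] is Prüfer, [I] is the quotient of [1 + I] by [1 + I^-1], both of which
    contain [1]. *)
Lemma hw_ex I : munit I -> exists c, [/\ Ep R c, I = Jm c & sm_inv I = Jm c^-1].
Proof.
move=> uI; have uV := munitV uI; have u1 := munit1 (BR_ext R).
have uA := munitD pR u1 uI; have uB := munitD pR u1 uV.
have [c [pc cE cV]] := hw_big uA (@sle_addl _ _ _).
have [d [pd dE dV]] := hw_big uB (@sle_addl _ _ _).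
have AB : (1 + I = I * (1 + sm_inv I))%R by rewrite mulrDr mulr1 smulV // addrC.
exists (c * d^-1); have pdV := EpV pd; have pcd : Ep R (c * d^-1) by apply: EpM.
have hI : I <=s Jm (c * d^-1).
  apply: sle_trans (JmM pc pdV); rewrite -cE -dV AB -mulrA smulV // mulr1.
  exact: sle_refl.
have hV : sm_inv I <=s Jm (c * d^-1)^-1.
  rewrite EpMV EpVK qmulC; apply: sle_trans (JmM pd (EpV pc)).
  rewrite -dE -cV; have <- : sm_inv I = ((1 + sm_inv I) * sm_inv (1 + I))%R.
    rewrite -[LHS]mulr1 -[X in (_ * X)%R = _](smulV uA) AB.
    have -> : (sm_inv I * (I * (1 + sm_inv I) * sm_inv (I * (1 + sm_inv I))) =
      sm_inv I * I * ((1 + sm_inv I) * sm_inv (I * (1 + sm_inv I))))%R by ring.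
    by rewrite smulVl // mul1r.
  exact: sle_refl.
by have [h1 h2] := Jm_pinch pcd (smulV uI) hI hV.
Qed.

Definition hw I : R :=
  if pselect (munit I) is left h then sval (cid (hw_ex h)) else eps.

Lemma hwP I : munit I ->
  [/\ Ep R (hw I), I = Jm (hw I) & sm_inv I = Jm (hw I)^-1].
Proof. by move=> uI; rewrite /hw; case: pselect => // h; case: cid. Qed.

Lemma hw_Ep I : munit I -> Ep R (hw I). Proof. by case/hwP. Qed.
Lemma hw_Jm I : munit I -> I = Jm (hw I). Proof. by case/hwP. Qed.
Lemma hw_in I phi : munit I -> I phi <-> ev phi (hw I) = hw I.
Proof. by move=> uI; rewrite {1}(hw_Jm uI); apply/JmE/hw_Ep. Qed.

Lemma hw_ge I d : munit I -> Ep R d -> I <=s Jm d -> d <= hw I.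
Proof.
move=> uI pd Id; have [pc IE VE] := hwP uI; have pV := EpV pc.
rewrite -[hw I]mul_eps // -[hw I in X in _ <= X]EpVK; apply/Ep_le_mul => //.
apply: Jm_one_le; first exact: EpM.
by apply: sle_trans (JmM pV pd); rewrite -VE -(smulVl uI); apply: sle_mul.
Qed.

(** The inclusion of [I] bounds [hw I] from below by [c]; that of [J] bounds [hw J], which is
    [(hw I)^-1], from below by [c^-1]. *)
Lemma hw_uniq I J c : (I * J = 1)%R -> Ep R c -> I <=s Jm c -> J <=s Jm c^-1 ->
  hw I = c.
Proof.
move=> IJ pc Ic Jc; have uI : munit I by exists J.
have uJ : munit J by exists I; rewrite mulrC.
have [pI IE VE] := hwP uI.
apply: qle_anti; last exact: hw_ge.
rewrite -[hw I]EpVK -[c]EpVK; apply: EpV_anti; [exact: EpV|exact: EpV|].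
have <- : hw J = (hw I)^-1.
  apply: qle_anti; last first.
    by apply: hw_ge => //; [exact: EpV|rewrite -VE (sm_invU IJ)].
  rewrite -[hw J]eps_mul; last exact: hw_Ep.
  rewrite -(EpVl pI) -qmulA -[X in _ <= X]mul_eps; last exact: EpV.
  apply: qleM; rewrite -[hw I * _]mul_eps; last by apply/EpM/hw_Ep.
  rewrite mul_eps; last by apply/EpM/hw_Ep.
  apply: Jm_one_le; first by apply/EpM/hw_Ep.
  apply: sle_trans (JmM pI (hw_Ep uJ)).
  by rewrite -IE -(hw_Jm uJ) IJ.
by apply: hw_ge => //; apply: EpV.
Qed.

Lemma hw_anti I J : munit I -> munit J -> I <=s J -> hw J <= hw I.
Proof.
by move=> uI uJ IJ; apply: hw_ge => //; [exact: hw_Ep|rewrite -hw_Jm].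
Qed.

Lemma hw_le I J : munit I -> munit J -> hw J <= hw I -> I <=s J.
Proof.
move=> uI uJ h; rewrite (hw_Jm uI) (hw_Jm uJ).
by apply: Jm_mono => //; apply: hw_Ep.
Qed.

Lemma hw_inj I J : munit I -> munit J -> hw I = hw J -> I = J.
Proof. by move=> uI uJ h; rewrite (hw_Jm uI) (hw_Jm uJ) h. Qed.

Lemma hwM I J : munit I -> munit J -> hw (I * J)%R = hw I * hw J.
Proof.
move=> uI uJ; have [pI IE VI] := hwP uI; have [pJ JE VJ] := hwP uJ.
apply: (@hw_uniq _ (sm_inv I * sm_inv J)%R).
- by rewrite mulrACA !smulV // mulr1.
- exact: EpM.
- by apply: sle_trans (JmM pI pJ); rewrite -IE -JE.
by rewrite EpMV; apply: sle_trans (JmM (EpV pI) (EpV pJ)); rewrite -VI -VJ.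
Qed.

Lemma hw1 : hw 1%R = eps.
Proof.
by apply: (@hw_uniq _ 1%R); rewrite ?mulr1 ?epsV ?Jm_eps //; apply: Ep_eps.
Qed.

Lemma hwV I : munit I -> hw (sm_inv I) = (hw I)^-1.
Proof.
move=> uI; have [pI IE VI] := hwP uI; apply: (@hw_uniq _ I).
- exact: smulVl.
- exact: EpV.
- by rewrite VI.
by rewrite EpVK -IE.
Qed.

Lemma hwD I J : munit I -> munit J -> hw (I + J)%R = hw I + hw J.
Proof.
move=> uI uJ; have pI := hw_Ep uI; have pJ := hw_Ep uJ;
  have uD := munitD pR uI uJ.
apply: qle_anti; first apply: qle_glb; first exact: hw_Ep.
- by apply: hw_anti => //; apply: sle_addl.
- by apply: hw_anti => //; apply: sle_addr.
apply: hw_ge => //; first exact: EpD.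
apply: sle_lub; [rewrite {1}(hw_Jm uI)|rewrite {1}(hw_Jm uJ)].
  by apply: Jm_mono => //; [exact: EpD|exact: qleDl].
by apply: Jm_mono => //; [exact: EpD|exact: qleDr].
Qed.

Lemma hw_pr I phi : munit I ->
  hw (I + @sm_pr (BR_ext R) phi)%R = qv (ev phi (hw I)).
Proof.
move=> uI; have pI := hw_Ep uI; have uK := munit_pr pR phi uI.
have pK := hw_Ep uK; have KI : hw (I + @sm_pr (BR_ext R) phi)%R <= hw I.
  by apply: hw_anti => //; apply: sle_addl.
have pv : Ep R (qv (ev phi (hw I))) by apply: Ep_v.
apply: qle_anti.
  have : (I + @sm_pr (BR_ext R) phi)%R phi by apply: sle_addr; apply: sm_pr_id.
  move=> /(hw_in _ uK)/(ev_idP phi pK) h; apply: qle_trans h _.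
  by rewrite (ev_le phi pK pI KI) qv_restr //; apply: qleDl.
apply: hw_ge => //; apply: sle_lub.
  by rewrite {1}(hw_Jm uI); apply: Jm_mono => //; apply: qv_ev_le.
apply/sm_pr_le/JmE => //; apply/ev_idP => //.
by rewrite (ev_le phi pv pI (qv_ev_le _ pI)) qv_restr // pv; apply: qle_refl.
Qed.

(** Let [m] be the meet at [a] of the values of the generators. All generators lie in [Jm m], so
    [m <= hw I] by [hw_ge]; the converse inequality is [ev_id_all] for each generator. *)
Lemma hat_wM_hw I : munit I -> hat_wM R (hat_in (hw I)).
Proof.
move=> uI; have [n [s IE]] := munit_fg uI; have pI := hw_Ep uI.
exists (sm_set I); first exact: munit_Mon.
exists n, s; split; first by rewrite IE; apply: (@lspan_smod (BR_ext R)).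
apply/funext => a; rewrite /hat_in.
have pF i : Ep R (qw (s i) a) by apply: Ep_v.
have [pm ma mF] := big_meetP (valP_Ep a) pF.
set m := bigop _ _ _ in pm ma mF *.
have Is i : I (s i) by rewrite IE; move: i; apply/sm_sum_le.
apply: qle_anti.
  apply: big_meet_lb; [exact: EpD|exact: qleDr|].
  by move=> i; apply: ev_id_all => //; apply/(hw_in _ uI).
apply: qle_glb => //; apply: hw_ge => //; rewrite IE; apply/sm_sum_le => i.
by apply/JmE => //; apply/(ev_id_iff (s i) pm ma); apply: mF.
Qed.

Lemma hat_in_mulV c : Ep R c -> hat_mul (hat_in c) (hat_in c^-1) = hat_in eps.
Proof.
move=> pc; apply/funext => a; rewrite /hat_mul /hat_in.
have pV := EpV pc; have pe := @Ep_eps R.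
(* [(d^-1 + eps)^-1] is the join of [d] and [eps]; the shifted argument is above it, and the
   truncation of [d] there has no effect. *)
have aux d : Ep R d -> d + val (toP (val a * (d^-1 + val (epsP R))^-1)) = d.
  move=> pd; have pd' := EpV pd; have pD := EpD pd' pe.
  have ge1 : eps <= (d^-1 + eps)^-1 by apply: EpV_ge => //; apply: qleDr.
  rewrite toPK; last by apply: LamPM; [exact: set_valP|split=> //; exact: EpV].
  apply/esym; rewrite qaddC -qleE //; apply: (@qle_trans _ (d^-1 + eps)^-1).
    by rewrite -{1}[d]EpVK; apply: EpV_anti => //; apply: qleDl.
  by rewrite qmulC; apply: EpM_ge => //; apply: EpV.
have := aux _ pV; rewrite EpVK => ->.
by rewrite aux // EpV_eps.
Qed.

Lemma hat_wMstar_hw I : munit I -> hat_wMstar R (hat_in (hw I)).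
Proof.
move=> uI; split; first exact: hat_wM_hw.
exists (hat_in (hw I)^-1); last exact/hat_in_mulV/hw_Ep.
by rewrite -hwV //; apply/hat_wM_hw/munitV.
Qed.

(** A module of value [f] need not be invertible. Adding [1] to it makes it so, at the price of
    cutting its value down to the meet of [f] and [eps]. *)
Lemma hat_wM_lower f : hat_wM R f -> exists I,
  [/\ munit I, hw I <= eps, hat_le (hat_in (hw I)) f &
   forall c, Ep R c -> hat_le (hat_in c) f -> eps + c <= hw I].
Proof.
move=> [_ _ [n [s [_ ->]]]];
  set I := (1 + \sum_(i < n) @sm_pr (BR_ext R) (s i))%R.
have uI : munit I by apply: munit_span.
have pI := hw_Ep uI.
have pF a i : Ep R (qw (s i) a) by apply: Ep_v.
exists I; split=> //.
- by rewrite -hw1; apply: hw_anti => //; [exact: munit1|exact: sle_addl].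
- move=> a; rewrite /hat_in; apply: big_meet_lb; [exact: EpD|exact: qleDr|].
  move=> i; apply: ev_id_all => //; apply/(hw_in _ uI); apply: sle_addr.
  by move: i; apply/sm_sum_le; apply: sle_refl.
move=> c pc cf; have pec : Ep R (eps + c) by apply: EpD.
apply: hw_ge => //; apply: sle_lub; first by rewrite -Jm_eps;
  apply: Jm_mono => //; apply: qleDl.
apply/sm_sum_le => i; apply: (Jm_mono pec pc); first exact: qleDr.
have [a ca] := LamP_above pc; apply/JmE => //; apply/(ev_id_iff _ pc ca).
have [_ _ /(_ i)] := big_meetP (valP_Ep a) (pF a).
apply: qle_trans; apply: qle_trans (cf a); rewrite /hat_in.
by apply: qle_glb => //; exact: qle_refl.
Qed.

Lemma big_meet_restr n (F G : 'I_n -> R) c d : Ep R c -> c <= d ->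
  (forall i, F i = G i + c) ->
  \big[@qs_add R/c]_(i < n) F i = \big[@qs_add R/d]_(i < n) G i + c.
Proof.
move=> pc; rewrite qleE // => cd; elim: n F G => [|n IH] F G FG;
  first by rewrite !big_ord0.
by rewrite !big_ord_recl (IH _ (fun i => G (lift ord0 i))) // FG qaddACA pc.
Qed.

Lemma hat_wM_Lam f : hat_wM R f -> hatLam R f.
Proof.
move=> [_ _ [n [s [_ ->]]]]; split=> [a|a b ab].
  by have [] := big_meetP (valP_Ep a) (fun i => Ep_v (val (s i) a)).
apply: big_meet_restr => // i.
by rewrite /qw (BR_restr (BRP (s i)) ab) qv_restr.
Qed.

(** The factors of the product at [a] are [f b1 >= f a] and [g b2 >= v], where [v] is [g] at [eps].
    Now [v * f b1] is at most [f b1 * g b2] and at most [val a], since [val b1 = val a * v^-1]; so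
    it is at most the product at [a], which is [eps + val a]. *)
Lemma hat_inv_ub f g a : hatLam R f -> hatLam R g -> hat_mul f g = hat_in eps ->
  f a <= (g (epsP R))^-1.
Proof.
move=> Hf Hg /(congr1 (@^~ a)); rewrite /hat_mul /hat_in.
set v := g (epsP R); set u := f (epsP R); have pe := @Ep_eps R.
have pv : Ep R v by case: Hg => h _; apply: h.
have pu : Ep R u by case: Hf => h _; apply: h.
have le1 h b : hatLam R h -> h b <= val b.
  move=> [ph hh]; rewrite (hh b b (qle_refl _)); apply: qleDr => //.
have shP d : Ep R d -> d <= eps ->
  LamP R (val a * d^-1) /\ val a <= val a * d^-1.
  move=> pd d1; have e1 := EpV_ge pd d1; split; last exact: EpM_ge.
  by apply: LamPM; [exact: set_valP|apply: LamPV].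
have v1 : v <= eps by apply: (le1 g (epsP R)).
have u1 : u <= eps by apply: (le1 f (epsP R)).
have [P1 h1] := shP _ pv v1; have [P2 h2] := shP _ pu u1.
set b1 := toP (val a * v^-1); set b2 := toP (val a * u^-1) => E0.
have vb1 : val b1 = val a * v^-1 by rewrite toPK.
have vb2 : val b2 = val a * u^-1 by rewrite toPK.
have pf b : Ep R (f b) by case: Hf => h _; apply: h.
have pg b : Ep R (g b) by case: Hg => h _; apply: h.
have hg : v <= g b2.
  case: Hg => _ /(_ (epsP R) b2); rewrite /= -/v => -> //; last exact: valP_ge.
  by apply: qleDl.
have hf : f a <= f b1.
  case: Hf => _ /(_ a b1); rewrite vb1 => -> //.
  exact: qleDl.
apply: qle_trans hf _; rewrite -[v^-1]mul_eps; last exact: EpV.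
apply/Ep_le_mul => //.
apply: (@qle_trans _ (eps + val a)); last exact: qleDl.
rewrite -E0; apply: qle_glb; first exact: EpM.
  by rewrite qmulC; apply: qleM.
apply: (@qle_trans _ (v * (val a * v^-1))); first by apply: qleM; rewrite -vb1;
  apply: le1.
rewrite qmulCA EpV_eps // mul_eps //; exact: qle_refl.
Qed.

(** Beyond a point [b] above the bound, truncation at [b] changes nothing: [f c = f b] for all
    [c >= b], and [f] is the image of [f b]. *)
Lemma hatLam_bounded f q : hatLam R f -> Ep R q -> (forall a, f a <= q) ->
  hat_Lam_in R f.
Proof.
move=> [pf hf] pq fq; have [b qb] := LamP_above pq.
exists (f b) => //; apply/funext => a; rewrite /hat_in.
have [c [bc ac]] := LamP_ub b a.
have E0 : f b = f c.
  by rewrite (hf _ _ bc) qaddC; apply/esym; rewrite -qleE //;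
    apply: qle_trans qb.
by rewrite E0 (hf _ _ ac).
Qed.

Lemma hat_wMstar_ub f : hat_wMstar R f ->
  exists2 q, Ep R q & forall a, f a <= q.
Proof.
move=> [Mf [g Mg fg]]; exists (g (epsP R))^-1.
  by apply: EpV; case: (hat_wM_Lam Mg) => h _; apply: h.
by move=> a; apply: hat_inv_ub (hat_wM_Lam Mg) fg; apply: hat_wM_Lam.
Qed.

Lemma hat_in_Lam c : Ep R c -> hatLam R (hat_in c).
Proof.
move=> pc; split=> [a|a b]; rewrite /hat_in; first exact: EpD.
by rewrite qleE // -qaddA => <-.
Qed.

Lemma hat_in_le c d : Ep R c -> Ep R d -> hat_le (hat_in c) (hat_in d) ->
  c <= d.
Proof.
move=> pc pd h; have [a ca] := LamP_above pc.
apply: qle_trans (qleDl d (valP_Ep a)); apply: qle_trans (h a); rewrite /hat_in.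
by apply: qle_glb => //; apply: qle_refl.
Qed.

Lemma strong_pm_of_hw : (forall c, Ep R c -> exists2 I, munit I & hw I = c) ->
  strong_prufer_manis R.
Proof.
move=> h; apply/seteqP; split=> [f Mf|_ [c pc <-]].
  have [q pq fq] := hat_wMstar_ub Mf.
  by apply: hatLam_bounded pq fq; case: Mf => /hat_wM_Lam.
by have [I uI <-] := h c pc; apply: hat_wMstar_hw.
Qed.

Lemma pm_of_strong : strong_prufer_manis R -> prufer_manis R.
Proof.
move=> sR; rewrite /prufer_manis sR; apply/seteqP;
  split=> [f [Hf [_ [_ [_ [q pq <-] _ fq]]]]|_ [c pc <-]].
  by apply: (hatLam_bounded Hf pq) => a; apply: qle_trans (fq a) _;
    apply: qleDl.
split; first exact: hat_in_Lam.
exists (hat_in c), (hat_in c); split; try by exists c.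
  by move=> a; apply: qle_refl.
by move=> a; apply: qle_refl.
Qed.

(** The form in which the Prüfer-Manis property is used. The lower bound comes from a module of
    value [f]. The upper one comes from the inverse [g'] of [g]: the values of [g] are at most the
    inverse of [g'] at [eps], hence at most [(hw J)^-1]. *)
Lemma hw_cofinal : prufer_manis R -> forall c, Ep R c ->
  exists I J, [/\ munit I, munit J, hw I <= c & c <= hw J].
Proof.
move=> hR c pc; have : hat_Lam_in R (hat_in c) by exists c.
rewrite -hR => -[_ [f [g [[Mf _] [Mg [g' Mg' gg']] fc cg]]]].
have [I [uI _ hI _]] := hat_wM_lower Mf.
have [J [uJ J1 hJ _]] := hat_wM_lower Mg'.
exists I, (sm_inv J); split=> //; first exact: munitV.
  by apply: hat_in_le => //;
    [exact: hw_Ep|move=> a; apply: qle_trans (hI a) (fc a)].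
have Lg' := hat_wM_Lam Mg'; have pJ := hw_Ep uJ;
  have pg' : Ep R (g' (epsP R)) by case: Lg' => h _; apply: h.
rewrite hwV //; apply: (@qle_trans _ (g' (epsP R))^-1); last first.
  apply: EpV_anti => //; apply: qle_trans (hJ (epsP R)); rewrite /hat_in /=.
  by apply: qle_glb => //; apply: qle_refl.
have [a ca] := LamP_above pc.
apply: (@qle_trans _ (g a)); last by apply: hat_inv_ub => //; apply: hat_wM_Lam.
apply: qle_trans (cg a); rewrite /hat_in.
by apply: qle_glb => //; apply: qle_refl.
Qed.

(** [hat_wM_lower] realizes only the meets [eps + c]; a general [c] is the quotient of [eps + c] by
    [eps + c^-1]. *)
Lemma hw_surj : strong_prufer_manis R -> forall c, Ep R c ->
  exists2 I, munit I & hw I = c.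
Proof.
move=> sR; have h c : Ep R c -> exists2 I, munit I & hw I = eps + c.
  move=> pc; have : hat_Lam_in R (hat_in c) by exists c.
  rewrite -sR => -[/hat_wM_lower[I [uI I1 hI hc] _]].
  exists I => //; apply: qle_anti; last by apply: hc => // a; apply: qle_refl.
  by apply: qle_glb => //; [exact: hw_Ep|apply: hat_in_le => //; apply: hw_Ep].
move=> c pc; have [I uI hI] := h c pc; have [J uJ hJ] := h _ (EpV pc).
exists (I * sm_inv J)%R; first by apply: munitM => //; apply: munitV.
rewrite hwM ?hwV //; last exact: munitV.
have pe := @Ep_eps R; have pV := EpV pc; have pD := EpD pe pV.
have E0 : hw I = c * hw J by rewrite hI hJ EpDM // mul_eps // EpV_eps // qaddC.
by rewrite E0 -qmulA EpV_eps ?mul_eps // hJ.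
Qed.
End HatW.

(** * The completion as the ring extension of [R_{B/A}] *)

Local Open Scope ring_scope.

(** * Extension of modules along a ring morphism *)

Section Extension.
Context (E E' : ringext) (g : {rmorphism E -> E'})
  (gA : forall x, re_sub E x -> re_sub E' (g x)).
Implicit Types (x y : E) (I J : smod E) (K : smod E').

(** Its underlying set is convertible to [extm g I], the set used for morphisms of Prüfer
    extensions. *)
Definition sm_ext I : smod E' :=
  Smod (mulm0 _ _) (@mulmD _ _ _) (@mulmZ _ (1 : smod E') (g @` sm_set I)).

Lemma sm_ext_in I x : I x -> sm_ext I (g x).
Proof.
move=> Ix; rewrite -[g x]mul1r; apply: mulm_gen; last by exists x.
exact: sub1.
Qed.

Lemma sm_ext_le I K : sm_ext I <=s K <-> forall x, I x -> K (g x).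
Proof.
split=> [h x Ix|h]; first by apply/h/sm_ext_in.
apply: (mulm_ind (sm0 K) (@smD _ K)) => a _ Aa [x Ix <-].
by apply: smZ => //; apply: h.
Qed.

Lemma sm_ext1 : sm_ext 1 = 1.
Proof.
apply: sle_anti; first by apply/sm_ext_le.
by apply/sone_le; rewrite -(rmorph1 g); apply/sm_ext_in/sub1.
Qed.

Lemma sm_extM I J : sm_ext (I * J) = sm_ext I * sm_ext J.
Proof.
apply: sle_anti.
  apply/sm_ext_le.
  apply: (@mulm_ind _ I J [set x | (sm_ext I * sm_ext J)%R (g x)]) => /=.
  - by rewrite rmorph0; apply: (sm0 (sm_ext I * sm_ext J)).
  - by move=> x y hx hy; rewrite rmorphD; apply: (@smD _ (sm_ext I * sm_ext J)).
  by move=> x y Ix Jy; rewrite rmorphM; apply: mulm_gen; apply: sm_ext_in.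
have h x y : I x -> J y -> sm_ext (I * J) (g x * g y).
  by move=> Ix Jy; rewrite -rmorphM; apply/sm_ext_in/in_smul.
suff H : sm_set (sm_ext I) `<=` [set u | forall w, sm_ext J w ->
  sm_ext (I * J) (u * w)].
  by apply: smul_sub => u w /H; apply.
apply: (@mulm_ind E' (sm_one E') (g @` sm_set I)
  [set u | forall w, sm_ext J w -> sm_ext (I * J) (u * w)]) => /=.
- by move=> w _; rewrite mul0r; apply: (sm0 (sm_ext (I * J))).
- move=> u u1 hu hu1 w hw; rewrite mulrDl; apply: (@smD _ (sm_ext (I * J))).
    exact: hu.
  exact: hu1.
move=> a _ Aa [x Ix <-].
suff H : sm_set (sm_ext J) `<=` [set w | sm_ext (I * J) (a * g x * w)] by [].
apply: (@mulm_ind E' (sm_one E') (g @` sm_set J)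
  [set w | sm_ext (I * J) (a * g x * w)]) => /=.
- by rewrite mulr0; apply: (sm0 (sm_ext (I * J))).
- by move=> y z hy hz; rewrite mulrDr; apply: (@smD _ (sm_ext (I * J))).
move=> b _ Ab [y Jy <-]; rewrite mulrACA; apply: (@smZ _ (sm_ext (I * J)));
  last exact: h.
exact: subM.
Qed.

Lemma sm_extD I J : sm_ext (I + J) = sm_ext I + sm_ext J.
Proof.
apply: sle_anti.
  apply/sm_ext_le => _ [x Ix [y Jy <-]]; rewrite rmorphD.
  by apply: smD; [apply: sle_addl|apply: sle_addr]; apply: sm_ext_in.
by apply: sle_lub; apply/sm_ext_le => x h; apply: sm_ext_in;
  [apply: sle_addl|apply: sle_addr].
Qed.

Lemma sm_ext_pr x : sm_ext (sm_pr x) = sm_pr (g x).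
Proof.
apply: sle_anti; last exact/sm_pr_le/sm_ext_in/sm_pr_id.
apply/sm_ext_le => _ [a Aa <-]; rewrite rmorphM.
by apply: smZr; [exact: sm_pr_id|exact: gA].
Qed.

Lemma munit_ext I : munit I -> munit (sm_ext I).
Proof. by move=> [J IJ]; exists (sm_ext J); rewrite -sm_extM IJ sm_ext1. Qed.

End Extension.

Lemma hw_ext (E : ringext) (R : srqsring) (pR : is_prufer (BR_ext R))
    (g : {rmorphism E -> BR_ext R}) (I J : smod E) c :
  (forall x, re_sub E x -> re_sub (BR_ext R) (g x)) -> I * J = 1 -> Ep R c ->
  (forall x, I x -> ev (g x) c = c) ->
  (forall x, J x -> ev (g x) c^-1%qs = c^-1%qs) ->
  hw pR (sm_ext g I) = c.
Proof.
move=> gA IJ pc hI hJ; apply: (@hw_uniq _ pR _ (sm_ext g J)).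
- by rewrite -sm_extM IJ sm_ext1.
- by [].
- by apply/sm_ext_le => x Ix; apply/JmE => //; apply: hI.
by apply/sm_ext_le => x Jx; apply/JmE; [exact: EpV|apply: hJ].
Qed.

Definition mk_rmorphism (B B' : comPzRingType) (f : B -> B')
    (fB : zmod_morphism f) (fM : monoid_morphism f) : {rmorphism B -> B'} :=
  HB.pack f (GRing.isZmodMorphism.Build _ _ f fB)
    (GRing.isMonoidMorphism.Build _ _ f fM).

(** * The map from [B] to the ring extension of [R_{B/A}], and the Prüfer-Manis property *)

Section RBA.
Context (E : prufer_ext).
Implicit Types (x y z : E) (I J K V : smod E).
Let pE := pe_prufer E.

Definition rba_cq : crqsring := CrQsring (rba_ax E).

Lemma rba_dir : directed rba_cq.
Proof.
move=> X; have [x [I [uI ->]]] := clsP X; move=> /rba_Em[I1 Ix].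
apply/rba_le; split=> //; rewrite sub0r; apply: smN.
by rewrite -[x](subrK 1); apply: smD; [exact: I1|exact: sub1].
Qed.

Lemma rba_LamP X : LamP rba_cq X ->
  exists I (uI : munit I), X = cls 0 uI /\ I <=s 1.
Proof.
by move=> [/rba_Ep[I [uI ->]] /rba_le[I1 _]]; exists I, uI.
Qed.

Lemma rba_LamP0 I (uI : munit I) : I <=s 1 -> LamP rba_cq (cls 0 uI).
Proof.
move=> I1; split; first exact: rba_Ep0.
by apply/rba_le; split=> //; rewrite subr0; apply: sm0.
Qed.

Lemma rba_sur : superrigid rba_cq.
Proof.
move=> X /rba_LamP[I [uI [-> I1]]]; exists (cls 1 uI); first exact: rba_one_Em.
exact: rba_ep.
Qed.

Definition rba_sr : srqsring := SrQsring rba_dir rba_sur.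

Definition idl (X : RBA_set E) : {I : smod E | munit I} :=
  (sval (cid (cls_ex X))).2.

Lemma idl_cls x I (uI : munit I) : sval (idl (cls x uI)) = I.
Proof. by rewrite /idl; case: cid => -[y [J uJ]] /= /cls_inj[]. Qed.

Definition eta_fun x (a : LamP rba_sr) : rba_sr := cls x (svalP (idl (val a))).

Lemma LamP_cls (a : LamP rba_sr) :
  exists I (uI : munit I), val a = cls 0 uI /\ I <=s 1.
Proof. exact: rba_LamP (set_valP a). Qed.

Lemma LamP_of_cls I (uI : munit I) : I <=s 1 ->
  exists a : LamP rba_sr, val a = cls 0 uI.
Proof. by move=> I1; apply/(@LamP_val rba_sr)/rba_LamP0. Qed.

Lemma eta_funE x (a : LamP rba_sr) I (uI : munit I) : val a = cls 0 uI ->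
  eta_fun x a = cls x uI.
Proof.
move=> aE; apply: cls_eq; first by rewrite aE idl_cls.
by apply: sm_eq0; rewrite subrr.
Qed.

Lemma rba_restr x I J (uI : munit I) (uJ : munit J) : J <=s I ->
  @qs_add (rba_alg E) (cls x uJ) (cls 0 uI) = cls x uI.
Proof.
move=> JI; rewrite rba_qadd; apply: cls_eq; first exact: sadd_idPr.
by rewrite addr0 subrr; apply: sm0.
Qed.

Lemma eta_BR x : BR_set (eta_fun x).
Proof.
apply: BR_setP => [a|a b].
  by have [I [uI [aE _]]] := LamP_cls a; rewrite (eta_funE _ aE) aE;
    apply: rba_ep.
have [I [uI [aE _]]] := LamP_cls a; have [J [uJ [bE _]]] := LamP_cls b.
rewrite (eta_funE _ aE) (eta_funE _ bE) aE bE => /rba_le[JI _].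
by rewrite rba_restr.
Qed.

Definition eta_map x : BR rba_sr := mkBR (eta_BR x).

Lemma eta_val x a : val (eta_map x) a = eta_fun x a. Proof. by []. Qed.

Lemma eta_zmod : zmod_morphism eta_map.
Proof.
move=> x y; apply/BR_inj/funext => a; have [I [uI [aE _]]] := LamP_cls a.
rewrite /= /br_add /br_opp /= !(eta_funE _ aE) rba_oppE rba_addE.
by apply: cls_eq; rewrite ?addss // subrr; apply: sm0.
Qed.

Lemma eta_monoid : monoid_morphism eta_map.
Proof.
split.
  apply/BR_inj/funext => a; have [I [uI [aE I1]]] := LamP_cls a.
  rewrite /= (eta_funE _ aE); apply: (@Em_inj rba_sr).
  - exact: rba_one_Em.
  - exact: br_one_Em.
  by rewrite br_one_ep aE; apply: rba_ep.
move=> x y; apply/BR_inj/funext => a; have [I [uI [aE I1]]] := LamP_cls a.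
have [n h] := br_mulP a (eta_BR x) (eta_BR y);
  have [E0 le _] := h n (qle_refl _).
rewrite BRmul_val E0 eta_val.
have [J [uJ [nE _]]] := LamP_cls n.
move: le; rewrite !(eta_funE _ nE) rba_qmul rba_ep aE => /rba_le[JI _].
rewrite rba_restr // (eta_funE _ aE); apply: cls_eq => //.
by rewrite subrr; apply: sm0.
Qed.

Definition eta_rm : {rmorphism E -> BR_ext rba_sr} :=
  mk_rmorphism eta_zmod eta_monoid.

Lemma ev_eta x I (uI : munit I) : ev (eta_map x) (cls 0 uI) = cls x uI.
Proof.
have pI : Ep rba_sr (cls 0 uI) by apply: rba_Ep0.
have [a Ia] := LamP_above pI; rewrite (evE _ pI Ia).
have [J [uJ [aE _]]] := LamP_cls a; move: Ia; rewrite aE => /rba_le[JI _].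
by rewrite eta_val (eta_funE _ aE) rba_restr.
Qed.

Lemma ev_eta_id x I (uI : munit I) : I x ->
  ev (eta_map x) (cls 0 uI) = cls 0 uI.
Proof. by move=> Ix; rewrite ev_eta; apply: cls_eq; rewrite ?subr0. Qed.

Lemma ev_eta_inj x I (uI : munit I) : ev (eta_map x) (cls 0 uI) = cls 0 uI ->
  I x.
Proof. by rewrite ev_eta => /cls_inj[_]; rewrite subr0. Qed.

Lemma eta_A x : re_sub E x <-> re_sub (BR_ext rba_sr) (eta_rm x).
Proof.
split=> [Ax|/AR_ev]; first by apply/AR_ev; apply: ev_eta_id.
exact: ev_eta_inj.
Qed.

Lemma ev_cls (phi : BR rba_sr) I (uI : munit I) :
  exists x, ev phi (cls 0 uI) = cls x uI.
Proof.
have pI : Ep rba_sr (cls 0 uI) by apply: rba_Ep0.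
have := ev_ep phi pI; have [x [J [uJ ->]]] := clsP (ev phi (cls 0 uI)).
rewrite rba_ep => /cls_inj[JI _]; exists x.
by apply: cls_eq => //; rewrite subrr; apply: sm0.
Qed.

Lemma eta_dense (phi : BR rba_sr) I (uI : munit I) :
  exists x, ev (phi - eta_rm x)%R (cls 0 uI) = cls 0 uI.
Proof.
have pI : Ep rba_sr (cls 0 uI) by apply: rba_Ep0.
have [x xE] := ev_cls phi uI; exists x.
have := evD phi (- eta_rm x) pI pI; rewrite evN // xE ev_eta pI => <-.
exact: rba_ep.
Qed.

Lemma rba_prufer : is_prufer (BR_ext rba_sr).
Proof.
apply: (prufer_extend (g := eta_rm)) => // [x /eta_A //|phi].
by have [x xE] := eta_dense phi (munit1 E); exists x; apply/AR_ev.
Qed.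

Lemma cls0V I (uI : munit I) (uV : munit (sm_inv I)) :
  (cls 0 uI : rba_sr)^-1%qs = cls 0 uV.
Proof.
have E0 : sm_inv I = I * (sm_inv I * sm_inv I) by rewrite mulrA smulV // mul1r.
have u' : munit (I * (sm_inv I * sm_inv I)) by rewrite -E0.
have v0 : vI 0 I = I by rewrite /vI sm_pr0 addr0.
rewrite [qs_inv _](@rba_invE _ 0 I uI (sm_inv I) 0 _ _ _ u') ?v0 ?smulV //.
- by apply: cls_eq => //; rewrite subrr; apply: sm0.
- exact: sm0.
by rewrite smulVl // mul0r sub0r; apply/smN/sub1.
Qed.

Lemma hw_eta I (uI : munit I) : hw rba_prufer (sm_ext eta_rm I) = cls 0 uI.
Proof.
apply: (@hw_ext _ _ _ _ I (sm_inv I)).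
- by move=> x /eta_A.
- exact: smulV.
- exact: rba_Ep0.
- by move=> x Ix; apply: ev_eta_id.
by move=> x Vx; rewrite (cls0V _ (munitV uI)); apply: ev_eta_id.
Qed.

Lemma rba_hw_surj c : Ep rba_sr c -> exists2 I, munit I & hw rba_prufer I = c.
Proof.
move=> /rba_Ep[I [uI ->]]; exists (sm_ext eta_rm I); last exact: hw_eta.
by apply: munit_ext => // x /eta_A.
Qed.

Lemma rba_strong : strong_prufer_manis rba_sr.
Proof. exact: (strong_pm_of_hw (pR := rba_prufer)) rba_hw_surj. Qed.

Lemma rba_manis : prufer_manis rba_sr.
Proof. exact/pm_of_strong/rba_strong. Qed.

Definition rba : RBA E.
Proof.
exists (@rba_add E) (@rba_mul E) (@rba_opp E) (@rba_inv E) (cls 0 (munit1 E))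
  (rba_ax E) rba_dir rba_sur.
- move=> X Y x y a b /rba_clsP[I [uI [-> ->]]] /rba_clsP[J [uJ [-> ->]]].
  by rewrite rba_addE.
- by move=> X x a /rba_clsP[I [uI [-> ->]]]; rewrite rba_oppE.
- move=> X Y x y a b /rba_clsP[I [uI [-> ->]]] /rba_clsP[J [uJ [-> ->]]].
  by rewrite rba_mulE -!sm_pr_mul.
- move=> X x a /rba_clsP[I [uI [-> ->]]].
  have [V [z [uz [vV Vz xz ->]]]] := clsVP x uI.
  exists (sm_set V), z; split=> //.
    by apply/MstarP_munit; exists (vI x I); rewrite mulrC.
  by rewrite -[mulm _ _]/(sm_set (V * vI x I)) mulrC vV.
- by [].
- exact: rba_prufer.
exact: rba_manis.
Defined.
End RBA.

(** * Functors and adjunction *)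

Local Open Scope qs_scope.

Lemma is_qs_homI (R R' : crqsring) (f : R -> R') :
  (forall x y, f (x + y) = f x + f y) -> (forall x y, f (x * y) = f x * f y) ->
  f eps = eps -> is_qs_hom f.
Proof.
move=> fD fM f1; have PA := cq_add (cq_ax R); have PM := cq_mul (cq_ax R).
split=> // x; apply/esym.
  by apply: (crs_invU (cq_add (cq_ax R'))); rewrite -!fD ?(crsK PA) ?(crsV PA).
by apply: (crs_invU (cq_mul (cq_ax R'))); rewrite -!fM ?(crsK PM) ?(crsV PM).
Qed.

Lemma is_RmorI (R R' : crqsring) (f : R -> R') : is_qs_hom f ->
  (forall c, Ep R' c -> exists a b, [/\ Ep R a, Ep R b, f a <= c & c <= f b]) ->
  is_Rmor f.
Proof.
move=> hf h; split=> //; apply/seteqP; split=> [c []|c pc] //.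
split=> //; have [a [b [pa pb ac cb]]] := h c pc.
by exists (f a), (f b); split=> //; [exists a|exists b].
Qed.

Lemma Rmor_hull (R R' : crqsring) (f : R -> R') : is_Rmor f ->
  forall c, Ep R' c -> exists a b, [/\ Ep R a, Ep R b, f a <= c & c <= f b].
Proof.
move=> [_ fH] c; rewrite -{1}fH => -[_ [_ [_ [[a pa <-] [b pb <-] ac cb]]]].
by exists a, b.
Qed.

Lemma is_PmorI (E E' : prufer_ext) (g : {rmorphism E -> E'}) :
  (forall x, re_sub E x -> re_sub E' (g x)) ->
  (forall K : smod E', munit K -> exists I J : smod E,
    [/\ munit I, munit J, K <=s sm_ext g I & sm_ext g J <=s K]) -> is_Pmor g.
Proof.
move=> gA h; split=> //; apply/seteqP; split=> [c []|c Mc] //.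
split=> //; have [K KE uK] := Mstar_smod Mc.
have [I [J [uI uJ KI JK]]] := h K uK.
exists (extm g (sm_set I)), (extm g (sm_set J)); rewrite /mle -KE; split=> //.
  by exists (sm_set I) => //; apply/MstarP_munit.
by exists (sm_set J) => //; apply/MstarP_munit.
Qed.

Lemma Pmor_hull (E E' : prufer_ext) (g : {rmorphism E -> E'}) : is_Pmor g ->
  forall K : smod E', munit K -> exists I J : smod E,
    [/\ munit I, munit J, K <=s sm_ext g I & sm_ext g J <=s K].
Proof.
move=> [_ gH] K /MstarP_munit; rewrite -{1}gH.
move=> [_ [_ [_ [[_ /Mstar_smod[I <- uI] <-] [_ /Mstar_smod[J <- uJ] <-] KI JK]]]].
by exists I, J.
Qed.

Definition mkPhom (E E' : prufer_ext) (g : {rmorphism E -> E'}) (gP : is_Pmor g) :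
  Phom E E' := exist (fun h : {rmorphism E -> E'} => is_Pmor h) g gP.

(** * The functor B on morphisms *)

Section BMap.
Context (R R' : pm_qsring) (f : Rhom R R').
Implicit Types (phi psi : BR R).
Let g := sval f.
Let gh : is_qs_hom g. Proof. by case: (svalP f). Qed.
Let gD := qs_homD gh.
Let gM := qs_homM gh.
Let gN := qs_homN gh.
Local Hint Resolve valP_Ep valP_ge Ep_eps EpV : core.

Lemma hom_Ep (c : R) : Ep R c -> Ep R' (g c).
Proof. by move=> pc; rewrite /Ep /= -gD pc. Qed.
Lemma hom_ep (c : R) : ep (g c) = g (ep c).
Proof. by rewrite /ep -gN -gD. Qed.
Lemma hom_le (c d : R) : c <= d -> g c <= g d.
Proof. exact: qs_hom_le. Qed.
Lemma hom_LamP (c : R) : LamP R c -> LamP R' (g c).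
Proof.
move=> [pc c1]; split; first exact: hom_Ep.
by rewrite -(qs_hom_eps gh); apply: hom_le.
Qed.

Lemma hom_above (a' : LamP R') : exists a : LamP R, val a' <= g (val a).
Proof.
have [_ [c [_ pc _ ac]]] := Rmor_hull (svalP f) (valP_Ep a').
have [a ca] := LamP_above pc; exists a; apply: qle_trans ac _.
exact: hom_le.
Qed.

Definition Bmap_fun phi (a' : LamP R') : R' :=
  g (val phi (sval (cid (hom_above a')))) + val a'.

Lemma Bmap_funE phi (a' : LamP R') (a : LamP R) : val a' <= g (val a) ->
  Bmap_fun phi a' = g (val phi a) + val a'.
Proof.
rewrite /Bmap_fun; case: cid => b /= hb ha.
have aux (b1 b2 : LamP R) : val a' <= g (val b1) -> val b1 <= val b2 ->
    g (val phi b1) + val a' = g (val phi b2) + val a'.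
  move=> h1 h2; apply: qle_restr => //.
    by apply: hom_le; apply: BR_le h2; apply: BRP.
  by rewrite hom_ep (BR_ep _ (BRP phi)).
have [e [ae be]] := LamP_ub a b.
by rewrite (aux _ _ ha ae) (aux _ _ hb be).
Qed.

Lemma Bmap_BR phi : BR_set (Bmap_fun phi).
Proof.
apply: BR_setP => [a'|a' b' ab].
  have [a ha] := hom_above a';
    rewrite (Bmap_funE _ ha) epD hom_ep (BR_ep _ (BRP phi)).
  by rewrite (ep_id (valP_Ep a')); move: ha; rewrite qleE // => <-.
have [b hb] := hom_above b'; rewrite (Bmap_funE _ hb) (@Bmap_funE _ a' b).
  by rewrite -qaddA; congr (_ + _); move: ab; rewrite qleE.
exact: qle_trans hb.
Qed.

Definition Bmap phi : BR R' := mkBR (Bmap_BR phi).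

Lemma Bmap_val phi (a' : LamP R') :
  val (Bmap phi) a' = Bmap_fun phi a'. Proof. by []. Qed.

(** On the image of Lambda the truncation in [Bmap] disappears. Nearly all later computations with
    [Bmap] go through this formula. *)
Lemma ev_Bmap phi (c : R) : Ep R c -> ev (Bmap phi) (g c) = g (ev phi c).
Proof.
move=> pc; have [a ca] := LamP_above pc; have pgc := hom_Ep pc.
have [a' aE] : exists a' :
  LamP R', val a' = g (val a) by apply/LamP_val/hom_LamP/set_valP.
have le : g c <= val a' by rewrite aE; apply: hom_le.
rewrite (evE _ pgc le) Bmap_val (@Bmap_funE _ a' a); last by rewrite aE;
  apply: qle_refl.
by rewrite -qaddA (evE _ pc ca) gD; congr (_ + _); move: le;
  rewrite qleE // => <-.
Qed.

Lemma Bmap_zmod : zmod_morphism Bmap.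
Proof.
move=> phi psi; apply/BR_inj/funext => a'; have [a ha] := hom_above a'.
rewrite Bmap_val (Bmap_funE _ ha).
rewrite -[RHS]/(Bmap_fun phi a' + - Bmap_fun psi a') !(Bmap_funE _ ha).
rewrite qoppD (qopp_id (valP_Ep a')) qaddACA valP_Ep.
by rewrite -[val (phi - psi)%R a]/(val phi a + - val psi a) gD gN.
Qed.

Lemma Bmap_monoid : monoid_morphism Bmap.
Proof.
split.
  apply/BR_inj/funext => a'; have [a ha] := hom_above a'.
  rewrite Bmap_val (Bmap_funE _ ha).
  have [b' bE] : exists b' :
    LamP R', val b' = g (val a) by apply/LamP_val/hom_LamP/set_valP.
  have -> : g (val (1%R : BR R) a) = br_one b'.
    apply: (@Em_inj R'); last by rewrite hom_ep !br_one_ep bE.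
      by rewrite /Em /= -gM; congr g; apply: br_one_Em.
    exact: br_one_Em.
  by rewrite -[RHS]/(br_one a') (BR_restr (BR_one R') (a := a') (b := b')) // bE.
move=> phi psi; apply/BR_inj/funext => a'; have [a ha] := hom_above a'.
rewrite Bmap_val (Bmap_funE _ ha).
rewrite -[RHS]/(br_mul (Bmap_fun phi) (Bmap_fun psi) a').
have [n' h'] := br_mulP a' (Bmap_BR phi) (Bmap_BR psi).
have [n h] := br_mulP a (BRP phi) (BRP psi).
have [m' hm] := hom_above n'; have [b [nb mb]] := LamP_ub n m'.
have [e1 e2 _] := h b nb.
have {hm}nb' : val n' <= g (val b) by apply: qle_trans hm _; apply: hom_le.
have [-> _ _] := h' n' (qle_refl _).
rewrite BRmul_val e1 gD -qaddA.
have -> : g (val a) + val a' = val a' by apply/esym; move: ha; rewrite qleE.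
rewrite !(Bmap_funE _ nb') gM; apply/esym; apply: qle_restr => //.
  by apply: qleMM; apply: qleDl.
have [_ + _] := h' n' (qle_refl _).
by rewrite !(Bmap_funE _ nb').
Qed.

Definition Bmap_rm : {rmorphism BR_ext R -> BR_ext R'} :=
  mk_rmorphism Bmap_zmod Bmap_monoid.

Lemma Bmap_A phi : AR R phi -> AR R' (Bmap phi).
Proof.
move=> /AR_ev h; apply/AR_ev; rewrite -(qs_hom_eps gh) ev_Bmap //.
by rewrite h.
Qed.

Lemma hw_Bmap (I : smod (BR_ext R)) : munit I ->
  hw (pm_prufer R') (sm_ext Bmap_rm I) = g (hw (pm_prufer R) I).
Proof.
move=> uI; have pI := hw_Ep (pm_prufer R) uI.
have uV := munitV uI.
apply: (@hw_ext _ _ _ _ I (sm_inv I)).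
- exact: Bmap_A.
- exact: smulV.
- exact: hom_Ep.
- by move=> phi /(hw_in (pm_prufer R) _ uI) h; rewrite ev_Bmap // h.
move=> phi /(hw_in (pm_prufer R) _ uV); rewrite hwV // => h.
by rewrite -(qs_homV gh) ev_Bmap ?h //; apply: EpV.
Qed.

Lemma Bmap_Pmor : is_Pmor (Bmap_rm : {rmorphism B_ob R -> B_ob R'}).
Proof.
apply: is_PmorI; first exact: Bmap_A.
move=> K uK; have [c [d [pc pd hc hd]]] :=
  Rmor_hull (svalP f) (hw_Ep (pm_prufer R') uK).
have [I [_ [uI _ Ic _]]] := hw_cofinal (pm_prufer R) (pm_manis R) pc.
have [_ [J [_ uJ _ Jd]]] := hw_cofinal (pm_prufer R) (pm_manis R) pd.
exists I, J; split=> //.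
  apply: (hw_le (pR := pm_prufer R')) => //; first exact/munit_ext/uI/Bmap_A.
  by rewrite hw_Bmap //; apply: qle_trans hc; apply: hom_le.
apply: (hw_le (pR := pm_prufer R')) => //; first exact/munit_ext/uJ/Bmap_A.
by rewrite hw_Bmap //; apply: qle_trans hd _; apply: hom_le.
Qed.

Definition B_hom : Phom (B_ob R) (B_ob R') :=  mkPhom Bmap_Pmor.

(** The points [g c] are cofinal in the positive cone of [R'], and the value at a point determines
    the values below it. Identities between ring morphisms into [B_{R'}] are checked in this way. *)
Lemma BR_eq_above (phi' psi' : BR R') :
  (forall c : R, Ep R c -> ev phi' (g c) = ev psi' (g c)) -> phi' = psi'.
Proof.
move=> h; apply/BR_inj/funext => a'; have [a ha] := hom_above a'.
have pa := hom_Ep (valP_Ep a).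
rewrite -!ev_val !(ev_le _ _ pa ha) ?h //.
Qed.
End BMap.

Definition Rob (E : prufer_ext) : pm_qsring := R_ob rba E.

(** * The functor R on morphisms *)

Section RMap.
Context (E E' : prufer_ext) (g : Phom E E').
Implicit Types (x y : E) (I J : smod E).
Let h := sval g.
Let hA : forall x, re_sub E x -> re_sub E' (h x).
Proof. by case: (svalP g). Qed.

Definition Rmap (X : Rob E) : Rob E' :=
  let p := sval (cid (cls_ex X)) in cls (h p.1) (munit_ext hA (svalP p.2)).

Lemma RmapE x I (uI : munit I) : Rmap (cls x uI) = cls (h x) (munit_ext hA uI).
Proof.
rewrite /Rmap; case: cid => -[y [J uJ]] /= /cls_inj[JI xy]; subst J.
apply: cls_eq => //; rewrite -opprB -rmorphB; apply/smN/sm_ext_in => //.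
Qed.

Lemma Rmap_qs_hom : is_qs_hom Rmap.
Proof.
apply: is_qs_homI => [X Y|X Y|].
- have [x [I [uI ->]]] := clsP X; have [y [J [uJ ->]]] := clsP Y.
  rewrite rba_qadd !RmapE rba_qadd; apply: cls_eq; first exact: sm_extD.
  by rewrite rmorphD subrr; apply: sm0.
- have [x [I [uI ->]]] := clsP X; have [y [J [uJ ->]]] := clsP Y.
  rewrite rba_qmul !RmapE rba_qmul; apply: cls_eq.
    by rewrite /mulI !sm_extD ?sm_extM // !sm_ext_pr.
  by rewrite rmorphM subrr; apply: sm0.
rewrite -[qs_eps in LHS]/(cls 0 (munit1 E)) RmapE.
apply: cls_eq; first exact: sm_ext1.
by rewrite rmorph0 subrr; apply: sm0.
Qed.

Lemma Rmap_Rmor : is_Rmor Rmap.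
Proof.
apply: is_RmorI => [|c]; first exact: Rmap_qs_hom.
move=> /rba_Ep[K [uK ->]]; have [I [J [uI uJ KI JK]]] := Pmor_hull (svalP g) uK.
exists (cls 0 uI), (cls 0 uJ); rewrite !RmapE rmorph0.
by split; [exact: rba_Ep0|exact: rba_Ep0| |];
  apply/rba_le; split=> //; rewrite subrr; apply: sm0.
Qed.

Definition R_hom : Rhom (Rob E) (Rob E') := exist _ Rmap Rmap_Rmor.
End RMap.

Section Unit.
Context (E : prufer_ext).

Lemma eta_Pmor : is_Pmor (eta_rm E : {rmorphism E -> B_ob (Rob E)}).
Proof.
apply: is_PmorI => [x /eta_A //|K uK].
have [I [uI KE]] := rba_Ep (hw_Ep (@rba_prufer E) uK).
have uJ : munit (sm_ext (eta_rm E) I) by apply: munit_ext => // x /eta_A.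
have -> : K = sm_ext (eta_rm E) I.
  by apply: (hw_inj (pR := @rba_prufer E)) => //; rewrite hw_eta.
by exists I, I; split.
Qed.

Definition eta_hom : Phom E (B_ob (Rob E)) := mkPhom eta_Pmor.
End Unit.

(** * The counit *)

Section Counit.
Context (R : pm_qsring).
Implicit Types (phi psi : BR R) (I J : smod (BR_ext R)).
Let pR := pm_prufer R.

Lemma ev_eq phi psi c : Ep R c ->
  ev (phi - psi)%R c = c <-> ev phi c = ev psi c.
Proof.
move=> pc; split=> h.
  have -> : phi = (phi - psi + psi)%R by rewrite subrK.
  by rewrite -[in LHS]pc -evD // h -{1}(ev_ep psi pc) qaddC qadd_ep.
by rewrite -[in LHS]pc -evD // evN // h -[LHS]/(ep _) ev_ep.
Qed.

Definition kappa (X : Rob (B_ob R)) : R :=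
  let p := sval (cid (cls_ex X)) in ev p.1 (hw pR (sval p.2)).

Lemma kappaE phi I (uI : munit I) :
  kappa (@cls (B_ob R) phi I uI) = ev phi (hw pR I).
Proof.
rewrite /kappa; case: cid => -[psi [J uJ]] /= /(@cls_inj (B_ob R))[JI xy];
  subst J.
by apply/esym/ev_eq; [exact: hw_Ep|apply/(hw_in pR)].
Qed.

Lemma kappa_qs_hom : is_qs_hom kappa.
Proof.
apply: is_qs_homI => [X Y|X Y|].
- have [x [I [uI ->]]] := clsP X; have [y [J [uJ ->]]] := clsP Y.
  by rewrite rba_qadd !kappaE hwD // evD //; apply: hw_Ep.
- have [x [I [uI ->]]] := clsP X; have [y [J [uJ ->]]] := clsP Y.
  have pI := hw_Ep pR uI; have pJ := hw_Ep pR uJ.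
  have uvI := @munit_vI (B_ob R) x I uI; have uvJ := @munit_vI (B_ob R) y J uJ.
  rewrite rba_qmul !kappaE ev_mul //; congr (ev _ _).
  (* [hw] carries the modulus of the product to the index in [ev_mul], because [hw_pr] turns the
     values [vI] into values [qv]. *)
  rewrite mulI_v hwD ?hwM //; try exact: munitM.
  by rewrite !hw_pr // qaddC.
rewrite -[qs_eps in LHS]/(cls (0 : B_ob R) (munit1 (B_ob R))) kappaE hw1.
by apply: ev0; apply: Ep_eps.
Qed.

Lemma kappa_Rmor : is_Rmor kappa.
Proof.
apply: is_RmorI => [|c pc]; first exact: kappa_qs_hom.
have [I [J [uI uJ Ic cJ]]] := hw_cofinal pR (pm_manis R) pc.
have e0 K (uK : munit K) : kappa (@cls (B_ob R) 0%R K uK) = hw pR K.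
  by rewrite kappaE; apply: ev0; apply: hw_Ep.
by exists (@cls (B_ob R) 0%R I uI), (@cls (B_ob R) 0%R J uJ); split;
  rewrite ?e0 //; apply: rba_Ep0.
Qed.

Definition kappa_hom : Rhom (Rob (B_ob R)) R := exist _ kappa kappa_Rmor.
End Counit.

Definition calR : @functor_on catP catR (R_ob rba).
Proof.
exists (fun E E' (g : Phom E E') => R_hom g) => [E|E E' E'' g f].
  apply/Rhom_eq/funext => X; have [x [I [uI ->]]] := clsP X.
  rewrite [LHS]RmapE; apply: cls_eq; last by rewrite subrr; apply: sm0.
  by apply: sle_anti; [apply/sm_ext_le|move=> y Iy;
    apply: (@sm_ext_in _ _ idfun)].
apply/Rhom_eq/funext => X; have [x [I [uI ->]]] := clsP X.
rewrite [LHS]RmapE [RHS]/= !RmapE; apply: cls_eq; last by rewrite subrr;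
  apply: sm0.
have [gA _] := svalP g.
by apply: smod_set_inj; apply/esym; apply: (extm_comp _ _ gA).
Defined.

Lemma Bmap_id (R : pm_qsring) (f : Rhom R R) phi : sval f = id ->
  Bmap f phi = phi.
Proof.
by move=> fE; apply: (@BR_eq_above R R f) => c pc; rewrite ev_Bmap // fE.
Qed.

Lemma Bmap_comp (R R' R'' : pm_qsring) (g : Rhom R' R'') (f : Rhom R R')
    (k : Rhom R R'') phi : sval k = sval g \o sval f ->
      Bmap k phi = Bmap g (Bmap f phi).
Proof.
move=> kE; apply: (@BR_eq_above R R'' k) => c pc; rewrite ev_Bmap // kE /=.
by rewrite !ev_Bmap //; apply: hom_Ep.
Qed.

Definition calB : @functor_on catR catP B_ob.
Proof.
exists (fun R R' (f : Rhom R R') => B_hom f) => [R|R R' R'' g f].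
  by apply: Phom_eq => phi; apply: Bmap_id.
by apply: Phom_eq => phi; apply: Bmap_comp.
Defined.

Lemma calR_on : R_on_morphisms calR.
Proof.
move=> E E' g X x a /rba_clsP[I [uI [-> ->]]].
by rewrite [sval _ _]RmapE.
Qed.

Lemma calB_on : B_on_morphisms calB.
Proof. by move=> R R' f phi a' a h; apply: Bmap_funE. Qed.

(** * The bijection of the adjunction and its naturality *)

Definition adj_fun (E : prufer_ext) (R : pm_qsring) (f : Rhom (Rob E) R) :
  @Defs.hom catP E (B_ob R) := @Defs.catcomp catP _ _ _ (B_hom f) (eta_hom E).

Definition adj_inv (E : prufer_ext) (R : pm_qsring) (g : Phom E (B_ob R)) :
  @Defs.hom catR (Rob E) R := @Defs.catcomp catR _ _ _ (kappa_hom R) (R_hom g).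

Lemma adj_funK E R : cancel (@adj_fun E R) (@adj_inv E R).
Proof.
move=> f; apply/Rhom_eq/funext => X; have [x [I [uI ->]]] := clsP X.
have [fA _] := svalP (adj_fun f).
rewrite -[LHS]/(kappa (Rmap (adj_fun f) (cls x uI))) RmapE.
rewrite [LHS](@kappaE R (Bmap f (eta_map x)) _ (munit_ext _ uI)).
have pI : Ep (Rob E) (cls 0%R uI) by apply: rba_Ep0.
(* The value is pinned on [I] and on its inverse: the evaluation of [eta_map y] at the class of [0]
   is that class for [y] in the module, and [f] carries this equality over to [R]. *)
have -> : hw (pm_prufer R) (sm_ext (sval (adj_fun f)) I) = sval f (cls 0%R uI).
  apply: (@hw_ext _ _ _ _ I (sm_inv I)) => //.
  - exact: smulV.
  - exact: hom_Ep.
  - move=> y Iy; rewrite -[LHS]/(ev (Bmap f (eta_map y)) _) ev_Bmap //.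
    by congr (sval f _); apply: ev_eta_id.
  have [fh _] := svalP f.
  move=> y Vy; rewrite -[LHS]/(ev (Bmap f (eta_map y)) _) -(qs_homV fh) ev_Bmap;
    last exact: EpV.
  by congr (sval f _); rewrite (cls0V uI (munitV uI)); apply: ev_eta_id.
by rewrite ev_Bmap //; congr (sval f _); apply: ev_eta.
Qed.

Lemma adj_invK E R : cancel (@adj_inv E R) (@adj_fun E R).
Proof.
move=> g; apply: Phom_eq => x.
have [gA _] := svalP g.
apply: (@BR_eq_above _ _ (adj_inv g)) => c /rba_Ep[I [uI ->]].
have pI : Ep (Rob E) (cls 0%R uI) by apply: rba_Ep0.
rewrite -[LHS]/(ev (Bmap (adj_inv g) (eta_map x)) _) (ev_Bmap _ _ pI).
have -> : ev (eta_map x) (cls 0%R uI) = cls x uI by apply: ev_eta.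
have h y : sval (adj_inv g) (cls y uI) =
    ev (sval g y) (hw (pm_prufer R) (sm_ext (sval g) I)).
  rewrite -[LHS]/(kappa (Rmap g (cls y uI))) RmapE.
  exact: kappaE.
(* With [y := 0], the formula [h] identifies the point of evaluation on the right with the value of
   the extended module. *)
by rewrite !h rmorph0 ev0 //; apply/hw_Ep/munit_ext.
Qed.

Lemma adj_fun_bij E R : bijective (@adj_fun E R).
Proof. by exists (@adj_inv E R); [exact: adj_funK|exact: adj_invK]. Qed.

Lemma Rmap_cls (E E' : prufer_ext) (h : Phom E E') (I : smod E) (uI : munit I)
    (uJ : munit (sm_ext (sval h) I)) x : Rmap h (cls x uI) = cls (sval h x) uJ.
Proof. by rewrite RmapE; apply: cls_eq; rewrite ?subrr //; apply: sm0. Qed.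

Lemma Bmap_eta (E E' : prufer_ext) (R : pm_qsring) (h : Phom E' E)
    (f : Rhom (Rob E) R) (k : Rhom (Rob E') R) (x : E') :
  sval k = sval f \o Rmap h -> Bmap k (eta_map x) = Bmap f (eta_map (sval h x)).
Proof.
move=> kE; apply: (@BR_eq_above _ _ k) => c pc.
rewrite (ev_Bmap k (eta_map x) pc) kE /=.
move: pc => /rba_Ep[I [uI ->]]; have [hA _] := svalP h.
have uJ := munit_ext hA uI.
have pJ : Ep (Rob E) (cls 0%R uJ) by apply: rba_Ep0.
rewrite (Rmap_cls _ uJ) (rmorph0 (sval h)) (ev_Bmap f _ pJ); congr (sval f _).
by rewrite (ev_eta x uI) (Rmap_cls _ uJ); apply/esym/ev_eta.
Qed.

Lemma adj_fun_natl (E E' : catP) (R : catR) (h : Defs.hom E' E)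
    (f : Defs.hom (Rob E : catR) R) :
  adj_fun (Defs.catcomp f (calR E' E h)) = Defs.catcomp (adj_fun f) h.
Proof. by apply: Phom_eq => x; apply: Bmap_eta. Qed.

Lemma adj_fun_natr (E : catP) (R R' : catR) (k : Defs.hom R R')
    (f : Defs.hom (Rob E : catR) R) :
  adj_fun (Defs.catcomp k f) = Defs.catcomp (calB R R' k) (adj_fun f).
Proof.
rewrite /adj_fun Defs.compA; congr Defs.catcomp.
exact: (fmapM calB k f).
Qed.

Definition adj : adjunction calR calB.
Proof.
exists adj_fun.
- exact: adj_fun_bij.
- exact: adj_fun_natl.
exact: adj_fun_natr.
Defined.

Lemma adj_unitE (E : prufer_ext) (x : E) :
  sval (adj_unit adj E : Phom E (B_ob (Rob E))) x = eta_map x.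
Proof. exact: Bmap_id. Qed.

(** * Completeness and the equivalence *)

Section Limits.
Context (E : ringext).
Implicit Types (I J K : smod E) (X : MstarP E -> set E).
Local Open Scope ring_scope.

Lemma MstarP_ex I : munit I -> I <=s 1 -> exists m : MstarP E, val m = sm_set I.
Proof.
move=> uI I1; have h : MstarP E (sm_set I) by split; [apply/MstarP_munit|].
by pose m : MstarP E := exist _ (sm_set I) (mem_set h); exists m.
Qed.

Lemma MstarP_smod (m : MstarP E) :
  exists I, [/\ munit I, I <=s 1 & val m = sm_set I].
Proof.
have [/Mstar_smod[I IE uI] h] := set_valP m; exists I; split=> //.
by move=> x Ix; apply: h; rewrite -IE.
Qed.

Lemma modclass_self (x : E) I : modclass x (sm_set I) x.
Proof. by exists 0; [exact: sm0|rewrite addr0]. Qed.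

Lemma modclass_in (x y : E) I : modclass x (sm_set I) y <-> I (y - x).
Proof.
split=> [[a Ia <-]|h]; first by rewrite addrC addKr.
by exists (y - x) => //; rewrite addrC subrK.
Qed.

Lemma limB_restr X (m k : MstarP E) I K (x y : E) : limB E X ->
  val m = sm_set I -> val k = sm_set K -> K <=s I ->
  X m = modclass x (sm_set I) -> X k = modclass y (sm_set K) -> I (y - x).
Proof.
move=> [_ XM] mE kE KI xE yE; apply/modclass_in; rewrite -xE.
by apply: (XM k m); rewrite ?mE ?kE // yE; apply: modclass_self.
Qed.

Lemma to_lim_limB (b : E) : limB E (to_lim b).
Proof.
split=> [a|a a' aa']; first by exists b.
by move=> _ [y ay <-]; exists y => //; apply: aa'.
Qed.

(** [A] is itself one of the moduli: a limit whose classes come from [A] is the image of some [b]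
    congruent modulo [A] to an element of [A]. *)
Lemma ext_complete_limB : set_bij setT (limB E) to_lim -> ext_complete E.
Proof.
move=> [h1 h2 h3]; split=> //; split.
- move=> b Ab; split; first exact: to_lim_limB.
  by move=> a; exists b.
- by move=> x y _ _; apply: h2; rewrite in_setT.
move=> X [/h3[b _ bX] XA]; exists b => //.
have [m mE] := @MstarP_ex 1 (munit1 E) (fun x => id).
have [c Ac] := XA m; rewrite -bX /to_lim mE => /modclass_eq bc.
by rewrite -[b](subrK c); apply: subD.
Qed.
End Limits.

(** * Completeness of the extension [A_R] in [B_R] *)

Section Complete.
Context (R : pm_qsring).
Implicit Types (phi psi : BR R) (I J K : smod (BR_ext R)).
Let pR := pm_prufer R.
Local Hint Resolve valP_Ep valP_ge Ep_eps EpV : core.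

Lemma hw_above (a : LamP R) :
  exists I, [/\ munit I, I <=s 1%R & val a <= hw pR I].
Proof.
have [_ [I [_ uI _ aI]]] := hw_cofinal pR (pm_manis R) (valP_Ep a).
exists I; split=> //; apply: (hw_le (pR := pR)) => //; first exact: munit1.
by rewrite hw1; apply: qle_trans (valP_ge a) aI.
Qed.

Lemma hw_LamP I : munit I -> I <=s 1%R -> exists a : LamP R, val a = hw pR I.
Proof.
move=> uI I1; apply/LamP_val; split; first exact: hw_Ep.
by rewrite -(hw1 pR); apply: hw_anti => //; apply: munit1.
Qed.

(** A compatible family [X] prescribes the value of [phi] at [a]: evaluate at [a] any representative
    of [X] modulo an [I] with [hw I >= a]. Such [I] exist by cofinality, and two of them give the
    same value because both can be compared with the modulus [I * J]. *)
Lemma BR_complete : ext_complete (BR_ext R).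
Proof.
apply: ext_complete_limB; split.
- by move=> b _; apply: to_lim_limB.
- move=> b b' _ _ bb'; apply/BR_inj/funext => a.
  have [I [uI I1 aI]] := hw_above a; have [m mE] := MstarP_ex uI I1.
  have := congr1 (@^~ m) bb'; rewrite /to_lim mE => /modclass_eq.
  have pI := hw_Ep pR uI.
  move=> /(hw_in pR _ uI)/(ev_eq _ _ pI) E0.
  by rewrite -!ev_val !(ev_le _ (valP_Ep a) pI aI) E0.
move=> X XB.
pose P (a : LamP R) (z : R) :=
  forall I (m : MstarP (BR_ext R)) (x : BR_ext R), munit I ->
  I <=s 1%R -> val m = sm_set I -> val a <= hw pR I ->
    X m = modclass x (sm_set I) ->
  z = ev x (val a).
have exP a : exists z, P a z.
  have [J [uJ J1 aJ]] := hw_above a; have [k kE] := MstarP_ex uJ J1.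
  have [y yE] := proj1 XB k; rewrite kE in yE.
  exists (ev y (val a)) => I m x uI I1 mE aI xE.
  have uK := munitM uI uJ.
  have KI : (I * J)%R <=s I by rewrite -[X in _ <=s X]mulr1; apply: sle_mul.
  have KJ : (I * J)%R <=s J by rewrite -[X in _ <=s X]mul1r; apply: sle_mul.
  have [l lE] := MstarP_ex uK (sle_trans KI I1).
  have [b bE] := proj1 XB l; rewrite lE in bE.
  have aux (L : smod (BR_ext R)) z (n : MstarP (BR_ext R)) : munit L ->
    val n = sm_set L -> val a <= hw pR L ->
      (I * J)%R <=s L -> X n = modclass z (sm_set L) ->
        ev z (val a) = ev b (val a).
    move=> uL nE aL KL zE; have pL := hw_Ep pR uL.
    have := limB_restr XB nE lE KL zE bE.
    move=> /(hw_in pR _ uL)/(ev_eq _ _ pL) E0.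
    by rewrite !(ev_le _ (valP_Ep a) pL aL) E0.
  by rewrite (aux J y k) // (aux I x m).
have [phi Pphi] := choice exP.
have phiB : BR_set phi.
  apply: BR_setP => [a|a b ab].
    have [I [uI I1 aI]] := hw_above a; have [m mE] := MstarP_ex uI I1.
    have [x xE] := proj1 XB m; rewrite mE in xE.
    by rewrite (Pphi a I m x) // ev_ep.
  have [I [uI I1 bI]] := hw_above b; have [m mE] := MstarP_ex uI I1.
  have [x xE] := proj1 XB m; rewrite mE in xE.
  have aI := qle_trans ab bI.
  by rewrite (Pphi a I m x) // (Pphi b I m x) // (ev_le x _ _ ab).
exists (mkBR phiB) => //; apply/funext => m.
have [I [uI I1 mE]] := MstarP_smod m; have [x xE] := proj1 XB m.
rewrite /to_lim xE mE; rewrite mE in xE; apply/modclass_eq.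
have pI := hw_Ep pR uI; apply/(hw_in pR _ uI)/ev_eq => //.
have [a aE] := hw_LamP uI I1.
rewrite -aE ev_val; apply: Pphi mE _ xE => //.
by rewrite aE; apply: qle_refl.
Qed.
End Complete.

(** * The ring extension of [R_{B/A}] as the completion *)

Section CompletionMap.
Context (E : prufer_ext).
Implicit Types (x y : E) (I J K : smod E) (phi : BR (rba_sr E)) (m : MstarP E).

(** The value of [phi] at the modulus [m], as a coset. Since [m] is a bare set, the condition ranges
    over all invertible modules that it underlies; there is only one. *)
Definition psi_map phi m : set E :=
  [set x | forall I (uI : munit I), val m = sm_set I ->
    ev phi (cls 0%R uI) = cls x uI].

Lemma psi_mapE phi m x I (uI : munit I) : val m = sm_set I ->
  ev phi (cls 0%R uI) = cls x uI -> psi_map phi m = modclass x (sm_set I).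
Proof.
move=> mE xE; apply/seteqP; split=> y.
  move=> /(_ I uI mE); rewrite xE => /cls_inj[_ h].
  by apply/modclass_in; rewrite -opprB; apply: smN.
move=> /modclass_in h J uJ; rewrite mE => /smod_set_inj JI; subst J.
have <- : cls 0%R uI = cls 0%R uJ by apply: cls_eq; rewrite ?subrr //;
  apply: sm0.
by rewrite xE; apply: cls_eq => //; rewrite -opprB; apply: smN.
Qed.

Lemma psi_map_ex phi m :
  exists x I (uI : munit I), [/\ I <=s 1%R, val m = sm_set I,
  ev phi (cls 0%R uI) = cls x uI & psi_map phi m = modclass x (sm_set I)].
Proof.
have [I [uI I1 mE]] := MstarP_smod m; have [x xE] := ev_cls phi uI.
by exists x, I, uI; split=> //; apply: psi_mapE xE.
Qed.

Lemma psi_map_limB phi : limB E (psi_map phi).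
Proof.
split=> [m|m k km].
  by have [x [I [uI [_ -> _ ->]]]] := psi_map_ex phi m; exists x.
have [x [I [uI [_ mE xE ->]]]] := psi_map_ex phi m.
have [y [J [uJ [_ kE yE ->]]]] := psi_map_ex phi k.
move: km; rewrite mE kE => IJ z /modclass_in zx; apply/modclass_in.
have -> : (z - y = (z - x) + (x - y))%R by rewrite addrA subrK.
apply: smD; first exact: IJ.
have pI : Ep (rba_sr E) (cls 0%R uI) by apply: rba_Ep0.
have pJ : Ep (rba_sr E) (cls 0%R uJ) by apply: rba_Ep0.
have le : @qle (rba_sr E) (cls 0%R uJ) (cls 0%R uI).
  by apply/rba_le; split=> //; rewrite subrr; apply: sm0.
have := ev_le phi pJ pI le; rewrite xE yE rba_restr // => /cls_inj[_ h].
by rewrite -opprB; apply: smN.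
Qed.

Lemma psi_map_inj phi phi' : psi_map phi = psi_map phi' -> phi = phi'.
Proof.
move=> h; apply/BR_inj/funext => a; have [I [uI [aE I1]]] := LamP_cls a.
have [m mE] := MstarP_ex uI I1; have [x xE] := ev_cls phi uI.
rewrite -!ev_val aE xE.
have : psi_map phi m x by rewrite (psi_mapE mE xE); apply: modclass_self.
by rewrite h => /(_ I uI mE).
Qed.

Lemma psi_map_surj X : limB E X -> exists phi, psi_map phi = X.
Proof.
move=> XB.
pose P (a : LamP (rba_sr E)) (z : rba_sr E) := forall I (uI : munit I) m x,
  val a = cls 0%R uI -> val m = sm_set I -> X m = modclass x (sm_set I) ->
    z = cls x uI.
have exP a : exists z, P a z.
  have [I [uI [aE I1]]] := LamP_cls a; have [m mE] := MstarP_ex uI I1.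
  have [x xE] := proj1 XB m; exists (cls x uI) => J uJ k y.
  rewrite aE => /cls_inj[JI _] kE yE; apply: cls_eq => //; subst J.
  have km : k = m by apply: val_inj; rewrite mE.
  by apply/modclass_eq; rewrite -mE -xE -km yE kE.
have [f Pf] := choice exP.
have fB : BR_set f.
  apply: BR_setP => [a|a b].
    have [I [uI [aE I1]]] := LamP_cls a; have [m mE] := MstarP_ex uI I1.
    have [x xE] := proj1 XB m; rewrite mE in xE.
    by rewrite (Pf a I uI m x) // aE; apply: rba_ep.
  have [I [uI [aE I1]]] := LamP_cls a; have [m mE] := MstarP_ex uI I1.
  have [J [uJ [bE J1]]] := LamP_cls b; have [k kE] := MstarP_ex uJ J1.
  have [x xE] := proj1 XB m; rewrite mE in xE.
  have [y yE] := proj1 XB k; rewrite kE in yE.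
  rewrite (Pf a I uI m x) // (Pf b J uJ k y) // aE bE => /rba_le[JI _].
  rewrite rba_restr //; apply: cls_eq => //; rewrite -opprB; apply: smN.
  exact: limB_restr XB mE kE JI xE yE.
exists (mkBR fB); apply/funext => m.
have [I [uI I1 mE]] := MstarP_smod m; have [a aE] := LamP_of_cls uI I1.
have [x xE] := proj1 XB m; rewrite xE mE; rewrite mE in xE.
apply: (psi_mapE (uI := uI)) => //.
by rewrite -aE ev_val; apply: Pf aE mE xE.
Qed.

Lemma psi_map_A phi : AR (rba_sr E) phi <-> limA E (psi_map phi).
Proof.
have p1 := @Ep_eps (rba_sr E).
split=> [/AR_ev h|[_ h]].
  split=> [|m]; first exact: psi_map_limB.
  have [x [I [uI [I1 mE xE ->]]]] := psi_map_ex phi m.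
  exists x; last by rewrite mE.
  have pI : Ep (rba_sr E) (cls 0%R uI) by apply: rba_Ep0.
  have le : @qle (rba_sr E) eps (cls 0%R uI).
    by apply/rba_le; split=> //; rewrite subrr; apply: sm0.
  have := ev_le phi p1 pI le; rewrite h xE rba_restr // => /cls_inj[_].
  by rewrite sub0r => /smN; rewrite opprK.
have [m mE] := MstarP_ex (munit1 E) (sle_refl (I := 1%R)).
have [b Ab] := h m.
have [x xE] := ev_cls phi (munit1 E);
  rewrite (psi_mapE mE xE) mE => /modclass_eq xb.
apply/AR_ev; rewrite [LHS]xE; apply: cls_eq => //; rewrite subr0.
by rewrite -[x](subrK b); apply: smD.
Qed.

Lemma psi_map_eta x : psi_map (eta_map x) = to_lim x.
Proof.
apply/funext => m; have [I [uI I1 mE]] := MstarP_smod m.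
by rewrite (psi_mapE mE (ev_eta x uI)) /to_lim mE.
Qed.

Lemma psi_map_completion : @is_completion E (BR_ext (rba_sr E)) psi_map.
Proof.
split.
- split; first by move=> phi _; apply: psi_map_limB.
    by move=> phi phi' _ _; apply: psi_map_inj.
  by move=> X /psi_map_surj[phi <-]; exists phi.
- split; first by move=> phi /psi_map_A.
    by move=> phi phi' _ _; apply: psi_map_inj.
  move=> X XA; have [phi E0] := psi_map_surj (proj1 XA).
  by exists phi => //; apply/psi_map_A; rewrite E0.
- move=> phi phi' m; have [x [I [uI [I1 mE xE ->]]]] := psi_map_ex phi m.
  have [y yE] := ev_cls phi' uI; rewrite (psi_mapE mE yE).
  have pI : Ep (rba_sr E) (cls 0%R uI) by apply: rba_Ep0.
  have xyE : ev (phi + phi')%R (cls 0%R uI) = cls (x + y)%R uI.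
    rewrite -[in LHS]pI -(evD phi phi' pI pI) xE yE rba_qadd.
    by apply: cls_eq; rewrite ?addss // subrr; apply: sm0.
  rewrite (psi_mapE mE xyE); apply/seteqP; split=> z.
    move=> [a Ia <-]; exists x; first exact: modclass_self.
    by exists (y + a)%R; [exists a|rewrite addrA].
  move=> [_ [a Ia <-] [_ [b Ib <-] <-]]; exists (a + b)%R; first exact: smD.
  by rewrite addrACA.
move=> phi phi' m; have [I [uI I1 mE]] := MstarP_smod m.
have [a aE] := LamP_of_cls uI I1.
have [n h] := br_mulP a (BRP phi) (BRP phi');
  have [E0 le _] := h n (qle_refl _).
have [J [uJ [nE J1]]] := LamP_cls n; have [k kE] := MstarP_ex uJ J1.
(* [k] is the modulus [n] of [br_mulP], at which the product of the two values restricts to the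
   value of the product at [m]. *)
exists k => b b' /(_ J uJ kE) + /(_ J uJ kE).
rewrite -nE !ev_val => bE bE'.
have xyE : ev (phi * phi')%R (cls 0%R uI) = cls (b * b')%R uI.
  rewrite -aE ev_val BRmul_val E0.
  move: le; rewrite bE bE' rba_qmul rba_ep aE => /rba_le[JI _].
  exact: rba_restr.
by rewrite (psi_mapE mE xyE); apply: modclass_self.
Qed.
End CompletionMap.

(** * Invertibility of the unit and the counit *)

Lemma naturally_isomorphic_sym (C D : category) (F G : C -> D)
    (Fm : functor_on F) (Gm : functor_on G) :
  naturally_isomorphic Fm Gm -> naturally_isomorphic Gm Fm.
Proof.
move=> [t [tN tI]]; pose s a := sval (cid (tI a)).
have sP a := svalP (cid (tI a)); exists s; split=> [a b f|a].
  have [ts _] := sP a; have [_ st] := sP b.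
  rewrite -[LHS]compm1 -ts Defs.compA -(Defs.compA (s b)) -tN Defs.compA st.
  by rewrite comp1m.
by have [ts st] := sP a; exists (t a).
Qed.

Lemma inj_surj_bij (T U : Type) (f : T -> U) :
  injective f -> (forall y, exists x, f x = y) -> bijective f.
Proof.
move=> fI fS; have [g gP] := choice fS; exists g => // x.
by apply: fI; rewrite gP.
Qed.

Lemma P_iso (E E' : catP) (g : Defs.hom E E') :
  bijective (sval (g : Phom E E')) ->
  (forall x, re_sub E' (sval (g : Phom E E') x) -> re_sub E x) -> is_iso g.
Proof.
move=> [f fK gK] gA.
have fB : zmod_morphism f by apply: can2_zmod_morphism.
have fM : monoid_morphism f by apply: can2_monoid_morphism.
pose h : {rmorphism E' -> E} := mk_rmorphism fB fM.
have hA y : re_sub E' y -> re_sub E (h y) by move=> Ay; apply: gA;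
  rewrite /= gK.
have [gA' _] := svalP (g : Phom E E').
have hP : is_Pmor h.
  apply: is_PmorI => // K uK.
  (* [K] is the extension along [h] of its own extension along [g], so it bounds itself from both
     sides. *)
  exists (sm_ext (sval (g : Phom E E')) K), (sm_ext (sval (g : Phom E E')) K).
  have uK' := munit_ext gA' uK.
  have -> : sm_ext h (sm_ext (sval (g : Phom E E')) K) = K.
    apply: smod_set_inj.
    rewrite -[LHS]/(extm h (extm (sval (g : Phom E E')) (sm_set K))).
    rewrite extm_comp // -[RHS]extm_id; last exact: munit_Mon.
    by congr extm; apply/funext => x /=; apply: fK.
  by split.
by exists (mkPhom hP); split; apply: Phom_eq => x; [apply: gK|apply: fK].
Qed.

Lemma R_iso (R R' : catR) (f : Defs.hom R R') :
  bijective (sval (f : Rhom R R')) -> is_iso f.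
Proof.
move=> [g fK gK]; have [fh _] := svalP (f : Rhom R R').
have gP : is_Rmor g.
  apply: is_RmorI => [|c pc]; first split=> [x y|x y|x|x|].
  - by apply: (can_inj fK); rewrite (qs_homD fh) !gK.
  - by apply: (can_inj fK); rewrite (qs_homM fh) !gK.
  - by apply: (can_inj fK); rewrite (qs_homN fh) !gK.
  - by apply: (can_inj fK); rewrite (qs_homV fh) !gK.
  - by apply: (can_inj fK); rewrite (qs_hom_eps fh) gK.
  exists (sval (f : Rhom R R') c), (sval (f : Rhom R R') c); rewrite fK.
  by split; try exact: hom_Ep; apply: qle_refl.
by exists (exist _ g gP : Rhom R' R); split; apply: Rhom_eq; apply/funext.
Qed.

Lemma BR_ob_complete (R : catR) : in_CP (B_ob R).
Proof. exact: BR_complete. Qed.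

Lemma rba_complete (E : prufer_ext) : qs_complete (rba_sr E).
Proof.
move=> X; have [x [I [uI ->]]] := clsP X.
have phiE (b : Ep (rba_sr E)) K (uK : munit K) : val b = cls 0%R uK ->
    cls x (svalP (idl (val b))) = cls x uK.
  by move=> bE; apply: cls_eq; rewrite ?bE ?idl_cls // subrr; apply: sm0.
exists (fun b : Ep (rba_sr E) => cls x (svalP (idl (val b)))); split.
- move=> b; have [K [uK bE]] := rba_Ep (set_valP b).
  by rewrite (phiE _ _ _ bE) bE; apply: rba_ep.
- move=> b c; have [K [uK bE]] := rba_Ep (set_valP b).
  have [L [uL cE]] := rba_Ep (set_valP c).
  rewrite (phiE _ _ _ bE) (phiE _ _ _ cE) bE cE => /rba_le[LK _].
  by apply/rba_le; split=> //; rewrite subrr; apply: sm0.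
by move=> b; rewrite rba_ep => bE; apply: phiE.
Qed.

Lemma Rob_in_CR (E : catP) : in_CR (Rob E).
Proof. by split; [apply: rba_complete|apply: rba_strong]. Qed.

Lemma eta_iso (E : catP) : in_CP E -> @is_iso catP E (B_ob (Rob E)) (eta_hom E).
Proof.
move=> [_ [_ toI toS]]; apply: P_iso; last by move=> x h; apply/eta_A/h.
apply: inj_surj_bij => [x y xy|phi].
  apply: toI; rewrite ?in_setT // -!psi_map_eta; congr psi_map; exact: xy.
have [x _ xE] := toS _ (psi_map_limB phi); exists x.
by apply: psi_map_inj; rewrite [LHS]psi_map_eta.
Qed.

(** For injectivity, [ep] recovers the value and hence the ideal. For surjectivity at [x], the
    strong property gives an ideal of value [ep x], and completeness extends [x] to a compatible
    family on Lambda, whose restriction to the positive cone is the required element of [B_R]. *)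
Lemma kappa_iso (R : catR) : in_CR R ->
  @is_iso catR (Rob (B_ob R)) R (kappa_hom R).
Proof.
move=> [cR sR]; apply: R_iso; apply: inj_surj_bij => [X Y|x].
  have [phi [I [uI ->]]] := clsP X; have [psi [J [uJ ->]]] := clsP Y.
  rewrite -[LHS]/(kappa _) -[RHS]/(kappa _) !kappaE => E0.
  have pI := hw_Ep (pm_prufer R) uI; have pJ := hw_Ep (pm_prufer R) uJ.
  have IJ : I = J.
    by apply: (hw_inj (pR := pm_prufer R)) => //; have := congr1 (@ep R) E0;
      rewrite !ev_ep.
  subst J; apply: cls_eq => //.
  by apply/(hw_in (pm_prufer R) _ uI)/ev_eq.
have [f [fe fm fx]] := cR x.
have px := Ep_ep x.
have [I uI Ix] := hw_surj (pm_prufer R) sR px.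
pose e (c : R) (pc : Ep R c) : Ep R := exist _ c (mem_set pc).
pose phi (a : LamP R) : R := f (e _ (valP_Ep a)).
have phiB : BR_set phi.
  by split=> [a|a b ab]; [rewrite fe|apply: fm].
exists (@cls (B_ob R) (mkBR phiB : BR R) I uI).
rewrite -[LHS]/(kappa _) kappaE Ix.
have [a xa] := LamP_above px; rewrite (evE _ px xa).
rewrite -[RHS](fx (e _ px)) //.
have := fm (e _ px) (e _ (valP_Ep a)) xa.
by rewrite /qle fe => ->.
Qed.

Lemma eta_natural (E E' : catP) (g : Defs.hom E E') :
  Defs.catcomp (eta_hom E' : Defs.hom (E' : catP) (B_ob (Rob E') : catP)) g =
  Defs.catcomp (calB (Rob E) (Rob E') (calR E E' g)) (eta_hom E).
Proof.
apply: Phom_eq => x; apply/esym.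
have := @Bmap_eta E' E (Rob E') g (idm (Rob E' : catR)) (R_hom g) x erefl.
by rewrite (@Bmap_id _ (idm (Rob E' : catR))).
Qed.

Lemma kappa_natural (R R' : catR) (f : Defs.hom R R') :
  Defs.catcomp (kappa_hom R' : Defs.hom (Rob (B_ob R') : catR) R')
    (calR (B_ob R) (B_ob R') (calB R R' f)) =
  Defs.catcomp f (kappa_hom R).
Proof.
apply/Rhom_eq/funext => X; have [phi [I [uI ->]]] := clsP X.
rewrite -[LHS]/(kappa (Rmap (B_hom f) (cls phi uI))).
rewrite -[RHS]/(sval f (kappa (cls phi uI))).
rewrite RmapE !kappaE (hw_Bmap f uI) ev_Bmap //.
exact: hw_Ep.
Qed.
Theorem theorem7p2 :
  exists (S : forall E : prufer_ext, RBA E)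
         (calR : @functor_on catP catR (R_ob S))
         (calB : @functor_on catR catP B_ob),
    R_on_morphisms calR /\ B_on_morphisms calB /\
    (* (1) *)
    exists t : adjunction calR calB,
      (* (2) *)
      (forall E : prufer_ext,
         in_CP (B_ob (R_ob S E)) /\
         exists psi : B_ob (R_ob S E) -> MstarP E -> set E,
           is_completion psi /\
           forall b : E, psi (sval (adj_unit t E : Phom E (B_ob (R_ob S E))) b)
                         = to_lim b) /\
      (* (3) *)
      exists (hR : forall E : catP, in_CP E -> in_CR (R_ob S E))
             (hB : forall R : catR, in_CR R -> in_CP (B_ob R)),
        inverse_equivalences (functor_restrict hR calR) (functor_restrict hB calB).
Proof.
exists rba, calR, calB; split; first exact: calR_on.
split; first exact: calB_on.
exists adj; split=> [E|].
  split; first exact: (BR_ob_complete (Rob E)).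
  exists (@psi_map E); split; first exact: psi_map_completion.
  by move=> b; rewrite adj_unitE psi_map_eta.
exists (fun E _ => Rob_in_CR E), (fun R _ => BR_ob_complete R); split.
  (* The unit starts at the identity functor, so it gives the inverse of the isomorphism asked
     for. *)
  apply: naturally_isomorphic_sym.
  exists (fun E => eta_hom (sval E)); split=> [E E' g|E]; first exact: eta_natural.
  exact: eta_iso (svalP E).
exists (fun R => kappa_hom (sval R)); split=> [R R' f|R]; first exact: kappa_natural.
exact: kappa_iso (svalP R).
Qed.
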